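(* Let $\underline\alpha\in\underline{\mathcal A}$ be an admissible strategy profile, with $\alpha^x_\cdot=\underline\alpha(x,\cdot,\mathbb B^x)$, and consider the graphon SDE system $$dX^{\underline\alpha,x}_t=\big(a(x)X^{\underline\alpha,x}_t+b(x)\alpha^x_t+c(x)Z^{\underline\alpha,x}_t\big)dt+dB^x_t,\quad X^{\underline\alpha,x}_0=\xi^x,\qquad Z^{\underline\alpha,x}_t=\int_I w(x,y)X^{\underline\alpha,y}_t\,\lambda(dy),\quad t\in[0,T].\qquad( * )$$ Let $\mathbb X^{\underline\alpha}$ be the unique solution of $( * )$ in $L^2_\boxtimes(\Omega\times I;E)$ and let $\mathbb Z^{\underline\alpha}$ be the corresponding aggregate. Then: 1. $\mathbb Z^{\underline\alpha}$ is $\mathbb P\boxtimes\lambda$-a.s. equal to a deterministic function in $L^2_\lambda(I;E)$: there is $\widetilde f\in L^2_\lambda(I;E)$ such that, with $f(\omega,x):=\widetilde f(x)$ for $(\omega,x)\in\Omega\times I$, $$\mathbb P\boxtimes\lambda\big(\|\mathbb Z^{\underline\alpha}-f\|_E=0\big)=1.$$ 2. There exists a unique pair $(X^{\underline\alpha,x})_{x\in I}$, $(Z^{\underline\alpha,x})_{x\in I}$ of versions of $\mathbb X^{\underline\alpha}$ and $\mathbb Z^{\underline\alpha}$, respectively, solving the system $( * )$ for all $x\in I$ in the standard $L^2(\Omega;E)$-sense. 3. Moreover, $Z^{\underline\alpha,\cdot}$ is an everywhere deterministic version of $\mathbb Z^{\underline\alpha}$.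
   Context: **Fubini extension.** Let $T>0$ and let $I\subset\mathbb R$ be a closed bounded interval, with Borel $\sigma$-field $\mathcal B_I$ and normalized Lebesgue measure $\lambda_I$. Given probability spaces $(\Omega,\mathcal F,\mathbb P)$ and $(I,\mathcal I,\lambda)$, a probability space $(\Omega\times I,\mathcal W,\mathbb Q)$ extending $(\Omega\times I,\mathcal F\otimes\mathcal I,\mathbb P\otimes\lambda)$ is a Fubini extension if for every real $\mathbb Q$-integrable $f$: (i) $f(\cdot,x)$ is $\mathbb P$-integrable for $\lambda$-a.e. $x$ and $f(\omega,\cdot)$ is $\lambda$-integrable for $\mathbb P$-a.e. $\omega$; (ii) $x\mapsto\int_\Omega f(\omega,x)d\mathbb P$ is $\lambda$-integrable, $\omega\mapsto\int_I f(\omega,x)d\lambda$ is $\mathbb P$-integrable, and both iterated integrals equal $\int f\,d\mathbb Q$. (The same holds for Bochner integrals of functions valued in a separable Banach space.) Random variables $(f_x)_{x\in I}$ are essentially pairwise independent (e.p.i.) if for $\lambda$-a.e. $x$, $f_x$ is independent of $f_y$ for $\lambda$-a.e. $y$. Fix $(I,\mathcal I,\lambda)$ extending $(I,\mathcal B_I,\lambda_I)$, $(\Omega,\mathcal F,\mathbb P)$, and a Fubini extension denoted $(\Omega\times I,\mathcal F\boxtimes\mathcal I,\mathbb P\boxtimes\lambda)$ such that, for every Polish $S$ and measurable $\varphi:(I,\mathcal I)\to\mathcal P(S)$, there is an $\mathcal F\boxtimes\mathcal I$-measurable process $\Omega\times I\to S$ whose $x$-sections are e.p.i. with law $\varphi(x)$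 for all $x\in I$ (these are known to exist). **Noise.** $E:=C([0,T];\mathbb R)$ with the sup norm $\|\cdot\|_E$, $S:=E\times\mathbb R$; for $\sigma\in S$ write $\sigma=([\sigma]_1,[\sigma]_2)$. $\nu:I\to\mathcal P(\mathbb R)$ is $\mathcal I$-measurable. $\mathbb B:\Omega\times I\to S$, $\mathbb B^x=(B^x,\xi^x)$, is an $\mathcal F\boxtimes\mathcal I$-measurable process with e.p.i. sections such that $\mathbb B^x$ has law (Wiener measure)$\,\otimes\,\nu(x)$ for all $x\in I$. $\mathbb F^x$ is the filtration generated by $\mathbb B^x$ (i.e. by $\xi^x$ and the Brownian motion $B^x$). **Spaces.** $L^2_\boxtimes(\Omega\times I;E)$: equivalence classes of $(\mathcal F\boxtimes\mathcal I,\mathcal B(E))$-measurable, $\mathbb P\boxtimes\lambda$-square integrable functions. $L^2_\lambda(I;E)$: equivalence classes of $(\mathcal I,\mathcal B(E))$-measurable, $\lambda$-square integrable functions. $\mathbb E^\boxtimes$ is expectation under $\mathbb P\boxtimes\lambda$, $\mathbb E$ under $\mathbb P$. A version of a class is a member of it. **Graphon.** $w:I\times I\to[0,1]$ is symmetric and (Borel) measurable. **Assumptions.** $\nu(x)$ has a finite second moment bounded uniformly in $x$; $a,b,c:I\to\mathbb R$ are $\mathcal I$-measurable and bounded. **Admissible profiles.** $\underline{\mathcal A}$ is the set of $\mathcal I\otimes\mathcal B([0,T])\otimes\mathcal B(S)$-measurable $\underline\alpha:I\times[0,T]\times S\to\mathbb R$ such that $\underline\alpha(x,t,\sigma)=\underline\alpha(x,t,\sigma')$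 whenever $[\sigma]_1(s)=[\sigma']_1(s)$ for $0\le s\le t$ and $[\sigma]_2=[\sigma']_2$; and $\mathbb E^\boxtimes[\int_0^T|\underline\alpha(\cdot,t,\mathbb B^\cdot)|^2dt]<\infty$ and $\mathbb E[\int_0^T|\underline\alpha(x,t,\mathbb B^x)|^2dt]<\infty$ for all $x\in I$. **Solution in $L^2_\boxtimes$.** For $z\in L^2_\boxtimes(\Omega\times I;E)$ there is a unique $\mathbb X^{\underline\alpha,z}\in L^2_\boxtimes(\Omega\times I;E)$ with $\mathbb X^{\underline\alpha,z}_t=\xi+\int_0^t(a\mathbb X^{\underline\alpha,z}_s+b\alpha_s+c z_s)ds+B_t$, $t\in[0,T]$, $\mathbb P\boxtimes\lambda$-a.e. The map $z\mapsto\big((\omega,x)\mapsto\int_I w(x,y)\mathbb X^{\underline\alpha,z,y}(\omega)\lambda(dy)\big)$ has a unique fixed point in $L^2_\boxtimes(\Omega\times I;E)$; this fixed point is the aggregate $\mathbb Z^{\underline\alpha}$, and $\mathbb X^{\underline\alpha}:=\mathbb X^{\underline\alpha,\mathbb Z^{\underline\alpha}}$ is the unique solution of the graphon SDE system in $L^2_\boxtimes(\Omega\times I;E)$. *)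

(* Defs.v *)
From HB Require Import structures.
From mathcomp Require Import all_boot all_order all_algebra.
From mathcomp Require Import all_classical all_reals all_analysis.
Set Implicit Arguments.
Unset Strict Implicit.
Unset Printing Implicit Defensive.
Import Order.TTheory GRing.Theory Num.Theory.
Import numFieldNormedType.Exports.
Local Open Scope classical_set_scope.
Local Open Scope ring_scope.

(* A continuous function on [0,T] is represented by its extension by 0 to the
   real line, so that Leibniz equality is equality on [0,T]. *)
Definition cpath_pred (R : realType) (T : R) : {pred R -> R} :=
  mem [set f : R -> R | {within `[0, T], continuous f} /\
                        forall t, ~ `[0, T]%classic t -> f t = 0].

Lemma cpath_submod_closed (R : realType) (T : R) :
  submod_closed (cpath_pred T).
Proof.
split.
  by rewrite /cpath_pred; apply/mem_set; split => // x; exact: cvg_cst.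
move=> k f g /set_mem[cf f0] /set_mem[cg g0].
apply/mem_set; split.
  move=> x; apply: (@continuousD _ R^o); last exact: cg.
  by apply: (@continuousZl_tmp _ R^o); exact: cf.
move=> t tT; rewrite -[LHS]/(k *: f t + g t) f0// g0// scaler0 addr0//.
Qed.

HB.instance Definition _ (R : realType) (T : R) :=
  GRing.isSubmodClosed.Build R (R -> R) (cpath_pred T)
    (cpath_submod_closed T).

Record cpath (R : realType) (T : R) := CPath {
  cpath_fun :> R -> R ;
  cpathP : cpath_fun \in cpath_pred T }.

HB.instance Definition _ (R : realType) (T : R) :=
  [isSub for (@cpath_fun R T)].
HB.instance Definition _ (R : realType) (T : R) := gen_eqMixin (cpath T).
HB.instance Definition _ (R : realType) (T : R) := gen_choiceMixin (cpath T).

HB.instance Definition _ (R : realType) (T : R) :=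
  [SubChoice_isSubLmodule of cpath T by <:].

Lemma cpath_continuous (R : realType) (T : R) (f : cpath T) :
  {within `[0, T], continuous f}.
Proof. by have /set_mem[] := cpathP f. Qed.

Lemma cpath_out (R : realType) (T : R) (f : cpath T) t :
  ~ `[0, T]%classic t -> f t = 0.
Proof. by have /set_mem[_ +] := cpathP f; exact. Qed.

Definition cpath_norm (R : realType) (T : R) (f : cpath T) : R :=
  sup [set `|f t| | t in `[0, T]].

Lemma cpath_has_ubound (R : realType) (T : R) (f : cpath T) :
  has_ubound [set `|f t| | t in `[0, T]].
Proof.
have /compact_bounded[M [_ Mb]] : compact (f @` `[0, T]).
  by apply: continuous_compact (@segment_compact _ _ _); exact: cpath_continuous.
exists (M + 1) => _ [t tT <-].
by apply: (Mb (M + 1)); [rewrite ltrDl|exists t].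
Qed.

Lemma cpath_norm_ub (R : realType) (T : R) (f : cpath T) t :
  `|f t| <= cpath_norm f.
Proof.
have [tT|tT] := pselect (`[0, T]%classic t).
  by apply: ub_le_sup; [exact: cpath_has_ubound|exists t].
rewrite cpath_out// normr0 /cpath_norm.
have [->|/set0P[x Sx]] := eqVneq [set `|f t| | t in `[0, T]] set0.
  by rewrite sup0.
apply: (@le_trans _ _ x); first by case: Sx => ? _ <-.
by apply: ub_le_sup => //; exact: cpath_has_ubound.
Qed.

Lemma cpath_norm_le (R : realType) (T : R) (f : cpath T) M :
  0 <= M -> (forall t, `|f t| <= M) -> cpath_norm f <= M.
Proof.
move=> M0 fM; rewrite /cpath_norm.
have [->|/set0P S0] := eqVneq [set `|f t| | t in `[0, T]] set0.
  by rewrite sup0.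
by apply: ge_sup => // _ [t _ <-].
Qed.

Lemma cpath_norm_ge0 (R : realType) (T : R) (f : cpath T) : 0 <= cpath_norm f.
Proof. exact: le_trans (normr_ge0 _) (cpath_norm_ub f 0). Qed.

Lemma cpath_normD (R : realType) (T : R) (f g : cpath T) :
  cpath_norm (f + g) <= cpath_norm f + cpath_norm g.
Proof.
apply: cpath_norm_le => [|t]; first by rewrite addr_ge0 ?cpath_norm_ge0.
by rewrite (le_trans (ler_normD _ _))// lerD ?cpath_norm_ub.
Qed.

Lemma cpath_normZ (R : realType) (T : R) (k : R) (f : cpath T) :
  cpath_norm (k *: f) = `|k| * cpath_norm f.
Proof.
have le1 c (g : cpath T) : cpath_norm (c *: g) <= `|c| * cpath_norm g.
  apply: cpath_norm_le => [|t]; first by rewrite mulr_ge0 ?cpath_norm_ge0.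
  by rewrite normrM ler_wpM2l ?cpath_norm_ub.
apply/eqP; rewrite eq_le le1 /=.
have [->|k0] := eqVneq k 0; first by rewrite normr0 mul0r cpath_norm_ge0.
rewrite -ler_pdivlMl ?normr_gt0// -normfV.
by rewrite -{1}[f](scalerK k0) le1.
Qed.

Lemma cpath_norm0_eq0 (R : realType) (T : R) (f : cpath T) :
  cpath_norm f = 0 -> f = 0.
Proof.
move=> f0; apply/val_inj/funext => t; apply/eqP.
by rewrite -normr_le0 -f0 cpath_norm_ub.
Qed.

HB.instance Definition _ (R : realType) (T : R) :=
  Lmodule_isNormed.Build R (cpath T)
    (@cpath_normD R T) (@cpath_normZ R T) (@cpath_norm0_eq0 R T).

HB.instance Definition _ (R : realType) (T : R) :=
  @isMeasurable.Build (sigma_display (@open (cpath T))) (cpath T)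
    <<s @open (cpath T) >> (@sigma_algebra0 _ setT _) (@sigma_algebraC _ _)
    (@sigma_algebra_bigcup _ setT _).

Record segment_of (R : realType) := Segment {
  left_end : R ; right_end : R ; left_lt_right : left_end < right_end }.

Definition points (R : realType) (J : segment_of R) :=
  {x : R | x \in `[left_end J, right_end J]}.

Lemma left_endP (R : realType) (J : segment_of R) :
  left_end J \in `[left_end J, right_end J].
Proof. by rewrite in_itv/= lexx ltW// left_lt_right. Qed.

(* The library's measurable types are pointed. *)
HB.instance Definition _ (R : realType) (J : segment_of R) :=
  Choice.on (points J).
HB.instance Definition _ (R : realType) (J : segment_of R) :=
  isPointed.Build (points J) (exist _ (left_end J) (left_endP J)).

Definition borel_points (R : realType) (J : segment_of R) :=
  g_sigma_algebra_preimageType (\val : points J -> R).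

Definition extends_lebesgue (R : realType) (J : segment_of R)
    (calI : set (set (points J)))
    (lam : probability (g_sigma_algebraType calI) R) :=
  forall B : set R, measurable B ->
    calI (\val @^-1` B) /\
    lam (\val @^-1` B) =
      (lebesgue_measure (B `&` `[left_end J, right_end J])
         * ((right_end J - left_end J)^-1)%:E)%E.

Definition has_law d d' (Om : measurableType d) (S : measurableType d')
    (R : realType) (P : probability Om R) (X : Om -> S)
    (mu : set S -> \bar R) :=
  measurable_fun setT X /\
  forall A : set S, measurable A -> P (X @^-1` A) = mu A.

Definition independent2 d d' (Om : measurableType d) (S : measurableType d')
    (R : realType) (P : probability Om R) (X Y : Om -> S) :=
  forall A B : set S, measurable A -> measurable B ->
    P (X @^-1` A `&` Y @^-1` B) = (P (X @^-1` A) * P (Y @^-1` B))%E.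

Definition epi d d' dI (Om : measurableType d) (S : measurableType d')
    (I : measurableType dI) (R : realType) (P : probability Om R)
    (lam : probability I R) (f : Om * I -> S) :=
  {ae lam, forall x, {ae lam, forall y,
    independent2 P (fun om => f (om, x)) (fun om => f (om, y))}}.

Definition square_integrable d (U : measurableType d) (R : realType) (T : R)
    (mu : probability U R) (X : U -> cpath T) :=
  measurable_fun setT X /\ (\int[mu]_u (`|X u| ^+ 2)%:E < +oo)%E.

(* The partial integrals are only defined almost everywhere: their
   integrability means that they agree almost everywhere with an integrable
   function. No completeness of P or lam is assumed. *)
Definition fubini_extension d dI (Om : measurableType d)
    (I : measurableType dI) (R : realType) (P : probability Om R)
    (lam : probability I R) (W : set (set (Om * I)))
    (Q : probability (g_sigma_algebraType W) R) :=
  [/\ sigma_algebra setT W,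
      forall A : set (Om * I), measurable A -> W A /\ Q A = (P \x lam)%E A &
      forall f : Om * I -> R, Q.-integrable setT (EFin \o f) ->
        [/\ {ae lam, forall x, P.-integrable setT (fun om => (f (om, x))%:E)},
            {ae P, forall om, lam.-integrable setT (fun x => (f (om, x))%:E)},
            exists g : I -> R,
              [/\ {ae lam, forall x,
                     ((g x)%:E = \int[P]_om (f (om, x))%:E)%E},
                  lam.-integrable setT (EFin \o g) &
                  (\int[lam]_x (g x)%:E = \int[Q]_p (f p)%:E)%E] &
            exists h : Om -> R,
              [/\ {ae P, forall om,
                     ((h om)%:E = \int[lam]_x (f (om, x))%:E)%E},
                  P.-integrable setT (EFin \o h) &
                  (\int[P]_om (h om)%:E = \int[Q]_p (f p)%:E)%E]]].

(* Polish spaces are presented by a complete metric. *)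
Definition rich d dI (Om : measurableType d) (I : measurableType dI)
    (R : realType) (P : probability Om R) (lam : probability I R)
    (W : set (set (Om * I))) :=
  forall (S : completePseudoMetricType R),
    hausdorff_space S -> (exists2 D : set S, countable D & dense D) ->
  forall phi : I -> probability (g_sigma_algebraType (@open S)) R,
    measurable_fun setT
      (phi : I -> pprobability (g_sigma_algebraType (@open S)) R) ->
  exists f : Om * I -> S,
    [/\ measurable_fun setT
          (f : g_sigma_algebraType W -> g_sigma_algebraType (@open S)),
        epi P lam (f : Om * I -> g_sigma_algebraType (@open S)) &
        forall x, has_law P
          (fun om => f (om, x) : g_sigma_algebraType (@open S)) (phi x)].

Definition wiener_measure (R : realType) (T : R)
    (mu : probability (cpath T) R) :=
  mu [set f : cpath T | f 0 = 0] = 1%E /\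
  forall (n : nat) (t : nat -> R) (A : nat -> set R),
    0 <= t 0%N -> (forall i, (i < n)%N -> t i < t i.+1) -> t n <= T ->
    (forall i, measurable (A i)) ->
    mu [set f : cpath T | forall i, (i < n)%N -> A i (f (t i.+1) - f (t i))] =
    (\prod_(i < n) normal_prob 0 (Num.sqrt (t i.+1 - t i)) (A i))%E.

Definition noise d dI (Om : measurableType d) (I : measurableType dI)
    (R : realType) (T : R) (P : probability Om R) (lam : probability I R)
    (W : set (set (Om * I))) (wiener : probability (cpath T) R)
    (nu : I -> probability R R) (BB : Om * I -> cpath T * R) :=
  [/\ measurable_fun setT (BB : g_sigma_algebraType W -> cpath T * R),
      epi P lam BB &
      forall x, has_law P (fun om => BB (om, x)) (wiener \x nu x)%E].

Definition admissible d dI (Om : measurableType d) (I : measurableType dI)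
    (R : realType) (T : R) (P : probability Om R) (W : set (set (Om * I)))
    (Q : probability (g_sigma_algebraType W) R)
    (BB : Om * I -> cpath T * R) (alpha : I -> R -> cpath T * R -> R) :=
  [/\ measurable_fun ([set: I] `*` `[0, T] `*` [set: cpath T * R])
        (fun q : I * R * (cpath T * R) => alpha q.1.1 q.1.2 q.2),
      forall x t (s s' : cpath T * R), 0 <= t <= T ->
        (forall r, 0 <= r <= t -> s.1 r = s'.1 r) -> s.2 = s'.2 ->
        alpha x t s = alpha x t s',
      (\int[Q]_p \int[lebesgue_measure]_(t in `[0%R, T])
          (`|alpha p.2 t (BB p)| ^+ 2)%:E < +oo)%E &
      forall x, (\int[P]_om \int[lebesgue_measure]_(t in `[0%R, T])
          (`|alpha x t (BB (om, x))| ^+ 2)%:E < +oo)%E].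

Definition integral_is d (U : measurableType d) (R : realType)
    (mu : {measure set U -> \bar R}) (D : set U) (f : U -> R) (v : R) :=
  mu.-integrable D (EFin \o f) /\ v = \int[mu]_(u in D) f u.

Definition simple_fun d (U : measurableType d) (V : Type) (s : U -> V) :=
  finite_set (range s) /\ forall v, measurable (s @^-1` [set v]).

Definition simple_integral d (U : measurableType d) (R : realType)
    (V : normedModType R) (mu : probability U R) (s : U -> V) : V :=
  \sum_(v \in range s) fine (mu (s @^-1` [set v])) *: v.

Definition bochner_integral_is d (U : measurableType d) (R : realType)
    (V : normedModType R) (mu : probability U R) (f : U -> V) (v : V) :=
  exists s : nat -> U -> V,
    [/\ forall n, simple_fun (s n),
        {ae mu, forall u, s n u @[n --> \oo] --> f u},
        (\int[mu]_u (`|f u - s n u|)%:E)%E @[n --> \oo] --> 0%E &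
        simple_integral mu (s n) @[n --> \oo] --> v].

(* Written for one path, with s = (Brownian path, initial condition), in the
   form X_t - xi - B_t = int_0^t (a X_r + b u_r + c z_r) dr. *)
Definition state_equation (R : realType) (T : R) (a b c : R) (u : R -> R)
    (z : cpath T) (s : cpath T * R) (X : cpath T) :=
  forall t, 0 <= t <= T ->
    integral_is lebesgue_measure `[0, t]
      (fun r => a * X r + b * u r + c * z r) (X t - s.2 - s.1 t).

(* XX and ZZ are representatives of their classes; the second equation says
   that ZZ is a fixed point of the aggregation map. *)
Definition solution_L2box d dI (Om : measurableType d) (I : measurableType dI)
    (R : realType) (T : R) (lam : probability I R) (W : set (set (Om * I)))
    (Q : probability (g_sigma_algebraType W) R)
    (BB : Om * I -> cpath T * R) (w : I -> I -> R) (a b c : I -> R)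
    (alpha : I -> R -> cpath T * R -> R) (XX ZZ : Om * I -> cpath T) :=
  [/\ square_integrable Q XX, square_integrable Q ZZ,
      {ae Q, forall p, state_equation (a p.2) (b p.2) (c p.2)
         (fun t => alpha p.2 t (BB p)) (ZZ p) (BB p) (XX p)} &
      {ae Q, forall p, bochner_integral_is lam
         (fun y => w p.2 y *: XX (p.1, y)) (ZZ p)}].

Definition solution_everywhere d dI (Om : measurableType d)
    (I : measurableType dI) (R : realType) (T : R) (P : probability Om R)
    (lam : probability I R) (BB : Om * I -> cpath T * R) (w : I -> I -> R)
    (a b c : I -> R) (alpha : I -> R -> cpath T * R -> R)
    (X Z : Om * I -> cpath T) :=
  forall x,
    [/\ square_integrable P (fun om => X (om, x)),
        square_integrable P (fun om => Z (om, x)),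
        {ae P, forall om, state_equation (a x) (b x) (c x)
           (fun t => alpha x t (BB (om, x)))
           (Z (om, x)) (BB (om, x)) (X (om, x))} &
        {ae P, forall om, forall t, 0 <= t <= T ->
           integral_is lam setT (fun y => w x y * X (om, y) t) (Z (om, x) t)}].

Definition version d (U : measurableType d) (R : realType) (T : R)
    (Q : probability U R) (XX X : U -> cpath T) :=
  square_integrable Q X /\ {ae Q, forall p, X p = XX p}.

Definition version_solution d dI (Om : measurableType d)
    (I : measurableType dI) (R : realType) (T : R) (P : probability Om R)
    (lam : probability I R) (W : set (set (Om * I)))
    (Q : probability (g_sigma_algebraType W) R)
    (BB : Om * I -> cpath T * R) (w : I -> I -> R) (a b c : I -> R)
    (alpha : I -> R -> cpath T * R -> R)
    (XX ZZ X Z : Om * I -> cpath T) :=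
  [/\ version Q XX X, version Q ZZ Z &
      solution_everywhere P lam BB w a b c alpha X Z].

(* Main.v *)
(* By variation of constants, the state with zero aggregate is a measurable functional F0 of
   (x, B^x), hence a family that is essentially pairwise independent in x.  Such families satisfy
   an exact law of large numbers, so the integrals of F0 at the points of a countable dense set of
   times, against the indicators of rational rays in y, are almost surely constant.  These are
   countably many conditions and w(x, .) is Borel, so outside a single null set they determine
   the integral of w(x, .) F0 for every x.  For two such omega the deviations X - F0 therefore
   solve the same linear system in y, and coincide by a Gronwall estimate.  Hence
   Z^x = int w(x, y) X^y(omega_0) lambda(dy) for one fixed omega_0, which is defined and
   deterministic for every x; solving the state equation with this Z gives X^x for every x. *)
Require Import Defs.
From mathcomp Require Import all_boot all_order all_algebra.
From mathcomp Require Import all_classical all_reals all_analysis.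
From mathcomp Require Import ring lra measurable_realfun.
Import Order.TTheory GRing.Theory Num.Theory.
Import numFieldNormedType.Exports.
Local Open Scope classical_set_scope.
Local Open Scope ring_scope.
Set Implicit Arguments.
Unset Strict Implicit.

(** * Continuous paths *)

(** The state itself is no functional of (x, B^x): a priori its aggregate may depend on the noise at
    all other indices. Independence is therefore exploited only for the part without aggregate; the
    remainder is compared between two sample points, where the argument is purely deterministic.

    Applying the law of large numbers to w(x, .) F0 directly would cost one null set for each x,
    uncountably many in all. The Borel field of the interval is countably generated, while the
    larger field [calI] need not be; it is the Borel measurability of w(x, .) that makes rational
    rays a sufficient family of test functions.

    The other obstacle is that sections behave well only almost everywhere: W may exceed the product
    field, and neither P nor lam is assumed complete. Path-valued statements are therefore reduced
    to the norm and to evaluations at countably many times, since the Fubini property speaks of real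
    functions. *)

Section cpath_topology.
Variables (R : realType) (T : R).
Hypothesis T_gt0 : 0 < T.
Implicit Types (f g : cpath T).

Lemma cpath_cont f t e : 0 < e -> `[0, T]%classic t ->
  exists2 r, 0 < r & forall s, `[0, T]%classic s ->
    `|s - t| < r -> `|f s - f t| < e.
Proof.
move=> e0 tT.
have /subspace_continuousP/(_ t tT)/cvgrPdist_lt/(_ e e0) := @cpath_continuous _ _ f.
rewrite near_withinE => /nbhs_ballP[r /= r0 fr].
exists r => // s sT; rewrite distrC => st; rewrite distrC.
exact: (fr s).
Qed.

(** Heine-Cantor in near-covering form: radii that work near each point of a compact set can be
    replaced by one radius for all its points. *)
Lemma cpath_unif f e : 0 < e ->
  exists2 r, 0 < r & forall s t, `[0, T]%classic s -> `[0, T]%classic t ->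
    `|s - t| < r -> `|f s - f t| < e.
Proof.
move=> e0.
have /compact_near_coveringP := @segment_compact R 0 T.
move=> /(_ R 0^'+ (fun r t => forall s, `[0, T]%classic s ->
  `[0, T]%classic t -> `|s - t| < r -> `|f s - f t| < e) _) [].
  move=> x xT.
  have e20 : 0 < e / 2 by rewrite divr_gt0.
  have [r r0 fr] := cpath_cont f e20 xT.
  have r20 : 0 < r / 2 by rewrite divr_gt0.
  near=> y d => s sT yT syd.
  have xy : `|y - x| < r / 2.
    near: y; rewrite /prop_near1; apply/nbhs_ballP; exists (r / 2) => // z /=.
    by rewrite /ball/= distrC.
  have dr : d < r / 2 by near: d; exact: nbhs_right_lt.
  have sx : `|s - x| < r.
    rewrite -(subrKA y) (le_lt_trans (ler_normD _ _))//.
    by have := lt_trans syd dr; move: xy; lra.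
  rewrite -(subrKA (f x)) (le_lt_trans (ler_normD _ _))//.
  have := fr _ sT sx; rewrite (distrC (f x)).
  have yxr : `|y - x| < r by rewrite (lt_le_trans xy)//; lra.
  by have := fr y yT yxr; lra.
move=> r /= r0 fr; exists (r / 2); first by rewrite divr_gt0.
move=> s t sT tT st.
apply: (fr (r / 2)) => //=; last by rewrite divr_gt0.
by rewrite sub0r normrN gtr0_norm ?divr_gt0// ltr_pdivrMr// ltr_pMr// ltr1n.
Unshelve. all: by end_near. Qed.

(** A countable dense set of times. The cut at T makes every pair of indices valid, so that
    quantification over the grid carries no side condition. *)
Definition grid (p : nat * nat) : R := Num.min T (T * (p.2%:R / p.1.+1%:R)).

Lemma gridP p : `[0, T]%classic (grid p).
Proof.
rewrite /= in_itv/= /grid ge_min lexx/= andbT le_min ltW//=.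
by rewrite mulr_ge0// ltW.
Qed.

Lemma grid_dense t e : 0 < e -> `[0, T]%classic t ->
  exists p, `|grid p - t| < e.
Proof.
move=> e0; rewrite /= in_itv/= => /andP[t0 tT].
set n := Num.truncn (T / e).
have nT : T < e * n.+1%:R.
  rewrite mulrC -ltr_pdivrMr//; exact: truncnS_gt.
set i := Num.truncn (t / T * n.+1%:R).
have /andP[i1 i2] : i%:R <= t / T * n.+1%:R < i.+1%:R.
  by apply: truncn_itv; rewrite mulr_ge0// divr_ge0// ltW.
exists (n, i); rewrite /grid/=.
have it : T * (i%:R / n.+1%:R) <= t.
  by rewrite mulrC -ler_pdivlMr// ler_pdivrMr.
have ti : t < T * (i%:R / n.+1%:R) + e.
  have -> : t = T * ((t / T * n.+1%:R) / n.+1%:R).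
    by rewrite mulfK// mulrC divfK// gt_eqF.
  apply: (@lt_le_trans _ _ (T * (i.+1%:R / n.+1%:R))).
    by rewrite ltr_pM2l// ltr_pM2r.
  rewrite -natr1 mulrDl mulrDr lerD2l mul1r ler_pdivrMr//.
  exact: ltW.
rewrite min_r ?(le_trans it)//.
by rewrite distrC ger0_norm ?subr_ge0// ltrBlDl.
Qed.

Lemma cpath_le_grid f c : (forall p, `|f (grid p)| <= c) ->
  forall t, `|f t| <= c.
Proof.
move=> fc t.
have [tT|/cpath_out->] := pselect (`[0, T]%classic t); last first.
  by rewrite normr0 (le_trans _ (fc (0, 0)%N)).
apply/ler_addgt0Pl => e e0.
have [r r0 fr] := cpath_cont f e0 tT.
have [p pt] := grid_dense r0 tT.
have := fr _ (gridP p) pt; rewrite distrC => ?.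
rewrite -(subrK (f (grid p)) (f t)) (le_trans (ler_normD _ _))// lerD ?fc//.
exact: ltW.
Qed.

Lemma cpath_norm_le_grid f c : (`|f| <= c) = `[< forall p, `|f (grid p)| <= c >].
Proof.
apply/idP/asboolP => [fc p|fc].
  by rewrite (le_trans _ fc)// cpath_norm_ub.
apply: cpath_norm_le; first exact: le_trans (fc (0,0)%N).
exact: cpath_le_grid.
Qed.

Lemma cpath_eq_grid f g : (forall p, f (grid p) = g (grid p)) -> f = g.
Proof.
move=> fg; apply/eqP; rewrite -subr_eq0 -normr_le0 cpath_norm_le_grid.
by apply/asboolP => p; rewrite -[X in `|X|]/(f _ - g _) fg subrr normr0.
Qed.

Lemma cpath_eq f g : (forall t, 0 <= t <= T -> f t = g t) -> f = g.
Proof.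
move=> fg; apply: cpath_eq_grid => p; apply: fg.
by have := gridP p; rewrite /= in_itv.
Qed.

(** Rational step functions stand in for a dense sequence of paths: they are not continuous, but
    their codes form a countable type and they approximate every path uniformly. *)
Definition step_fun (k : nat * seq rat) (t : R) : R :=
  ratr (nth 0 k.2 (Num.truncn (t / T * k.1.+1%:R))).

Lemma cpath_step f e : 0 < e ->
  exists k, forall t, `[0, T]%classic t -> `|f t - step_fun k t| <= e.
Proof.
move=> e0.
have e20 : 0 < e / 2 by rewrite divr_gt0.
have [r r0 fr] := cpath_unif f e20.
set n := Num.truncn (T / r).
have nT : T < r * n.+1%:R.
  rewrite mulrC -ltr_pdivrMr//; exact: truncnS_gt.
have fq i : {q : rat | `|f (grid (n, i)) - ratr q| < e / 2}.
  apply: cid; have [|q] := @rat_in_itvoo R (f (grid (n, i)) - e / 2) (f (grid (n, i)) + e / 2).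
    by lra.
  rewrite in_itv/= => /andP[q1 q2]; exists q.
  by rewrite ltr_norml; apply/andP; split; lra.
(* At t = T the index is n.+1, hence n.+2 values. *)
exists (n, mkseq (fun i => sval (fq i)) n.+2) => t tT.
move: (tT); rewrite /= in_itv/= => /andP[t0 tleT].
rewrite /step_fun/=; set i := Num.truncn _.
have /andP[i1 i2] : i%:R <= t / T * n.+1%:R < i.+1%:R.
  by apply: truncn_itv; rewrite mulr_ge0// divr_ge0// ltW.
have ilen : (i < n.+2)%N.
  rewrite -(ltr_nat R) (le_lt_trans i1)// (@le_lt_trans _ _ n.+1%:R) ?ltr_nat//.
  by rewrite ler_piMl// ler_pdivrMr// mul1r.
rewrite nth_mkseq//; case: (fq i) => /= q fqi.
have it : T * (i%:R / n.+1%:R) <= t.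
  by rewrite mulrC -ler_pdivlMr// ler_pdivrMr.
have ti : t < T * (i%:R / n.+1%:R) + r.
  have -> : t = T * ((t / T * n.+1%:R) / n.+1%:R).
    by rewrite mulfK// mulrC divfK// gt_eqF.
  apply: (@lt_le_trans _ _ (T * (i.+1%:R / n.+1%:R))).
    by rewrite ltr_pM2l// ltr_pM2r.
  rewrite -natr1 mulrDl mulrDr lerD2l mul1r ler_pdivrMr//.
  exact: ltW.
have : `|t - grid (n, i)| < r.
  rewrite /grid/= min_r ?(le_trans it)//.
  by rewrite ger0_norm ?subr_ge0// ltrBlDl.
move=> /(fr _ _ tT (gridP _)) ft.
rewrite -(subrKA (f (grid (n, i)))) (le_trans (ler_normD _ _))//.
by move: ft fqi; lra.
Qed.

Lemma cpath_ball f e g : ball f e g <-> `|f - g| < e.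
Proof. by rewrite -ball_normE. Qed.

Lemma lipschitz_measurable_cpath (h : cpath T -> R) k :
  (forall f g, `|h f - h g| <= k * `|f - g|) -> measurable_fun setT h.
Proof.
move=> hk.
apply: (measurability _ (RGenOpens.measurableE R)) => _ [_ [x [y ->]] <-].
rewrite setTI; apply: sub_sigma_algebra.
suff : open (h @^-1` `]x, y[%classic) by [].
rewrite openE => f /=.
rewrite in_itv/= => /andP[xf fy].
(* Adding 1 keeps the denominator positive when k is 0. *)
pose e := Num.min (h f - x) (y - h f) / (`|k| + 1).
have k0 : 0 < `|k| + 1 by rewrite ltr_wpDl.
have e0 : 0 < e by rewrite divr_gt0// lt_min !subr_gt0 xf fy.
apply/nbhs_ballP; exists e => // g /cpath_ball fg /=.
rewrite in_itv/=.
have : `|h f - h g| < Num.min (h f - x) (y - h f).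
  apply: (le_lt_trans (hk f g)).
  apply: (@le_lt_trans _ _ ((`|k| + 1) * `|f - g|)).
    by rewrite ler_wpM2r// (le_trans (ler_norm k))// lerDl.
  by rewrite mulrC -ltr_pdivlMr.
rewrite lt_min !ltr_norml => /andP[/andP[_ ?] /andP[? _]].
by apply/andP; split; lra.
Qed.

Lemma measurable_cpath_eval t : measurable_fun setT (fun f : cpath T => f t).
Proof.
apply: (@lipschitz_measurable_cpath _ 1) => f g; rewrite mul1r.
exact: (cpath_norm_ub (f - g) t).
Qed.

Lemma measurable_cpath_norm : measurable_fun setT (fun f : cpath T => `|f|).
Proof.
by apply: (@lipschitz_measurable_cpath _ 1) => f g; rewrite mul1r ler_dist_dist.
Qed.

(** The Borel field of the sup norm is generated by the evaluations at grid times: an open set is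
    the union of the boxes around rational step functions that it contains. There are countably many
    boxes, and each is a countable intersection of conditions on grid evaluations. *)
Lemma measurable_fun_cpath d (U : measurableType d) (F : U -> cpath T) :
  (forall p, measurable_fun setT (fun u => F u (grid p))) ->
  measurable_fun setT F.
Proof.
move=> mF; apply: (measurability (@open (cpath T))) => // _ [A oA <-].
rewrite setTI.
pose box (k : nat * seq rat * nat) := [set f : cpath T |
  forall p, `|f (grid p) - step_fun k.1 (grid p)| <= k.2.+1%:R^-1].
have -> : F @^-1` A = \bigcup_(k in [set k | box k `<=` A]) (F @^-1` (box k)).
  apply/seteqP; split=> [u /= Au|u [k kA Fu]]; last exact: kA.
  have /nbhs_ballP[e /= e0 Ae] : nbhs (F u) A by apply: open_nbhs_nbhs.
  (* Two members of a box of radius 1/(m+1) differ by at most 2/(m+1). *)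
  pose m := Num.truncn (2 / e).
  have m0 : 0 < m.+1%:R^-1 :> R by rewrite invr_gt0.
  have me : 2 * m.+1%:R^-1 < e.
    by rewrite ltr_pdivrMr// mulrC -ltr_pdivrMr// truncnS_gt.
  have [k fk] := cpath_step (F u) m0.
  exists (k, m) => /=; last by move=> p; apply: fk; exact: gridP.
  move=> g gb; apply: Ae; apply/cpath_ball; apply: le_lt_trans me.
  rewrite cpath_norm_le_grid; apply/asboolP => p.
  rewrite -[X in `|X|]/(F u (grid p) - g (grid p)).
  rewrite -(subrKA (step_fun k (grid p))) (le_trans (ler_normD _ _))//.
  rewrite mulr2n mulrDl mul1r lerD//; first by apply: fk; exact: gridP.
  by rewrite distrC; exact: gb.
rewrite bigcup_mkcond; apply: countable_bigcupT_measurable => [|k]; first exact: countableP.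
case: ifPn => // _.
rewrite -[X in measurable X]setCK; apply: measurableC.
have -> : ~` (F @^-1` box k) = \bigcup_p
    [set u | ~~ (`|F u (grid p) - step_fun k.1 (grid p)| <= k.2.+1%:R^-1)].
  apply/seteqP; split=> [u /existsNP[p /negP pu]|u [p _ /= /negP pu]].
    by exists p.
  by move=> /(_ p).
apply: countable_bigcupT_measurable => [|p]; first exact: countableP.
have -> : [set u | ~~ (`|F u (grid p) - step_fun k.1 (grid p)| <= k.2.+1%:R^-1)]
   = (fun u => `|F u (grid p) - step_fun k.1 (grid p)|) @^-1` `](k.2.+1%:R^-1), +oo[.
  by apply/seteqP; split => u /=; rewrite in_itv/= andbT -ltNge.
rewrite -[X in measurable X]setTI.
have : measurable_fun setT (fun u => `|F u (grid p) - step_fun k.1 (grid p)|).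
  by apply: measurableT_comp => //; apply: measurable_funB.
by apply.
Qed.

Lemma measurable_cpathP d (U : measurableType d) (F : U -> cpath T) :
  measurable_fun setT F <-> forall t, measurable_fun setT (fun u => F u t).
Proof.
split=> [mF t|mF]; last exact: measurable_fun_cpath.
by apply: (measurableT_comp (measurable_cpath_eval t)).
Qed.

End cpath_topology.

(** * Integration of paths and the scalar linear integral equation *)

Section cpath_ode.
Variables (R : realType) (T : R).
Hypothesis T_gt0 : 0 < T.
Implicit Types (f g z V : cpath T) (a c t : R).
Notation mu := (@lebesgue_measure R).

(** Total constructor: it cuts h off outside [0, T] and falls back to the zero path when the result
    is not continuous on [0, T]. *)
Definition path_of (h : R -> R) : cpath T :=
  insubd 0 (fun t => if 0 <= t <= T then h t else 0).

Lemma path_ofE h t : {within `[0, T], continuous h} -> 0 <= t <= T ->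
  path_of h t = h t.
Proof.
move=> ch tT; rewrite /path_of -[X in X t]/(\val _) val_insubd.
rewrite ifT ?tT//; apply/mem_set; split.
  have hE x : `[0, T]%classic x -> h x = if 0 <= x <= T then h x else 0.
    by rewrite /= in_itv/= => ->.
  by apply: (@subspace_eq_continuous _ _ _ h) => // x /set_mem; exact: hE.
by move=> x /=; rewrite in_itv/=; case: ifP.
Qed.

Lemma cpath_integrable f t : 0 <= t <= T ->
  mu.-integrable `[0, t] (EFin \o f).
Proof.
move=> /andP[t0 tT]; apply: (@integrableS _ _ _ mu `[0, T]) => //.
  by apply: subset_itvl; rewrite bnd_simp.
apply: continuous_compact_integrable; first exact: segment_compact.
exact: (@cpath_continuous _ _ f).
Qed.

Lemma cpathD f g t : (f + g) t = f t + g t. Proof. by []. Qed.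
Lemma cpathB f g t : (f - g) t = f t - g t. Proof. by []. Qed.
Lemma cpathZ a f t : (a *: f) t = a * f t. Proof. by []. Qed.

Definition int_path (b : R -> R) : cpath T :=
  path_of (fun t => \int[mu]_(s in `[0, t]) b s).

Lemma int_pathE (b : R -> R) t : mu.-integrable `[0, T] (EFin \o b) ->
  0 <= t <= T -> int_path b t = \int[mu]_(s in `[0, t]) b s.
Proof.
move=> ib tT; apply: path_ofE => //.
by apply: parameterized_integral_continuous => //; exact: ltW.
Qed.

Lemma int_cpathE f t : 0 <= t <= T -> int_path f t = \int[mu]_(s in `[0, t]) f s.
Proof. by apply: int_pathE; apply: cpath_integrable; rewrite lexx ltW. Qed.

Lemma int_cpathD f g : int_path (f + g) = int_path f + int_path g.
Proof.
apply: cpath_eq => // t tT; rewrite cpathD !int_cpathE//.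
by rewrite RintegralD//; exact: cpath_integrable.
Qed.

Lemma int_cpathZ a f : int_path (a *: f) = a *: int_path f.
Proof.
apply: cpath_eq => // t tT; rewrite cpathZ !int_cpathE//.
by rewrite RintegralZl//; exact: cpath_integrable.
Qed.

Lemma int_cpathB f g : int_path (f - g) = int_path f - int_path g.
Proof. by rewrite int_cpathD -scaleN1r int_cpathZ scaleN1r. Qed.

Lemma Rintegral_itv_cst c t : 0 <= t -> \int[mu]_(s in `[0, t]) (cst c) s = c * t.
Proof.
move=> t0; rewrite Rintegral_cst//= lebesgue_measure_itv/= lte_fin.
by move: t0; rewrite le_eqVlt => /predU1P[<-|->]; rewrite ?ltxx ?mulr0//= subr0.
Qed.

Lemma integrable_itv_cst c t : mu.-integrable `[0, t] (EFin \o cst c).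
Proof.
apply: continuous_compact_integrable; first exact: segment_compact.
by move=> x; exact: cvg_cst.
Qed.

Lemma int_path_le (b : R -> R) t M : mu.-integrable `[0, T] (EFin \o b) ->
  (forall s, 0 <= s <= T -> `|b s| <= M) -> 0 <= t <= T ->
  `|int_path b t| <= M * T.
Proof.
move=> ib bM /[dup] tT /andP[t0 tleT]; rewrite int_pathE//.
have sub : `[0, t]%classic `<=` `[0, T]%classic.
  by apply: subset_itvl; rewrite bnd_simp.
have ibt : mu.-integrable `[0, t] (EFin \o b) by apply: (@integrableS _ _ _ mu `[0, T]).
apply: (le_trans (le_normr_Rintegral _ ibt)) => //.
apply: (@le_trans _ _ (\int[mu]_(s in `[0, t]) (cst M) s)).
  apply: le_Rintegral => //; first exact: integrable_norm.
    exact: integrable_itv_cst.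
  by move=> s /sub /=; rewrite in_itv/=; exact: bM.
rewrite Rintegral_itv_cst// ler_wpM2l//.
by apply: (le_trans (normr_ge0 _) (bM 0 _)); rewrite lexx ltW.
Qed.

Lemma int_cpath_norm f : `|int_path f| <= T * `|f|.
Proof.
rewrite cpath_norm_le_grid//; apply/asboolP => p.
rewrite mulrC; apply: int_path_le.
- by apply: cpath_integrable; rewrite lexx ltW.
- by move=> s _; exact: cpath_norm_ub.
- by have := gridP T_gt0 p; rewrite /= in_itv.
Qed.

Lemma measurable_int_cpath d (U : measurableType d) (F : U -> cpath T) :
  measurable_fun setT F -> measurable_fun setT (fun u => int_path (F u)).
Proof.
move=> mF; apply/measurable_cpathP => // t.
apply: (measurableT_comp _ mF (f := fun f : cpath T => int_path f t)).
apply: (@lipschitz_measurable_cpath _ _ _ T) => f g.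
rewrite -cpathB -int_cpathB (le_trans (cpath_norm_ub _ _))//.
exact: int_cpath_norm.
Qed.

Lemma cpath_continuous_at f t : 0 < t < T -> {for t, continuous f}.
Proof.
move=> tT; have /continuous_within_itvP := @cpath_continuous _ _ f.
by move=> /(_ T_gt0)[+ _ _]; apply; rewrite in_itv.
Qed.

Lemma is_derive_int_cpath f t : 0 < t < T ->
  is_derive t (1 : R) (int_path f : R -> R) (f t).
Proof.
move=> /[dup] tT /andP[t0 tleT].
have eqF : \forall s \near t, \int[mu]_(r in `[0, s]) f r = int_path f s.
  near=> s; rewrite int_cpathE//; apply/andP; split; apply: ltW; near: s.
    exact: lt_nbhsr.
  exact: lt_nbhsl.
have := @continuous_FTC1 R f (BLeft 0) t T tleT.
have fi : mu.-integrable `[0, T] (EFin \o f).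
  by apply: cpath_integrable; rewrite lexx ltW.
move=> /(_ fi) /=; rewrite ?lte_fin => /(_ t0 (@cpath_continuous_at f t tT)) [dF F'].
apply: (near_eq_is_derive eqF).
by apply: DeriveDef => //; rewrite -derive1E.
Unshelve. all: by end_near. Qed.

(* The solution of X = V + a int X is V_t + a e^(a t) int_0^t e^(-a s) V_s ds. *)
Definition expweight a V : cpath T := path_of (fun s => expR (- (a * s)) * V s).

Definition resolvent a V : cpath T :=
  path_of (fun t => V t + a * (expR (a * t) * int_path (expweight a V) t)).

Lemma continuous_expM a : continuous (fun t : R => expR (a * t)).
Proof.
move=> x; apply: continuous_comp; last exact: continuous_expR.
by apply: continuousM => //; exact: cvg_cst.
Qed.

Lemma within_cpathM (h : R -> R) f : continuous h ->
  {within `[0, T], continuous (fun t => h t * f t)}.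
Proof.
move=> ch x; apply: (@continuousM _ (subspace `[0, T])).
  exact: continuous_subspaceT.
exact: (@cpath_continuous _ _ f).
Qed.

Lemma expweightE a V t : 0 <= t <= T ->
  expweight a V t = expR (- (a * t)) * V t.
Proof.
move=> tT; apply: path_ofE => //; apply: within_cpathM => x.
by under eq_fun do rewrite -mulNr; exact: continuous_expM.
Qed.

Lemma resolventE a V t : 0 <= t <= T ->
  resolvent a V t = V t + a * (expR (a * t) * int_path (expweight a V) t).
Proof.
move=> tT; apply: path_ofE => // x.
apply: (@continuousD _ R^o (subspace `[0, T])).
  exact: (@cpath_continuous _ _ V).
apply: (@continuousM _ (subspace `[0, T])); first exact: cvg_cst.
exact/within_cpathM/continuous_expM.
Qed.

(** The function exp(a s) U(s), with U the primitive of the weighted input, vanishes at 0 and has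
    the resolvent as derivative; it is therefore the integral that the definition multiplies by a.
    The product is differentiable even though V is only continuous, as V enters through U alone. *)
Lemma resolvent_eq a V : resolvent a V = V + a *: int_path (resolvent a V).
Proof.
pose U := int_path (expweight a V).
have T0 : (0 : R) <= 0 <= T by rewrite (ltW T_gt0) andbT.
apply: cpath_eq => // t tT; rewrite cpathD cpathZ resolventE//; congr (_ + a * _).
rewrite [RHS]int_cpathE //.
move: (tT) => /andP[]; rewrite le_eqVlt => /predU1P[<- _|t0 tleT].
  by rewrite int_cpathE// set_itv1 !Rintegral_set1 mulr0.
pose F s := expR (a * s) * U s.
have dF s : 0 < s < T -> is_derive s (1 : R) F (resolvent a V s).
  move=> sT; have sT' : 0 <= s <= T by move: sT => /andP[/ltW-> /ltW->].
  have dU := is_derive_int_cpath (expweight a V) sT.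
  have dE : is_derive s (1 : R) (fun s : R => expR (a * s)) (a * expR (a * s)).
    have : is_derive s (1 : R) (fun s : R => a * s) a.
      by apply: is_derive_eq; rewrite [LHS]mulr1.
    by move=> ?; apply: is_derive_eq; rewrite mulrC.
  apply: is_derive_eq.
  rewrite resolventE// expweightE// -/U [_ *: _]mulrA -expRD subrr expR0 mul1r.
  by congr (_ + _); rewrite -[LHS]/(U s * _) mulrC mulrA.
have cF : {within `[0, t], continuous F}.
  have : {within `[0, T], continuous F} by exact/within_cpathM/continuous_expM.
  by apply: continuous_subspaceW; apply: subset_itvl; rewrite bnd_simp.
have sub s : s \in `]0, t[ -> 0 < s < T.
  by rewrite in_itv/= => /andP[-> st]; rewrite (lt_le_trans st).
have FTC : (\int[mu]_(s in `[0%R, t]) (resolvent a V s)%:E = (F t)%:E - (F 0%R)%:E)%E.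
  apply: continuous_FTC2 => //.
  - apply: continuous_subspaceW (@cpath_continuous _ _ (resolvent a V)).
    by apply: subset_itvl; rewrite bnd_simp.
  - have /(continuous_within_itvP _ t0)[_ ? ?] := cF; split => // s /sub st.
    by have [] := dF _ st.
  - by move=> s /sub st; rewrite derive1E; have [_ ->] := dF _ st.
rewrite -[RHS]/(fine (\int[mu]_(s in `[0%R, t]) (resolvent a V s)%:E)%E) FTC/=.
by rewrite /F /U (int_cpathE _ T0) set_itv1 Rintegral_set1 mulr0 subr0.
Qed.

End cpath_ode.

(** * Norm bounds, measurability of the resolvent, and Picard iteration *)

Section cpath_state.
Variables (R : realType) (T : R).
Hypothesis T_gt0 : 0 < T.
Implicit Types (f g z V : cpath T) (a c t : R).
Notation mu := (@lebesgue_measure R).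

Lemma cpath_norm_le_itv f M :
  (forall t, 0 <= t <= T -> `|f t| <= M) -> `|f| <= M.
Proof.
move=> fM; rewrite cpath_norm_le_grid//; apply/asboolP => p; apply: fM.
by have := gridP T_gt0 p; rewrite /= in_itv.
Qed.

(** One exponential bounds the factor outside the integral, the other the weight inside it; T bounds
    the norm of integration. *)
Lemma resolvent_norm a V C : `|a| <= C ->
  `|resolvent a V| <= (1 + C * (expR (C * T) * (T * expR (C * T)))) * `|V|.
Proof.
move=> aC; have C0 : 0 <= C by rewrite (le_trans _ aC).
have eC t : 0 <= t <= T -> expR (a * t) <= expR (C * T) /\
    expR (- (a * t)) <= expR (C * T).
  move=> /andP[t0 tT]; rewrite !ler_expR.
  have : `|a * t| <= C * T by rewrite normrM ler_pM// ger0_norm.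
  by rewrite ler_norml => /andP[? ?]; split; lra.
have ew : `|expweight a V| <= expR (C * T) * `|V|.
  apply: cpath_norm_le_itv => t tT; rewrite expweightE// normrM ler_pM//.
    by rewrite ger0_norm ?expR_ge0//; have [] := eC t tT.
  exact: cpath_norm_ub.
apply: cpath_norm_le_itv => t tT; rewrite resolventE//.
rewrite (le_trans (ler_normD _ _))// mulrDl mul1r lerD ?cpath_norm_ub//.
rewrite normrM -mulrA ler_pM// normrM -mulrA ler_pM//.
  by rewrite ger0_norm ?expR_ge0//; have [] := eC t tT.
rewrite (le_trans (cpath_norm_ub _ _))// (le_trans (int_cpath_norm _ _))//.
by rewrite -mulrA ler_wpM2l// ltW.
Qed.

Lemma gridT p : 0 <= grid T p <= T.
Proof. by have := gridP T_gt0 p; rewrite /= in_itv. Qed.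

Lemma measurable_cpathD d (U : measurableType d) (F G : U -> cpath T) :
  measurable_fun setT F -> measurable_fun setT G ->
  measurable_fun setT (fun u => F u + G u).
Proof.
move=> /(measurable_cpathP T_gt0) mF /(measurable_cpathP T_gt0) mG.
apply/measurable_cpathP => // t.
by apply: (@measurable_funD _ _ _ _ (fun u => F u t) (fun u => G u t)).
Qed.

Lemma measurable_cpathZ d (U : measurableType d) (a : U -> R) (F : U -> cpath T) :
  measurable_fun setT a -> measurable_fun setT F ->
  measurable_fun setT (fun u => a u *: F u).
Proof.
move=> ma /(measurable_cpathP T_gt0) mF.
apply/measurable_cpathP => // t.
by apply: (@measurable_funM _ _ _ _ a (fun u => F u t)).
Qed.

Lemma measurable_resolvent d (U : measurableType d) (a : U -> R) (V : U -> cpath T) :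
  measurable_fun setT a -> measurable_fun setT V ->
  measurable_fun setT (fun u => resolvent (a u) (V u)).
Proof.
move=> ma mV; have mVt := (measurable_cpathP T_gt0 _).1 mV.
have mew : measurable_fun setT (fun u => expweight (a u) (V u)).
  apply: measurable_fun_cpath => // p.
  under eq_fun do rewrite expweightE ?gridT//.
  apply: measurable_funM => //; apply: measurableT_comp => //.
  by apply: measurable_funN; apply: measurable_funM.
apply: measurable_fun_cpath => // p.
under eq_fun do rewrite resolventE ?gridT//.
apply: measurable_funD => //; apply: measurable_funM => //.
apply: measurable_funM; first by apply: measurableT_comp => //; apply: measurable_funM.
have /(measurable_cpathP T_gt0) := measurable_int_cpath T_gt0 mew.
exact.
Qed.

Lemma Rintegral_exprn t n : 0 <= t ->
  \int[mu]_(s in `[0, t]) (s ^+ n) = t ^+ n.+1 / n.+1%:R.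
Proof.
rewrite le_eqVlt => /predU1P[<-|t0].
  by rewrite set_itv1 Rintegral_set1 expr0n mul0r.
have FTC : (\int[mu]_(s in `[0%R, t]) (s ^+ n)%:E =
    (t ^+ n.+1 / n.+1%:R)%:E - (0 ^+ n.+1 / n.+1%:R)%:E)%E.
  have dF s : is_derive s (1 : R) (fun s : R => s ^+ n.+1 / n.+1%:R) (s ^+ n).
    have dX : is_derive s (1 : R) (fun s : R => s ^+ n.+1) (n.+1%:R * s ^+ n).
      apply: DeriveDef; first exact: exprn_derivable.
      by rewrite exp_derive/= [LHS]mulr1.
    have := @is_deriveZ _ _ _ (fun s : R => s ^+ n.+1) n.+1%:R^-1 s 1 _ dX.
    rewrite [_ *: _]mulKf ?pnatr_eq0// => dZ.
    by under eq_fun do rewrite mulrC; exact: dZ.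
  apply: (@continuous_FTC2 R (fun s => s ^+ n) (fun s => s ^+ n.+1 / n.+1%:R) 0 t) => //.
  - by apply: continuous_subspaceT => x; exact: exprn_continuous.
  - have cF : continuous (fun s : R => s ^+ n.+1 / n.+1%:R).
      by move=> x; apply: cvgM; [exact: exprn_continuous|exact: cvg_cst].
    split; first by move=> s _; have [] := dF s.
      by apply: cvg_at_right_filter; exact: cF.
    by apply: cvg_at_left_filter; exact: cF.
  - by move=> s _; rewrite derive1E; have [_ ->] := dF s.
rewrite -[LHS]/(fine (\int[mu]_(s in `[0%R, t]) (s ^+ n)%:E)%E) FTC/=.
by rewrite expr0n mul0r subr0.
Qed.

(** One Picard step, shared by the scalar and the collective uniqueness results: integrating the
    bound raises the power of t and divides by n + 1, so that iteration builds up a factorial. *)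
Lemma lin_step f z a c C A B n : `|a| <= C -> `|c| <= C ->
  f = int_path T (a *: f + c *: z) ->
  (forall t, 0 <= t <= T -> `|f t| <= A * t ^+ n) ->
  (forall t, 0 <= t <= T -> `|z t| <= B * t ^+ n) ->
  forall t, 0 <= t <= T -> `|f t| <= C * (A + B) / n.+1%:R * t ^+ n.+1.
Proof.
move=> aC cC fE fA zB t /[dup] tT /andP[t0 tleT].
have C0 : 0 <= C by rewrite (le_trans _ aC).
rewrite {1}fE int_cpathE//.
have ig := cpath_integrable (a *: f + c *: z) tT.
apply: (le_trans (le_normr_Rintegral _ ig)) => //.
have ie : mu.-integrable `[0, t] (EFin \o (fun s : R => s ^+ n)).
  apply: continuous_compact_integrable; first exact: segment_compact.
  by apply: continuous_subspaceT => x; exact: exprn_continuous.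
apply: (@le_trans _ _ (\int[mu]_(s in `[0, t]) (C * (A + B) * s ^+ n))).
  apply: le_Rintegral => //; first exact: integrable_norm.
    apply: continuous_compact_integrable; first exact: segment_compact.
    apply: continuous_subspaceT => x.
    by apply: cvgM; [exact: cvg_cst|exact: exprn_continuous].
  move=> s; rewrite /= in_itv/= => /andP[s0 st].
  have sT : 0 <= s <= T by rewrite s0 (le_trans st).
  rewrite -[X in `|X|]/(a * f s + c * z s) (le_trans (ler_normD _ _))//.
  rewrite !normrM -mulrA mulrDl mulrDr.
  by rewrite lerD// ler_pM//; [exact: fA|exact: zB].
by rewrite RintegralZl// Rintegral_exprn// mulrA mulrAC.
Qed.

Lemma cvg_expr_fact (x : R) : (x ^+ n / n`!%:R @[n --> \oo] --> (0 : R)).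
Proof. exact: (cvg_series_cvg_0 (is_cvg_series_exp_coeff x)). Qed.

Lemma norm_expr_fact_eq0 f M K :
  (forall n t, 0 <= t <= T -> `|f t| <= M * ((K * t) ^+ n / n`!%:R)) -> f = 0.
Proof.
move=> fM; apply/eqP; rewrite -normr_le0.
apply: cpath_norm_le_itv => t tT.
have M0 : M * ((K * t) ^+ n / n`!%:R) @[n --> \oo] --> (0 : R).
  rewrite -[X in _ --> X](mulr0 M).
  by apply: cvgM; [exact: cvg_cst|exact: cvg_expr_fact].
by apply: (cvgr_to_ge M0); apply: nearW => n; exact: fM.
Qed.

Lemma lin_unique f a : f = int_path T (a *: f) -> f = 0.
Proof.
move=> fE; apply: (@norm_expr_fact_eq0 _ `|f| `|a|) => // n.
elim: n => [|n IH] t tT; first by rewrite expr0 divr1 mulr1 cpath_norm_ub.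
(* The scalar equation is the coupled one with c = 0 and z = 0. *)
have fE' : f = int_path T (a *: f + 0 *: (0 : cpath T)) by rewrite scaler0 addr0.
have := @lin_step f 0 a 0 `|a| (`|f| * (`|a| ^+ n / n`!%:R)) 0 n _ _ fE'.
move=> /(_ _ _ _ _ t tT)/le_trans; apply=> //.
- by rewrite normr0.
- by move=> s sT; rewrite (le_trans (IH s sT))// exprMn mulrAC mulrA.
- by move=> s _; rewrite normr0 mul0r.
- rewrite addr0 exprMn factS natrM invfM [ `|a| ^+ n.+1]exprS.
  set x := n.+1%:R^-1; set y := _^-1; set s := t ^+ n.+1; set b := `|a| ^+ n.
  by rewrite le_eqVlt; apply/orP; left; apply/eqP; ring.
Qed.

End cpath_state.

(** * Gronwall estimate for a family coupled through its average *)

Section collective_gronwall.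
Variables (R : realType) (T : R).
Hypothesis T_gt0 : 0 < T.
Context d (U : measurableType d) (lam : probability U R).

Lemma measurable_EFin_cpath_norm d' (V : measurableType d') (F : V -> cpath T) :
  measurable_fun setT F -> measurable_fun setT (fun u => (`|F u|)%:E).
Proof.
move=> mF; apply/measurable_EFinP.
exact: (measurableT_comp (@measurable_cpath_norm R T)).
Qed.

Lemma measurable_EFin_cpath_eval d' (V : measurableType d') (F : V -> cpath T) t :
  measurable_fun setT F -> measurable_fun setT (fun u => (`|F u t|)%:E).
Proof.
move=> /(measurable_cpathP T_gt0) mF; apply/measurable_EFinP.
exact: measurableT_comp.
Qed.

(** Induction on n gives a bound with factor |D u| + M, where M is the mean of the norms. Averaged
    over y this factor becomes 2 M, so one Picard step produces C (|D u| + 3 M), which 4 C (|D u| +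
    M) absorbs. Each n costs one null set, and the factorial sends the bound to 0. *)
Lemma collective_unique (D Z : U -> cpath T) (a c : U -> R) C :
  (forall u, `|a u| <= C) -> (forall u, `|c u| <= C) ->
  measurable_fun setT D -> (\int[lam]_u (`|D u|)%:E < +oo)%E ->
  {ae lam, forall u, D u = int_path T (a u *: D u + c u *: Z u)} ->
  {ae lam, forall u t, 0 <= t <= T ->
    ((`|Z u t|)%:E <= \int[lam]_y (`|D y t|)%:E)%E} ->
  {ae lam, forall u, D u = 0}.
Proof.
move=> aC cC mD iD DE ZD.
have C0 : 0 <= C by apply: le_trans (aC point).
pose M := fine (\int[lam]_u (`|D u|)%:E).
have M0 : 0 <= M by apply: fine_ge0; exact: integral_ge0.
have ME : (\int[lam]_u (`|D u|)%:E = M%:E)%E.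
  by rewrite /M fineK// ge0_fin_numE//; exact: integral_ge0.
have bound n : {ae lam, forall u t, 0 <= t <= T ->
    `|D u t| <= (`|D u| + M) * ((4 * C) ^+ n / n`!%:R) * t ^+ n}.
  elim: n => [|n IH].
    apply: aeW => u t tT; rewrite expr0 divr1 !mulr1.
    by rewrite (le_trans (cpath_norm_ub _ _))// lerDl.
  have k0 : 0 <= (4 * C) ^+ n / n`!%:R by rewrite divr_ge0// exprn_ge0// mulr_ge0.
  have ZM : {ae lam, forall u t, 0 <= t <= T ->
      `|Z u t| <= 2 * M * ((4 * C) ^+ n / n`!%:R) * t ^+ n}.
    apply: filterS ZD => u Zu t /[dup] tT /andP[t0 _].
    rewrite -lee_fin (le_trans (Zu t tT))//.
    have kt0 : 0 <= (4 * C) ^+ n / n`!%:R * t ^+ n by rewrite mulr_ge0// exprn_ge0.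
    apply: (@le_trans _ _ (\int[lam]_y ((`|D y| + M) * ((4 * C) ^+ n / n`!%:R) * t ^+ n)%:E)%E).
      apply: ae_ge0_le_integral => //.
      - exact: measurable_EFin_cpath_eval.
      - by move=> u' _; rewrite lee_fin -mulrA mulr_ge0// addr_ge0.
      - apply/measurable_EFinP; do 2 apply: measurable_funM => //.
        apply: measurable_funD => //.
        exact: (measurableT_comp (@measurable_cpath_norm R T)).
      - by apply: filterS IH => y Dy _; rewrite lee_fin Dy.
    under eq_integral do rewrite -mulrA mulrC EFinM EFinD.
    rewrite ge0_integralZl//; last 2 first.
    - by apply: emeasurable_funD => //; exact: measurable_EFin_cpath_norm.
    - by move=> y _; rewrite adde_ge0// lee_fin.
    rewrite ge0_integralD//; last exact: measurable_EFin_cpath_norm.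
    rewrite ME integral_cst//= probability_setT mule1 -EFinD -EFinM lee_fin.
    set k := (4 * C) ^+ n / n`!%:R; set s := t ^+ n.
    by rewrite le_eqVlt; apply/orP; left; apply/eqP; ring.
  apply: filterS3 IH ZM DE => u Du Zu Eu t /[dup] tT /andP[t0 _].
  apply: (le_trans (lin_step T_gt0 (aC u) (cC u) Eu Du Zu tT)).
  rewrite ler_wpM2r ?exprn_ge0//.
  rewrite factS natrM invfM exprS -mulrDl.
  set x := n.+1%:R^-1; set y := n`!%:R^-1; set b := (4 * C) ^+ n.
  have -> : C * ((`|D u| + M + 2 * M) * (b * y)) * x =
     (`|D u| + M + 2 * M) * (C * (b * y) * x) by ring.
  have -> : (`|D u| + M) * (4 * C * b * (x * y)) =
     (4 * (`|D u| + M)) * (C * (b * y) * x) by ring.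
  rewrite ler_wpM2r//; first by rewrite !mulr_ge0 ?invr_ge0// /b exprn_ge0// mulr_ge0.
  by have := normr_ge0 (D u); lra.
have /ae_foralln := bound; apply: filterS => u Du.
apply: (@norm_expr_fact_eq0 _ _ T_gt0 _ (`|D u| + M) (4 * C)) => n t tT.
rewrite (le_trans (Du n t tT))// [(4 * C * t) ^+ n]exprMn.
set x := n`!%:R^-1; set b := (4 * C) ^+ n; set s := t ^+ n.
by rewrite le_eqVlt; apply/orP; left; apply/eqP; ring.
Qed.

End collective_gronwall.

(** * Fubini extensions and the exact law of large numbers *)

Section sections.
Context d1 d2 (X : measurableType d1) (Y : measurableType d2) (R : realType).
Context (mu : probability X R) (nu : probability Y R).

Lemma measurable_integrable_indic (N : set Y) :
  nu.-integrable setT (EFin \o (\1_N : Y -> R)) -> measurable N.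
Proof. by move=> /measurable_int/measurable_EFinP/measurable_indicP. Qed.

Lemma integrable_indic (N : set Y) : measurable N ->
  nu.-integrable setT (EFin \o (\1_N : Y -> R)).
Proof.
move=> mN; apply/integrableP; split.
  by apply/measurable_EFinP; exact: measurable_indic.
under eq_integral => x _ do rewrite /= ger0_norm//.
by rewrite integral_indic// setIT (le_lt_trans (probability_le1 _ mN))// ltry.
Qed.

(** The measure of the section is a nonnegative function of x with zero integral. Nothing is said of
    N as a subset of the product: [N x] is measurable wherever its indicator is integrable, which is
    the form in which the Fubini property delivers it. *)
Lemma negligible_sections (N : X -> set Y) (h : X -> R) :
  {ae mu, forall x, nu.-integrable setT (fun y => (\1_(N x) y : R)%:E)} ->
  {ae mu, forall x, ((h x)%:E = \int[nu]_y (\1_(N x) y)%:E)%E} ->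
  mu.-integrable setT (EFin \o h) -> (\int[mu]_x (h x)%:E = 0)%E ->
  {ae mu, forall x, nu.-negligible (N x)}.
Proof.
move=> iN hE ih h0.
have : {ae mu, forall x, setT x -> `|(h x)%:E|%E = 0%E}.
  have mh := measurable_int _ ih.
  have : ae_eq mu setT (EFin \o h) (cst 0%E).
    apply/(ae_eq_integral_abs mu measurableT) => //.
    rewrite -[RHS]h0; apply: ae_eq_integral => //.
      exact: measurableT_comp.
    apply: filterS hE => x hx _; rewrite -[(EFin \o h) x]/((h x)%:E) hx gee0_abs//.
    by apply: integral_ge0 => y _; rewrite lee_fin.
  apply: filterS => x hx _.
  by rewrite -[(h x)%:E]/((EFin \o h) x) (hx Logic.I) abse0.
apply: filterS3 iN hE => x iNx hx /(_ Logic.I)/eqP; rewrite abse_eq0 => /eqP h0x.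
have mN := measurable_integrable_indic iNx.
exists (N x); split => //.
by rewrite -h0x hx integral_indic// setIT.
Qed.

Lemma integral_negligible_sections (N : X -> set Y) (h : X -> R) :
  {ae mu, forall x, nu.-integrable setT (fun y => (\1_(N x) y : R)%:E)} ->
  {ae mu, forall x, ((h x)%:E = \int[nu]_y (\1_(N x) y)%:E)%E} ->
  mu.-integrable setT (EFin \o h) ->
  {ae mu, forall x, nu.-negligible (N x)} ->
  (\int[mu]_x (h x)%:E = 0)%E.
Proof.
move=> iN hE ih N0.
rewrite -(integral0 mu setT); apply: ae_eq_integral => //.
  exact: measurable_int ih.
apply: filterS3 iN hE N0 => x iNx hx N0x _; rewrite hx.
have mN := measurable_integrable_indic iNx.
rewrite integral_indic// setIT; exact/negligibleP.
Qed.

End sections.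

Section fubini_extension_theory.
Context d dI (Om : measurableType d) (I : measurableType dI) (R : realType).
Context (P : probability Om R) (lam : probability I R).
Context (W : set (set (Om * I))) (Q : probability (g_sigma_algebraType W) R).
Hypothesis QF : fubini_extension P lam Q.
Notation OmI := (g_sigma_algebraType W).

Lemma measurable_boxtimes (A : set (Om * I)) :
  measurable A -> measurable (A : set OmI).
Proof. by case: QF => _ WP _ /WP[WA _]; exact: sub_sigma_algebra. Qed.

Lemma measurable_fun_boxtimes d' (U : measurableType d') (f : Om * I -> U) :
  measurable_fun setT f -> measurable_fun setT (f : OmI -> U).
Proof.
move=> mf _ B mB; rewrite setTI; apply: measurable_boxtimes.
by rewrite -[X in measurable X]setTI; exact: mf.
Qed.

Lemma ae_boxtimes1 (A : Om * I -> Prop) :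
  {ae Q, forall p, A p} -> {ae P, forall om, {ae lam, forall x, A (om, x)}}.
Proof.
move=> [N [mN N0 AN]].
have [_ _ /(_ _ (integrable_indic Q mN))[_ iN _ [h [hE ih hN]]]] := QF.
have := @negligible_sections _ _ _ _ _ P lam (fun om => [set x | N (om, x)]) h iN hE ih.
rewrite hN integral_indic// setIT => /(_ N0).
apply: filterS => om; apply: negligibleS => x /= nA; exact: AN.
Qed.

(** Measurability of A is part of the data here, because null sections alone do not place a set in
    the field generated by W. *)
Lemma boxtimes_ae1 (A : set (Om * I)) : measurable (A : set OmI) ->
  {ae P, forall om, {ae lam, forall x, A (om, x)}} -> {ae Q, forall p, A p}.
Proof.
move=> mA AE; have mN := measurableC mA.
have [_ _ /(_ _ (integrable_indic Q mN))[_ iN _ [h [hE ih hN]]]] := QF.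
have := @integral_negligible_sections _ _ _ _ _ P lam
  (fun om => [set x | (~` A) (om, x)]) h iN hE ih AE.
rewrite hN integral_indic// setIT => N0.
by exists (~` A); split; [exact: mN|exact: N0|].
Qed.

Lemma boxtimes_ae2 (A : set (Om * I)) : measurable (A : set OmI) ->
  {ae lam, forall x, {ae P, forall om, A (om, x)}} -> {ae Q, forall p, A p}.
Proof.
move=> mA AE; have mN := measurableC mA.
have [_ _ /(_ _ (integrable_indic Q mN))[iN _ [h [hE ih hN]] _]] := QF.
have := @integral_negligible_sections _ _ _ _ _ lam P
  (fun x => [set om | (~` A) (om, x)]) h iN hE ih AE.
rewrite hN integral_indic// setIT => N0.
by exists (~` A); split; [exact: mN|exact: N0|].
Qed.

End fubini_extension_theory.

Lemma bounded_integrable d (U : measurableType d) (R : realType)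
    (mu : probability U R) (f : U -> R) (K : R) :
  measurable_fun setT f -> (forall u, `|f u| <= K) ->
  mu.-integrable setT (EFin \o f).
Proof.
move=> mf fK; apply/integrableP; split; first exact/measurable_EFinP.
apply: (@le_lt_trans _ _ (\int[mu]_x (cst K%:E) x)%E); last first.
  by rewrite integral_cst//= probability_setT mule1 ltry.
apply: ge0_le_integral => //.
- by apply: measurableT_comp => //; exact/measurable_EFinP.
- by move=> u _; rewrite lee_fin.
Qed.

(** The joint law and the product of the two laws agree on rectangles, hence everywhere; Fubini for
    the product law then factorises the integral. Two functions [phi] and [psi] are allowed because
    the functional of the noise varies with the index. *)
Lemma independent2_integralM d d' (Om : measurableType d) (S : measurableType d')
    (R : realType) (P : probability Om R) (X Y : {mfun Om >-> S}) (phi psi : S -> R) (K : R) :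
  measurable_fun setT phi -> measurable_fun setT psi ->
  (forall s, `|phi s| <= K) -> (forall s, `|psi s| <= K) ->
  independent2 P X Y ->
  (\int[P]_om (phi (X om) * psi (Y om))%:E =
   (\int[P]_om (phi (X om))%:E) * (\int[P]_om (psi (Y om))%:E))%E.
Proof.
move=> mphi mpsi phiK psiK XY.
have mXY : measurable_fun setT (fun om => (X om, Y om)).
  by apply: measurable_fun_pair; exact: measurable_funP.
pose Z : {mfun Om >-> (S * S)%type} := mfun_Sub (mem_set mXY).
pose F (s : (S * S)%type) := (phi s.1 * psi s.2)%:E.
have mF : measurable_fun setT F.
  apply/measurable_EFinP; apply: measurable_funM.
    exact: (measurableT_comp mphi measurable_fst).
  exact: (measurableT_comp mpsi measurable_snd).
have FK s : `|phi s.1 * psi s.2| <= K * K by rewrite normrM ler_pM.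
have law (f : S -> R) (X0 : {mfun Om >-> S}) : measurable_fun setT f -> (forall s, `|f s| <= K) ->
    (\int[P]_om (f (X0 om))%:E = \int[distribution P X0]_s (f s)%:E)%E.
  move=> mf fK; rewrite (integral_pushforward (measurable_funP X0))//.
  - exact/measurable_EFinP.
  - apply: (@bounded_integrable _ _ _ _ _ K) => [|om]; last exact: fK.
    exact: measurableT_comp.
have -> : (\int[P]_om (phi (X om) * psi (Y om))%:E =
    \int[distribution P Z]_s F s)%E.
  rewrite (integral_pushforward mXY)//.
  apply: (@bounded_integrable _ _ _ _ (fun om => phi (X om) * psi (Y om)) (K * K)).
    by apply: measurable_funM; apply: measurableT_comp.
  by move=> om; rewrite normrM ler_pM.
rewrite (law _ _ mphi phiK) (law _ _ mpsi psiK).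
rewrite (eq_measure_integral (distribution P X \x distribution P Y)%E); last first.
  move=> A mA _; apply/esym; apply: product_measure_unique mA => B C mB mC.
  exact: (XY B C mB mC).
have iF : (distribution P X \x distribution P Y)%E.-integrable setT F.
  apply/integrableP; split => //.
  apply: (@le_lt_trans _ _ (\int[(distribution P X \x distribution P Y)%E]_x (cst (K * K)%:E) x)%E).
    apply: ge0_le_integral => //.
    - by apply: measurableT_comp.
    - by move=> u _; rewrite lee_fin FK.
  have PXY : (distribution P X \x distribution P Y)%E setT = 1%E.
    rewrite -setXTT.
    have := product_measure1E (distribution P X) (distribution P Y) measurableT measurableT.
    by move=> ->; rewrite /= /distribution /pushforward !preimage_setT !probability_setT mule1.
  by rewrite integral_cst//= PXY mule1 ltry.
have [c cE] : exists c : R, (\int[distribution P Y]_s (psi s)%:E = c%:E)%E.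
  exists (fine (\int[distribution P Y]_s (psi s)%:E)%E); rewrite fineK//.
  by apply: integrable_fin_num => //; apply: (@bounded_integrable _ _ _ _ _ K).
rewrite -integral12_prod_meas1// cE /fubini_F.
transitivity (\int[distribution P X]_s ((phi s)%:E * c%:E))%E; last first.
  by rewrite integralZr//; apply: (@bounded_integrable _ _ _ _ _ K).
apply: eq_integral => s _; rewrite /F /=.
under eq_integral do rewrite EFinM.
rewrite integralZl//; last by apply: (@bounded_integrable _ _ _ _ _ K).
congr (_ * _)%E; exact: cE.
Qed.

(** * The exact law of large numbers *)

Section law_of_large_numbers.
Context d dI (Om : measurableType d) (I : measurableType dI) (R : realType).
Context (P : probability Om R) (lam : probability I R).
Context (W : set (set (Om * I))) (Q : probability (g_sigma_algebraType W) R).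
Hypothesis QF : fubini_extension P lam Q.
Notation OmI := (g_sigma_algebraType W).

(** Any measurable version k of the partial integral may replace the unspecified version that the
    Fubini property provides. *)
Lemma boxtimes_integral1 (f : Om * I -> R) (k : Om -> R) :
  Q.-integrable setT (EFin \o f) -> measurable_fun setT k ->
  {ae P, forall om, ((k om)%:E = \int[lam]_x (f (om, x))%:E)%E} ->
  (\int[P]_om (k om)%:E = \int[Q]_p (f p)%:E)%E.
Proof.
move=> fi mk kE; have [_ _ /(_ f fi)[_ _ _ [h [hE hi <-]]]] := QF.
apply: ae_eq_integral => //.
- exact/measurable_EFinP.
- exact: measurable_int hi.
- by apply: filterS2 kE hE => om -> ->.
Qed.

Lemma boxtimes_integral2 (f : Om * I -> R) (k : I -> R) :
  Q.-integrable setT (EFin \o f) -> measurable_fun setT k ->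
  {ae lam, forall x, ((k x)%:E = \int[P]_om (f (om, x))%:E)%E} ->
  (\int[lam]_x (k x)%:E = \int[Q]_p (f p)%:E)%E.
Proof.
move=> fi mk kE; have [_ _ /(_ f fi)[_ _ [h [hE hi <-]] _]] := QF.
apply: ae_eq_integral => //.
- exact/measurable_EFinP.
- exact: measurable_int hi.
- by apply: filterS2 kE hE => x -> ->.
Qed.

(* With h the average of f over x and m its mean, both E[h^2] and m^2 are computed by
   iterated integration, and they agree; hence h has variance 0. *)
Lemma bounded_uncorrelated_lln (f : Om * I -> R) (K : R) :
  measurable_fun setT (f : OmI -> R) -> (forall p, `|f p| <= K) ->
  (forall x, measurable_fun setT (fun om => f (om, x))) ->
  {ae lam, forall x, {ae lam, forall y,
    (\int[P]_om (f (om, x) * f (om, y))%:E =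
     (\int[P]_om (f (om, x))%:E) * (\int[P]_om (f (om, y))%:E))%E}} ->
  {ae P, forall om, (\int[lam]_x (f (om, x))%:E = \int[Q]_p (f p)%:E)%E}.
Proof.
move=> mf fK mfx funcor.
have K0 : 0 <= K by apply: le_trans (fK point).
have fi : Q.-integrable setT (EFin \o f) by exact: bounded_integrable mf fK.
have [_ _ /(_ f fi)[_ fiom [g [gE gi gm]] [h0 [h0E h0i _]]]] := QF.
have mg : measurable_fun setT g by have /measurable_int/measurable_EFinP := gi.
have mh0 : measurable_fun setT h0 by have /measurable_int/measurable_EFinP := h0i.
have [m mE] : exists m : R, (\int[Q]_p (f p)%:E = m%:E)%E.
  exists (fine (\int[Q]_p (f p)%:E)%E); rewrite fineK//.
  exact: integrable_fin_num.
(* The version [h0] equals the average only almost surely. Truncation at the bound of f yields a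
   version bounded everywhere, whose products are integrable. *)
pose h om := Num.max (- K) (Num.min (h0 om) K).
have mh : measurable_fun setT h.
  by apply: measurable_maxr => //; apply: measurable_minr.
have hK om : `|h om| <= K.
  by rewrite ler_norml /h le_max lexx/= ge_max ge_min lexx orbT andbT; lra.
have hE : {ae P, forall om, ((h om)%:E = \int[lam]_x (f (om, x))%:E)%E}.
  apply: filterS2 (h0E) (fiom) => om h0om iom; rewrite -h0om; congr EFin.
  have : `|h0 om| <= K.
    rewrite -lee_fin -[leLHS]/(`|(h0 om)%:E|)%E h0om.
    apply: (le_trans (le_abse_integral _ _ (measurable_int _ iom))) => //.
    apply: (@le_trans _ _ (\int[lam]_x (cst K%:E) x)%E); last first.
      by rewrite integral_cst//= probability_setT mule1.
    apply: ge0_le_integral => //.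
    - by apply: measurableT_comp => //; exact: measurable_int iom.
    - by move=> x _ /=; rewrite lee_fin.
  by rewrite ler_norml => /andP[? ?]; rewrite /h min_l// max_r.
have ifh : Q.-integrable setT (EFin \o (fun p => f p * h p.1)).
  apply: (@bounded_integrable _ _ _ _ _ (K * K)) => [|p].
    apply: measurable_funM => //.
    by apply: (measurable_fun_boxtimes QF (f := fun p => h p.1)); exact: measurableT_comp.
  by rewrite normrM ler_pM.
have hh : (\int[P]_om (h om * h om)%:E = \int[Q]_p (f p * h p.1)%:E)%E.
  apply: boxtimes_integral1 => //; first exact: measurable_funM.
  apply: filterS2 (hE) (fiom) => om hom iom /=.
  under eq_integral do rewrite EFinM.
  by rewrite integralZr// -hom.
have fh : (\int[lam]_x (m * g x)%:E = \int[Q]_p (f p * h p.1)%:E)%E.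
  apply: boxtimes_integral2 => //; first exact: measurable_funM.
  apply: filterS2 (gE) (funcor) => x gx fx /=.
  (* For fixed x, the product of f with its own section at x has two iterated integrals: averaging
     over y first gives the mean of f(., x) h, averaging over omega first gives the integral of g x
     * g y, by uncorrelatedness. *)
  have iFx : Q.-integrable setT (EFin \o (fun p => f p * f (p.1, x))).
    apply: (@bounded_integrable _ _ _ _ _ (K * K)) => [|p].
      apply: measurable_funM => //.
      apply: (measurable_fun_boxtimes QF (f := fun p => f (p.1, x))).
      exact: (measurableT_comp (mfx x)).
    by rewrite normrM ler_pM.
  have <- : (\int[lam]_y (g x * g y)%:E = (m * g x)%:E)%E.
    under eq_integral do rewrite EFinM.
    by rewrite integralZl// gm mE -EFinM mulrC.
  transitivity (\int[Q]_p (f p * f (p.1, x))%:E)%E.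
    apply: boxtimes_integral2 => //; first exact: measurable_funM.
    apply: filterS2 fx gE => y fxy gy /=; rewrite EFinM gx gy -fxy.
    by apply: eq_integral => om _; rewrite mulrC.
  apply/esym; apply: boxtimes_integral1 => //.
    by apply: measurable_funM => //; exact: mfx.
  apply: filterS2 (hE) (fiom) => om hom iom /=.
  under [RHS]eq_integral do rewrite EFinM.
  by rewrite integralZr// -hom -EFinM mulrC.
have hm : (\int[P]_om (h om)%:E = m%:E)%E.
  by rewrite -mE; apply: boxtimes_integral1.
have ih : P.-integrable setT (EFin \o h) by exact: bounded_integrable mh hK.
have ihh : P.-integrable setT (EFin \o (fun om => h om * h om)).
  apply: (@bounded_integrable _ _ _ _ _ (K * K)) => [|om].
    exact: measurable_funM.
  by rewrite normrM ler_pM.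
(* Expanding the square gives m^2 - 2 m^2 + m^2. *)
have var0 : (\int[P]_om ((h om - m) ^+ 2)%:E = 0)%E.
  have -> : (fun om => ((h om - m) ^+ 2)%:E) =
      (fun om => (h om * h om)%:E + ((- (2 * m))%:E * (h om)%:E + (m * m)%:E))%E.
    by apply/funext => om; rewrite -EFinM -!EFinD; congr EFin; ring.
  have i2 : P.-integrable setT (fun om => (- (2 * m))%:E * (h om)%:E)%E.
    exact: integrableZl.
  have i3 : P.-integrable setT (cst (m * m)%:E).
    by apply: (@bounded_integrable _ _ _ _ (cst (m * m)) `|m * m|).
  rewrite integralD//; last exact: integrableD.
  rewrite integralD// integralZl// hm integral_cst//= probability_setT mule1.
  rewrite hh -fh; under eq_integral do rewrite EFinM.
  rewrite integralZl// gm mE -!EFinM -!EFinD; congr EFin; ring.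
have : ae_eq P setT (fun om => ((h om - m) ^+ 2)%:E) (cst 0%E).
  apply/(ae_eq_integral_abs P measurableT).
    apply/measurable_EFinP; apply: measurable_funX; exact: measurable_funB.
  rewrite -[RHS]var0; apply: eq_integral => om _.
  by rewrite gee0_abs// lee_fin sqr_ge0.
move=> hm0; apply: filterS2 (hE) (hm0) => om <- /(_ Logic.I)/= [/eqP].
by rewrite sqrf_eq0 subr_eq0 => /eqP ->; rewrite mE.
Qed.

(** Independence of the noise passes to measurable functionals of it, which may depend on x.
    Truncation at level n reduces to the bounded case; for almost every fixed omega, dominated
    convergence in x removes the truncation, and the limit is that of deterministic constants. *)
Lemma epi_lln d' (S : measurableType d') (BB : Om * I -> S) (phi : I * S -> R) :
  measurable_fun setT (BB : OmI -> S) ->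
  (forall x, measurable_fun setT (fun om => BB (om, x))) -> epi P lam BB ->
  measurable_fun setT phi ->
  Q.-integrable setT (fun p => (phi (p.2, BB p))%:E) ->
  exists m : R, {ae P, forall om,
    (\int[lam]_x (phi (x, BB (om, x)))%:E = m%:E)%E}.
Proof.
move=> mBB mBBx BBepi mphi fi.
pose phin (n : nat) (q : I * S) := Num.max (- n%:R) (Num.min (phi q) n%:R).
have mphin n : measurable_fun setT (phin n).
  by apply: measurable_maxr => //; apply: measurable_minr.
have phinK n q : `|phin n q| <= n%:R.
  rewrite ler_norml /phin le_max lexx/= ge_max ge_min lexx orbT andbT.
  by rewrite (@le_trans _ _ 0) ?oppr_le0.
have phinE n q : `|phin n q| <= `|phi q|.
  have n0 : 0 <= n%:R :> R by [].
  rewrite /phin; case: (leP (phi q) n%:R) => p1.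
    by case: (leP (phi q) (- n%:R)) => p2 //; rewrite normrN ger0_norm// ler0_norm; lra.
  by rewrite max_r ?(le_trans _ n0) ?oppr_le0// !ger0_norm; lra.
have phin_cvg q : phin n q @[n --> \oo] --> phi q.
  apply: cvg_near_cst; exists (Num.truncn `|phi q|).+1 => // n /= kn.
  have : `|phi q| <= n%:R.
    by rewrite ltW// (lt_le_trans (truncnS_gt _))// ler_nat.
  by rewrite ler_norml => /andP[? ?]; rewrite /phin min_l// max_r.
have lln n : {ae P, forall om, (\int[lam]_x (phin n (x, BB (om, x)))%:E =
    \int[Q]_p (phin n (p.2, BB p))%:E)%E}.
  apply: (@bounded_uncorrelated_lln (fun p => phin n (p.2, BB p)) n%:R) => //.
  - apply: measurableT_comp => //; apply: measurable_fun_pair => //.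
    exact: (measurable_fun_boxtimes QF measurable_snd).
  - by move=> x; apply: measurableT_comp => //; exact: measurable_fun_pair.
  apply: filterS BBepi => x; apply: filterS => y xy.
  pose X : {mfun Om >-> S} := mfun_Sub (mem_set (mBBx x)).
  pose Y : {mfun Om >-> S} := mfun_Sub (mem_set (mBBx y)).
  apply: (@independent2_integralM _ _ _ _ _ P X Y
    (fun s => phin n (x, s)) (fun s => phin n (y, s)) n%:R) => //.
    by apply: measurableT_comp => //; exact: measurable_fun_pair.
  by apply: measurableT_comp => //; exact: measurable_fun_pair.
(* Convergence to [m] is not shown separately: dominated convergence at each good omega yields it
   together with the finiteness of the limit. *)
pose m := limn (fun n => \int[Q]_p (phin n (p.2, BB p))%:E)%E.
have [_ _ /(_ _ fi)[_ fiom _ _]] := QF.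
have mE : {ae P, forall om, (\int[lam]_x (phi (x, BB (om, x)))%:E = (fine m)%:E)%E}.
  have /ae_foralln alln := lln.
  apply: filterS2 (alln) (fiom) => om llnom iom.
  have [] := @dominated_convergence _ _ _ lam _ measurableT
    (fun n x => (phin n (x, BB (om, x)))%:E) (fun x => (phi (x, BB (om, x)))%:E)
    (fun x => (`|phi (x, BB (om, x))|)%:E).
  - move=> n; apply/measurable_EFinP.
    have /measurable_int/measurable_EFinP := iom.
    move=> /= miom; apply: measurable_maxr => //; exact: measurable_minr.
  - exact: measurable_int iom.
  - apply: aeW => x _; apply: cvg_EFin; first exact: nearW.
    exact: phin_cvg.
  - exact: (integrable_norm iom).
  - by apply: aeW => x n _; rewrite lee_fin.
  move=> _ _; under [X in X @ _ --> _ -> _]eq_fun do rewrite llnom.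
  move=> /cvg_lim -/(_ (@ereal_hausdorff R)); rewrite -/m => ->.
  by rewrite fineK//; exact: integrable_fin_num.
by exists (fine m).
Qed.

End law_of_large_numbers.

(** * Countably many test sets for Borel weights *)

Section borel_test.
Context d (X : measurableType d) (R : realType) (mu : probability X R).
Variable pos : X -> R.
Hypothesis mpi : measurable_fun setT pos.

Definition rat_rays : set (set R) := [set A | exists q : rat, A = `]-oo, ratr q[%classic].

Lemma measurable_rat_rays : @measurable _ R = <<s rat_rays >>.
Proof.
apply/seteqP; split => A.
  have -> : @measurable _ R A = <<s @RGenInftyO.G R >> A.
    by rewrite -[LHS]/((@ocitv R).-sigma.-measurable A) RGenInftyO.measurableE.
  apply: smallest_sub; first exact: smallest_sigma_algebra.
  move=> _ [x ->].
  have -> : `]-oo, x[%classic = \bigcup_(q in [set q : rat | ratr q < x])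
      (`]-oo, (ratr q : R)[%classic : set (g_sigma_algebraType rat_rays)).
    apply/seteqP; split => [y|y [q /= qx]]; rewrite /= !in_itv/=.
      move=> /rat_in_itvoo[q]; rewrite in_itv/= => /andP[yq qx].
      by exists q => //=; rewrite in_itv.
    by move=> /lt_trans; apply.
  rewrite bigcup_mkcond.
  apply: (@bigcupT_measurable_rat _ (g_sigma_algebraType rat_rays)) => q.
  case: ifPn => // _; apply: sub_sigma_algebra; by exists q.
apply: smallest_sub; first exact: sigma_algebra_measurable.
by move=> _ [q ->]; exact: measurable_itv.
Qed.

(** The sets B with vanishing integral form a Dynkin system: the zero total integral gives
    complements and integrability gives disjoint unions. Rational rays are stable under intersection
    and generate the Borel field. *)
Lemma integral_borel_eq0 (k : X -> \bar R) :
  mu.-integrable setT k -> (\int[mu]_x k x = 0)%E ->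
  (forall q : rat, \int[mu]_(x in pos @^-1` `]-oo, ratr q[) k x = 0)%E ->
  forall B : set R, measurable B -> (\int[mu]_(x in pos @^-1` B) k x = 0)%E.
Proof.
move=> ik k0 kq B; rewrite measurable_rat_rays.
have mpre A : measurable A -> measurable (pos @^-1` A).
  by move=> mA; rewrite -[X in measurable X]setTI; exact: mpi.
apply: (@dynkin_induction _ _ rat_rays
  (fun B => \int[mu]_(x in pos @^-1` B) k x = 0)%E) => //.
- exact: measurable_rat_rays.
- move=> _ _ [q ->] [r ->].
  wlog qr : q r / q <= r => [H|].
    have [qr|/ltW rq] := leP q r; first exact: H.
    by rewrite setIC; exact: H.
  exists q; apply/seteqP; split => x /=; rewrite !in_itv/=; first by case.
  by move=> xq; split => //; rewrite (lt_le_trans xq)// ler_rat.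
- by move=> _ [q ->]; exact: kq.
- move=> S mS S0.
  move: k0; rewrite -(setUv (pos @^-1` S)) integral_setU.
  + by rewrite S0 add0e.
  + exact: mpre.
  + by apply: measurableC; exact: mpre.
  + by rewrite setUv; exact: measurable_int ik.
  + by apply/disj_setPLR; rewrite setCK.
- move=> F mF tF F0.
  rewrite preimage_bigcup integral_bigcup//.
  + by apply: eseries0 => i _ _; exact: F0.
  + by move=> i j _ _ [x [? ?]]; apply: tF => //; exists (pos x).
  + by move=> i; exact: mpre.
  + apply: (@integrableS _ _ _ mu setT) => //.
    by apply: bigcupT_measurable => i; exact: mpre.
Qed.

(** Discrete layer-cake formula: the number of levels (i+1)/(n+1) not exceeding s is the integer
    part of s (n+1). *)
Lemma sum_level_sets (s : R) n : 0 <= s <= 1 ->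
  0 <= s - \sum_(i < n.+1) n.+1%:R^-1 * (i.+1%:R / n.+1%:R <= s)%R%:R <= n.+1%:R^-1.
Proof.
move=> /andP[s0 s1].
pose j := Num.truncn (s * n.+1%:R).
have /andP[j1 j2] : j%:R <= s * n.+1%:R < j.+1%:R.
  by apply: truncn_itv; rewrite mulr_ge0.
have jn : (j <= n.+1)%N.
  by rewrite -(ler_nat R) (le_trans j1)// ler_piMl.
rewrite -mulr_sumr.
have -> : \sum_(i < n.+1) (i.+1%:R / n.+1%:R <= s)%R%:R = j%:R :> R.
  transitivity (\sum_(i < n.+1 | (i < j)%N) (1 : R)).
    rewrite [RHS]big_mkcond/=; apply: eq_bigr => i _.
    rewrite ler_pdivrMr// -truncn_ge_nat ?mulr_ge0// -/j.
    by case: ltnP.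
  by rewrite -(big_ord_widen n.+1 (fun=> 1))// sumr_const card_ord.
rewrite mulrC subr_ge0 ler_pdivrMr// j1/= lerBlDr -[X in _ <= X + _]mul1r -mulrDl.
by rewrite ler_pdivlMr// addrC natr1 ltW.
Qed.

(* v is a function of [pos] alone, so by a Dynkin argument countably many test functions
   suffice; this gives one null set for all x when v = w x. *)
Lemma integral_borel_test (k v : X -> R) :
  mu.-integrable setT (EFin \o k) -> (\int[mu]_x (k x)%:E = 0)%E ->
  (forall q : rat, \int[mu]_(x in pos @^-1` `]-oo, ratr q[) (k x)%:E = 0)%E ->
  (forall x, 0 <= v x <= 1) ->
  (forall s, exists2 B : set R, measurable B & [set x | s <= v x] = pos @^-1` B) ->
  (\int[mu]_x (v x * k x)%:E = 0)%E.
Proof.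
move=> ik k0 kq v01 vB.
have kB := integral_borel_eq0 ik k0 kq.
have mlev s : measurable [set x | s <= v x].
  by have [B mB ->] := vB s; rewrite -[X in measurable X]setTI; exact: mpi.
have mk : measurable_fun setT k by have /measurable_int/measurable_EFinP := ik.
have mv : measurable_fun setT v.
  apply: (measurability _ (RGenCInfty.measurableE R)) => _ [_ [s ->] <-].
  rewrite setTI; have -> : v @^-1` `[s, +oo[ = [set x | s <= v x].
    by apply/seteqP; split => x /=; rewrite in_itv/= andbT.
  exact: mlev.
have ibk (b : X -> R) : measurable_fun setT b -> (forall x, `|b x| <= 1) ->
    mu.-integrable setT (fun x => (b x * k x)%:E).
  move=> mb b1; apply: (le_integrable _ _ _ ik) => //.
    by apply/measurable_EFinP; exact: measurable_funM.
  by move=> x _ /=; rewrite lee_fin normrM ler_piMl.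
pose K := fine (\int[mu]_x (`|k x|)%:E).
have KE : (\int[mu]_x (`|k x|)%:E = K%:E)%E.
  by rewrite /K fineK//; apply: integrable_fin_num => //; exact: integrable_norm.
(* Layer-cake approximation of v by indicators of its upper level sets. These are preimages of Borel
   sets, so the integral of [a n] against k vanishes. *)
pose a n x : R := \sum_(i < n.+1) n.+1%:R^-1 * (i.+1%:R / n.+1%:R <= v x)%R%:R.
pose lev n i := [set x | i.+1%:R / n.+1%:R <= v x].
have levE n i x : (i.+1%:R / n.+1%:R <= v x)%R%:R = \1_(lev n i) x :> R.
  by rewrite indicE; congr ((nat_of_bool _)%:R); apply/idP/idP => [|/set_mem//]; exact: mem_set.
have ilev n i : mu.-integrable setT (fun x => (n.+1%:R^-1 * \1_(lev n i) x * k x)%:E).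
  under eq_fun do rewrite -mulrA EFinM.
  apply: integrableZl => //; apply: ibk.
    by apply: measurable_indic; exact: mlev.
  by move=> x; rewrite indicE; case: (_ \in _); rewrite ?normr1 ?normr0.
have aE n x : (a n x * k x)%:E = (\sum_(i < n.+1) (n.+1%:R^-1 * \1_(lev n i) x * k x)%:E)%E.
  by rewrite sumEFin /a mulr_suml; congr EFin; apply: eq_bigr => i _; rewrite levE.
have ian n : mu.-integrable setT (fun x => (a n x * k x)%:E).
  by under eq_fun do rewrite aE; apply: integrable_sum => // i _.
have a0 n : (\int[mu]_x (a n x * k x)%:E = 0)%E.
  under eq_integral do rewrite aE.
  rewrite integral_sum// big1// => i _.
  under eq_integral do rewrite -mulrA EFinM.
  rewrite integralZl//; last first.
    apply: ibk; first by apply: measurable_indic; exact: mlev.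
    by move=> x; rewrite indicE; case: (_ \in _); rewrite ?normr1 ?normr0.
  have [B mB levB] := vB (i.+1%:R / n.+1%:R).
  have := kB B mB; rewrite -levB => levk0.
  rewrite -[RHS](mule0 (n.+1%:R^-1)%:E); congr (_ * _)%E.
  rewrite -[RHS]levk0 [RHS]integral_mkcond; apply: eq_integral => x _.
  by rewrite patchE indicE; case: ifPn => xl; rewrite ?xl ?(negbTE xl) ?mul1r ?mul0r.
(* Replacing v by v - a n leaves the integral unchanged and makes the weight at most 1/(n+1). *)
have le n : (`|\int[mu]_x (v x * k x)%:E| <= (n.+1%:R^-1 * K)%:E)%E.
  have ivk : mu.-integrable setT (fun x => (v x * k x)%:E).
    by apply: ibk => // x; have /andP[? ?] := v01 x; rewrite ger0_norm.
  have -> : (\int[mu]_x (v x * k x)%:E = \int[mu]_x ((v x - a n x) * k x)%:E)%E.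
    rewrite -[LHS]sube0 -(a0 n) -integralB//.
    by apply: eq_integral => x _; rewrite -EFinB mulrBl.
  have iB : mu.-integrable setT (fun x => ((v x - a n x) * k x)%:E).
    by under eq_fun do rewrite mulrBl EFinB; exact: integrableB.
  apply: (le_trans (le_abse_integral _ _ (measurable_int _ iB))) => //.
  rewrite EFinM -KE -ge0_integralZl//; last first.
    by apply/measurable_EFinP; exact: measurableT_comp.
  apply: ge0_le_integral => //.
  - by apply: measurableT_comp => //; exact: measurable_int iB.
  - by apply/measurable_EFinP; apply: measurable_funM => //; exact: measurableT_comp.
  move=> x _; rewrite -EFinM lee_fin normrM ler_wpM2r//.
  by have /andP[? ?] := sum_level_sets n (v01 x); rewrite ger0_norm.
have vkfin : (\int[mu]_x (v x * k x)%:E)%E \is a fin_num.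
  by rewrite fin_num_abs (le_lt_trans (le 0%N))// ltry.
rewrite -(fineK vkfin); congr EFin; apply/eqP; rewrite -normr_le0.
have cK : n.+1%:R^-1 * K @[n --> \oo] --> (0 : R).
  by rewrite -[X in _ --> X](mul0r K); apply: cvgM; [exact: cvg_harmonic|exact: cvg_cst].
apply: (cvgr_to_ge cK); apply: nearW => n.
by rewrite -lee_fin -[leLHS]abse_EFin fineK.
Qed.

End borel_test.

(** * Aggregates and Bochner integrals *)

Section aggregate.
Variables (R : realType) (T : R).
Hypothesis T_gt0 : 0 < T.
Context d (U : measurableType d) (mu : probability U R).
Implicit Types F G : U -> cpath T.

(** Retraction of the line onto [0, T]. Composition with it extends a path continuously to the whole
    line, so that continuity of the averaged path can be studied on an open interval around
    [0, T]. *)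
Definition clamp (t : R) : R := Num.max 0 (Num.min t T).

Lemma clamp_itv t : 0 <= clamp t <= T.
Proof.
rewrite /clamp le_max lexx/= ge_max ltW//=.
by rewrite ge_min lexx orbT.
Qed.

Lemma clamp_id t : 0 <= t <= T -> clamp t = t.
Proof. by move=> /andP[t0 tT]; rewrite /clamp min_l// max_r. Qed.

Lemma clamp_dist (s t : R) : `|clamp s - clamp t| <= `|s - t|.
Proof.
wlog st : s t / s <= t.
  by move=> H; have [/H//|/ltW/H] := leP s t; rewrite distrC (distrC s).
have le1 : clamp s <= clamp t.
  by rewrite ge_max !le_max lexx/= le_min !ge_min st lexx !orbT.
have le2 : clamp t <= clamp s + (t - s).
  have /andP[s0 _] := clamp_itv s.
  rewrite {1}/clamp ge_max; apply/andP; split; first by lra.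
  have ms : Num.min s T <= clamp s by rewrite /clamp le_max lexx orbT.
  rewrite ge_min; apply/orP; have [sT|sT] := leP s T.
    by left; move: ms; rewrite min_l//; lra.
  right; have msT : Num.min s T = T by apply: min_r; exact: ltW.
  by move: ms; rewrite msT; lra.
by rewrite !ler0_norm ?subr_le0//; lra.
Qed.

Lemma continuous_cpath_clamp (f : cpath T) : continuous (fun t => f (clamp t)).
Proof.
move=> t; apply/cvgrPdist_lt => e e0.
have tT : `[0, T]%classic (clamp t) by rewrite /= in_itv/= clamp_itv.
have [r r0 fr] := cpath_cont f e0 tT.
apply/nbhs_ballP; exists r => // s /= ts.
rewrite distrC; apply: fr; first by rewrite /= in_itv/= clamp_itv.
by rewrite (le_lt_trans (clamp_dist _ _))// distrC.
Qed.

(** Aggregation by integrals at each time; [bochner_eval] reconciles it with the Bochner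
    integral. *)
Definition agg F : cpath T := path_of T (fun t => \int[mu]_u F u t).

Definition integrable_path F :=
  measurable_fun setT F /\ (\int[mu]_u (`|F u|)%:E < +oo)%E.

Lemma integrable_path_norm F : integrable_path F ->
  mu.-integrable setT (fun u => (`|F u|)%:E).
Proof.
move=> [mF iF]; apply/integrableP; split; first exact: measurable_EFin_cpath_norm.
by under eq_integral do rewrite gee0_abs//.
Qed.

Lemma integrable_path_eval F t : integrable_path F ->
  mu.-integrable setT (fun u => (F u t)%:E).
Proof.
move=> iF; apply: (le_integrable _ _ _ (integrable_path_norm iF)) => //.
  by apply/measurable_EFinP; case: iF => /(measurable_cpathP T_gt0) + _; apply.
by move=> u _ /=; rewrite lee_fin normr_id cpath_norm_ub.
Qed.

(** Dominated convergence, with the norm as dominating function, makes the integral continuous in t,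
    so [path_of] does not fall back to its default value. *)
Lemma aggE F t : integrable_path F -> 0 <= t <= T ->
  agg F t = \int[mu]_u F u t.
Proof.
move=> iF tT; pose h t := \int[mu]_u F u (clamp t).
have ch : {in `](-1), (T + 1)[%classic, continuous h}.
  apply: (@continuity_under_integral _ _ _ mu (fun t u => F u (clamp t)) setT
    measurableT (-1) (T + 1) _ _ (fun u => `|F u|)).
  - by move=> s _; exact: integrable_path_eval.
  - by apply: aeW => u _ s _; exact: continuous_cpath_clamp.
  - exact: integrable_path_norm.
  - by move=> s _; apply: aeW => u _; exact: cpath_norm_ub.
rewrite /agg path_ofE//.
apply: (@subspace_eq_continuous _ _ _ h).
  move=> s /set_mem; rewrite /= in_itv/= => sT.
  by apply: eq_Rintegral => u _; rewrite clamp_id.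
apply: continuous_in_subspaceT => s /set_mem; rewrite /= in_itv/= => /andP[s0 sT].
by apply: ch; apply/mem_set; rewrite /= in_itv/=; apply/andP; split; lra.
Qed.

Lemma integrable_pathZ F (v : U -> R) : integrable_path F ->
  measurable_fun setT v -> (forall u, `|v u| <= 1) ->
  integrable_path (fun u => v u *: F u).
Proof.
move=> [mF iF] mv v1.
have mvF : measurable_fun setT (fun u => v u *: F u) by exact: measurable_cpathZ.
split=> //; apply: le_lt_trans iF; apply: ge0_le_integral => //.
- exact: measurable_EFin_cpath_norm.
- exact: measurable_EFin_cpath_norm.
- by move=> u _; rewrite lee_fin normrZ ler_piMl.
Qed.

Lemma integrable_pathD F G : integrable_path F -> integrable_path G ->
  integrable_path (fun u => F u + G u).
Proof.
move=> [mF iF] [mG iG].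
have mFG : measurable_fun setT (fun u => F u + G u) by exact: measurable_cpathD.
split=> //.
apply: (@le_lt_trans _ _ (\int[mu]_u ((`|F u|)%:E + (`|G u|)%:E))%E).
  apply: ge0_le_integral => //; first exact: measurable_EFin_cpath_norm.
    by apply: emeasurable_funD; exact: measurable_EFin_cpath_norm.
  by move=> u _; rewrite -EFinD lee_fin ler_normD.
rewrite ge0_integralD//; last 2 first.
- exact: measurable_EFin_cpath_norm.
- exact: measurable_EFin_cpath_norm.
exact: lte_add_pinfty.
Qed.

Lemma integrable_pathB F G : integrable_path F -> integrable_path G ->
  integrable_path (fun u => F u - G u).
Proof.
move=> iF iG; apply: integrable_pathD => //.
have := @integrable_pathZ G (cst (-1)) iG.
under eq_fun do rewrite scaleN1r.
by apply => // u; rewrite normrN normr1.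
Qed.

End aggregate.

(** * Evaluation of Bochner integrals at a time *)

Section bochner.
Variables (R : realType) (T : R).
Hypothesis T_gt0 : 0 < T.
Context d (U : measurableType d) (mu : probability U R).

Lemma simple_fun_measurable (s : U -> cpath T) : simple_fun s ->
  measurable_fun setT s.
Proof.
move=> [fs ms] _ B mB; rewrite setTI.
have -> : s @^-1` B = \bigcup_(v in B `&` range s) (s @^-1` [set v]).
  apply/seteqP; split => [u Bu|u [v [Bv _] /= ->]]//.
  by exists (s u) => //; split => //; exists u.
apply: fin_bigcup_measurable => [|v _]; last exact: ms.
by apply: sub_finite_set fs => v [].
Qed.

Lemma simple_integral_eval (s : U -> cpath T) t : simple_fun s ->
  simple_integral mu s t = \int[mu]_u s u t.
Proof.
move=> [/finite_seqP[r0 r0E] ms]; pose r := undup r0.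
have rE : range s = [set` r] by rewrite r0E; apply/seteqP; split => v /=; rewrite mem_undup.
have ss u : s u t = \sum_(v <- r) v t * \1_(s @^-1` [set v]) u.
  have sr : s u \in r by have : [set` r] (s u) by rewrite -rE; exists u.
  rewrite (bigD1_seq (s u)) ?undup_uniq//= big1 ?addr0.
    by rewrite indicE mem_set// mulr1.
  move=> v vs; rewrite indicE memNset ?mulr0// => /= svu.
  by move: vs; rewrite svu eqxx.
have -> : simple_integral mu s t = \sum_(v <- r) v t * fine (mu (s @^-1` [set v])).
  rewrite /simple_integral rE -fsbig_seq ?undup_uniq//.
  have ev (q : seq (cpath T)) (F : cpath T -> cpath T) :
      (\sum_(v <- q) F v) t = \sum_(v <- q) F v t.
    by elim: q => [|v q IH]; rewrite ?big_nil// !big_cons cpathD IH.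
  by rewrite ev; apply: eq_bigr => v _; rewrite cpathZ mulrC.
have iv (v : cpath T) : mu.-integrable setT (fun u => (v t * \1_(s @^-1` [set v]) u)%:E).
  under eq_fun do rewrite EFinM.
  by apply: integrableZl => //; exact: integrable_indic.
rewrite /Rintegral; under [in RHS]eq_integral do rewrite ss -sumEFin.
have ev (v : cpath T) : (\int[mu]_u (v t * \1_(s @^-1` [set v]) u)%:E =
    (v t * fine (mu (s @^-1` [set v])))%:E)%E.
  under eq_integral do rewrite EFinM.
  rewrite integralZl//; last exact: integrable_indic.
  by rewrite integral_indic// setIT EFinM fineK// fin_num_measure.
by rewrite integral_sum//; under [in RHS]eq_bigr do rewrite ev; rewrite sumEFin.
Qed.

(** Both sides are limits of the simple integrals evaluated at t: evaluation is 1-Lipschitz for the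
    norm, and the error of the integrals is at most the mean of the norms of f - s n. *)
Lemma bochner_eval (f : U -> cpath T) v t : bochner_integral_is mu f v ->
  integrable_path mu f -> 0 <= t <= T -> v t = \int[mu]_u f u t.
Proof.
move=> [s [ss _ fs0 sv]] iF tT; have [mf fi] := iF.
have ms n : measurable_fun setT (s n) by exact: simple_fun_measurable.
have mfs n : measurable_fun setT (fun u => f u - s n u).
  under eq_fun do rewrite -scaleN1r.
  apply: measurable_cpathD => //.
  exact: (@measurable_cpathZ _ _ T_gt0 _ _ (cst (-1))).
have cv : simple_integral mu (s n) t @[n --> \oo] --> v t.
  apply/cvgrPdist_lt => e e0.
  move/cvgrPdist_lt : sv => /(_ e e0); apply: filterS => n.
  by apply: le_lt_trans; exact: (cpath_norm_ub (v - simple_integral mu (s n)) t).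
have cf : simple_integral mu (s n) t @[n --> \oo] --> \int[mu]_u f u t.
  apply/cvgrPdist_lt => e e0.
  have : \forall n \near \oo, (\int[mu]_u (`|f u - s n u|)%:E < e%:E)%E.
    have e0' : (0%:E < e%:E)%E by rewrite lte_fin.
    apply: (fs0 [set x | (x < e%:E)%E]).
    by apply: open_nbhs_nbhs; split; [exact: open_ereal_lt_ereal|].
  apply: filterS => n fsn.
  have ifs : integrable_path mu (fun u => f u - s n u).
    by split; [exact: mfs|rewrite (lt_trans fsn)// ltry].
  (* [s n] is f minus an error of finite mean norm. *)
  have isn : integrable_path mu (s n).
    have := integrable_pathB T_gt0 iF ifs.
    by under eq_fun do rewrite opprB addrC subrK.
  rewrite simple_integral_eval// -RintegralB//; last 2 first.
  - exact: integrable_path_eval.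
  - exact: integrable_path_eval.
  have ifst := integrable_path_eval T_gt0 t ifs.
  rewrite -lte_fin; apply: le_lt_trans fsn; rewrite EFin_normr_Rintegral//.
  apply: (le_trans (le_abse_integral _ _ (measurable_int _ ifst))) => //.
  apply: ge0_le_integral => //.
  - by apply: measurableT_comp => //; exact: measurable_int ifst.
  - exact: measurable_EFin_cpath_norm.
  - by move=> u _ /=; rewrite lee_fin; exact: (cpath_norm_ub (f u - s n u) t).
exact: (cvg_unique _ cv cf).
Qed.

End bochner.

(** * The state equation *)

Section state_equation_theory.
Variables (R : realType) (T : R).
Hypothesis T_gt0 : 0 < T.
Implicit Types (a b c C t : R) (u : R -> R) (z X : cpath T) (s : cpath T * R).
Notation mu := (@lebesgue_measure R).

Definition cst_path (x : R) : cpath T := path_of T (cst x).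

Lemma cst_pathE x t : 0 <= t <= T -> cst_path x t = x.
Proof. by move=> tT; rewrite /cst_path path_ofE// => ?; exact: cvg_cst. Qed.

Lemma cst_path_norm x : `|cst_path x| <= `|x|.
Proof. by apply: cpath_norm_le_itv => // t tT; rewrite cst_pathE. Qed.

(** Everything in the state equation except the feedback term: the equation reads X = V + a int X
    with this V. *)
Definition input_path b c u z s : cpath T :=
  cst_path s.2 + s.1 + b *: int_path T u + c *: int_path T z.

Definition state_path a b c u z s : cpath T := resolvent a (input_path b c u z s).

Lemma integrable_sub_itv u t : 0 <= t <= T ->
  mu.-integrable `[0, T] (EFin \o u) -> mu.-integrable `[0, t] (EFin \o u).
Proof.
move=> /andP[t0 tT]; apply: (@integrableS _ _ _ mu `[0, T]) => //.
by apply: subset_itvl; rewrite bnd_simp.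
Qed.

Lemma integrableZl_itv u k t : mu.-integrable `[0, t] (EFin \o u) ->
  mu.-integrable `[0, t] (EFin \o (fun r => k * u r)).
Proof.
move=> iu; have -> : EFin \o (fun r => k * u r) = (fun r => k%:E * (EFin \o u) r)%E.
  by apply/funext => r; rewrite /= EFinM.
exact: integrableZl.
Qed.

Lemma integrableD_itv u v t : mu.-integrable `[0, t] (EFin \o u) ->
  mu.-integrable `[0, t] (EFin \o v) ->
  mu.-integrable `[0, t] (EFin \o (fun r => u r + v r)).
Proof.
move=> iu iv; have -> : EFin \o (fun r => u r + v r) = ((EFin \o u) \+ (EFin \o v))%E.
  by apply/funext => r.
exact: integrableD.
Qed.

Lemma state_integral a b c u z X t : mu.-integrable `[0, T] (EFin \o u) ->
  0 <= t <= T ->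
  integral_is mu `[0, t] (fun r => a * X r + b * u r + c * z r)
    (a * int_path T X t + b * int_path T u t + c * int_path T z t).
Proof.
move=> iu tT; have iut := integrable_sub_itv tT iu.
have iX := cpath_integrable X tT; have iz := cpath_integrable z tT.
have iaX := integrableZl_itv a iX; have ibu := integrableZl_itv b iut.
have icz := integrableZl_itv c iz.
split; first by do 2 (apply: integrableD_itv => //).
rewrite RintegralD//; last exact: integrableD_itv.
rewrite RintegralD// (RintegralZl _ _ iX)// (RintegralZl _ _ iut)// (RintegralZl _ _ iz)//.
by rewrite (int_cpathE T_gt0 X tT) (int_cpathE T_gt0 z tT) int_pathE.
Qed.

Lemma state_pathP a b c u z s : mu.-integrable `[0, T] (EFin \o u) ->
  state_equation a b c u z s (state_path a b c u z s).
Proof.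
move=> iu t tT; set X := state_path _ _ _ _ _ _.
have [iX XE] := state_integral a b c z X iu tT; split=> //; rewrite -XE.
have : X t = (input_path b c u z s + a *: int_path T X) t.
  by rewrite {1}/X /state_path {1}resolvent_eq.
rewrite /input_path !cpathD !cpathZ cst_pathE// => ->; ring.
Qed.

(** The state equation solved for the Brownian path, so that moments of the noise can be read off
    from a given solution. *)
Lemma state_pathV a b c u z s X : mu.-integrable `[0, T] (EFin \o u) ->
  state_equation a b c u z s X ->
  s.1 = X - cst_path s.2 - a *: int_path T X - b *: int_path T u - c *: int_path T z.
Proof.
move=> iu XE; apply: cpath_eq => // t tT.
have [_ XtE] := XE t tT.
have [_ IE] := state_integral a b c z X iu tT.
rewrite -IE in XtE.
rewrite !cpathB !cpathZ cst_pathE//; move: XtE.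
set x := X t; set y := s.1 t; set A := a * _; set B := b * _; set D := c * _; lra.
Qed.

Lemma state_path0 a b c u z s X : state_equation a b c u z s X ->
  X 0 = s.2 + s.1 0.
Proof.
move=> /(_ 0); rewrite lexx ltW// => /(_ isT)[_].
rewrite set_itv1 Rintegral_set1; lra.
Qed.

(** Initial condition, noise and control cancel, leaving a linear equation driven by the difference
    of the aggregates. *)
Lemma state_diff a b c u z1 z2 s X1 X2 :
  state_equation a b c u z1 s X1 -> state_equation a b c u z2 s X2 ->
  X1 - X2 = int_path T (a *: (X1 - X2) + c *: (z1 - z2)).
Proof.
move=> E1 E2; apply: cpath_eq => // t tT; rewrite int_cpathE//.
have [i1 e1] := E1 t tT; have [i2 e2] := E2 t tT.
transitivity ((X1 t - s.2 - s.1 t) - (X2 t - s.2 - s.1 t)).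
  by rewrite cpathB; ring.
rewrite e1 e2 -RintegralB//; apply: eq_Rintegral => r _.
rewrite cpathD !cpathZ !cpathB; ring.
Qed.

Lemma state_unique a b c u z s X1 X2 :
  state_equation a b c u z s X1 -> state_equation a b c u z s X2 -> X1 = X2.
Proof.
move=> E1 E2; apply/eqP; rewrite -subr_eq0; apply/eqP.
have := state_diff E1 E2; rewrite subrr scaler0 addr0.
exact: lin_unique.
Qed.

Lemma input_path_norm b c u z s C : `|b| <= C -> `|c| <= C ->
  `|input_path b c u z s| <= `|s.2| + `|s.1| + C * `|int_path T u| + C * T * `|z|.
Proof.
move=> bC cC; have h1 := cst_path_norm s.2.
have h2 : `|b *: int_path T u| <= C * `|int_path T u| by rewrite normrZ ler_wpM2r.
have h3 : `|c *: int_path T z| <= C * T * `|z|.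
  by rewrite normrZ -mulrA ler_pM// int_cpath_norm.
apply: (le_trans (ler_normD _ _)); apply: lerD; last exact: h3.
apply: (le_trans (ler_normD _ _)); apply: lerD; last exact: h2.
by apply: (le_trans (ler_normD _ _)); apply: lerD.
Qed.

(** The 2 counts X itself and the initial condition, which is the value of X at 0 because the
    Brownian path starts at 0. *)
Lemma noise_norm a b c u z s X C : `|a| <= C -> `|b| <= C -> `|c| <= C ->
  mu.-integrable `[0, T] (EFin \o u) -> s.1 0 = 0 ->
  state_equation a b c u z s X ->
  `|s.1| <= (2 + C * T) * `|X| + C * `|int_path T u| + C * T * `|z|.
Proof.
move=> aC bC cC iu s0 XE; rewrite {1}(state_pathV iu XE).
have h1 : `|cst_path s.2| <= `|X|.
  rewrite (le_trans (cst_path_norm _))//.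
  by have := state_path0 XE; rewrite s0 addr0 => <-; exact: cpath_norm_ub.
have h2 : `|a *: int_path T X| <= C * T * `|X|.
  by rewrite normrZ -mulrA ler_pM// int_cpath_norm.
have h3 : `|b *: int_path T u| <= C * `|int_path T u| by rewrite normrZ ler_wpM2r.
have h4 : `|c *: int_path T z| <= C * T * `|z|.
  by rewrite normrZ -mulrA ler_pM// int_cpath_norm.
have -> : (2 + C * T) * `|X| = `|X| + `|X| + C * T * `|X|.
  by rewrite mulrDl mulr_natl mulr2n.
apply: (le_trans (ler_normB _ _)); apply: lerD; last exact: h4.
apply: (le_trans (ler_normB _ _)); apply: lerD; last exact: h3.
apply: (le_trans (ler_normB _ _)); apply: lerD; last exact: h2.
by apply: (le_trans (ler_normB _ _)); apply: lerD; last exact: h1.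
Qed.

(** Integrability follows from |u| <= 1 + |u|^2, and the estimate is the Cauchy-Schwarz inequality
    against the constant 1. *)
Lemma square_integrable_itv u : measurable_fun `[0, T] u ->
  (\int[mu]_(r in `[0%R, T]) (`|u r| ^+ 2)%:E < +oo)%E ->
  mu.-integrable `[0, T] (EFin \o u) /\
  `|int_path T u| ^+ 2 <= T * fine (\int[mu]_(r in `[0%R, T]) (`|u r| ^+ 2)%:E)%E.
Proof.
move=> mu' fu.
have isq : mu.-integrable `[0, T] (fun r => (`|u r| ^+ 2)%:E).
  apply/integrableP; split.
    apply/measurable_EFinP; apply: (@measurable_funX _ _ _ _ (fun r => `|u r|)).
    exact: measurableT_comp.
  by under eq_integral do rewrite gee0_abs ?lee_fin ?sqr_ge0//.
have i1 k : mu.-integrable `[0, T] (EFin \o cst k) := integrable_itv_cst k T.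
have iu : mu.-integrable `[0, T] (EFin \o u).
  apply: (le_integrable _ _ _ (integrableD_itv (i1 1) isq)) => //.
    exact/measurable_EFinP.
  move=> r _; rewrite lee_fin [leRHS]ger0_norm ?addr_ge0//.
  have := sqr_ge0 (`|u r| - 1); have := normr_ge0 (u r).
  by rewrite sqrrB1 /=; nra.
split=> //.
have iau : mu.-integrable `[0, T] (EFin \o (fun r => `|u r|)) by exact: integrable_norm.
set A := fine _; pose I := \int[mu]_(r in `[0, T]) `|u r|.
have TT : 0 <= T <= T by rewrite lexx ltW.
have I0 : 0 <= I by apply: Rintegral_ge0.
have uI : `|int_path T u| <= I.
  apply: cpath_norm_le_itv => // t tT; rewrite int_pathE//.
  apply: (le_trans (le_normr_Rintegral _ (integrable_sub_itv tT iu))) => //.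
  rewrite -lee_fin /Rintegral !fineK; last 2 first.
  - exact: integrable_fin_num.
  - by apply: integrable_fin_num => //; exact: (integrable_sub_itv tT iau).
  apply: ge0_subset_integral => //.
  - exact: measurable_int iau.
  - by apply: subset_itvl; rewrite bnd_simp; case/andP: tT.
apply: (@le_trans _ _ (I ^+ 2)); first by rewrite lerXn2r// nnegrE.
(* Integral of (|u| - I/T)^2; the expansion equals A - I^2/T, and its sign is the Cauchy-Schwarz
   inequality. *)
have : 0 <= \int[mu]_(r in `[0, T])
    (`|u r| ^+ 2 + ((- (2 * (I / T))) * `|u r| + cst ((I / T) ^+ 2) r)).
  apply: Rintegral_ge0 => r _ /=.
  by have := sqr_ge0 (`|u r| - I / T); nra.
have -> : \int[mu]_(r in `[0, T])
    (`|u r| ^+ 2 + ((- (2 * (I / T))) * `|u r| + cst ((I / T) ^+ 2) r)) = A - I ^+ 2 / T.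
  rewrite RintegralD//; last by apply: integrableD_itv => //; exact: integrableZl_itv.
  rewrite RintegralD//; last exact: integrableZl_itv.
  rewrite (RintegralZl _ _ iau)// Rintegral_itv_cst ?ltW// -/I.
  transitivity (A + (- (2 * (I / T)) * I + (I / T) ^+ 2 * T)); first by [].
  by field; rewrite gt_eqF.
by rewrite subr_ge0 ler_pdivrMr// mulrC.
Qed.

End state_equation_theory.

(** Tonelli makes the integrals of the positive and negative parts measurable in the parameter, and
    the integral is by definition their difference at every parameter, integrable or not. *)
Lemma measurable_integral_param d d' (V : measurableType d) (Y : measurableType d')
    (R : realType) (nu : {sigma_finite_measure set Y -> \bar R})
    (g : V * Y -> \bar R) (D : set Y) : measurable D -> measurable_fun setT g ->
  measurable_fun setT (fun v => \int[nu]_(y in D) g (v, y))%E.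
Proof.
move=> mD mg.
pose h (q : V * Y) := (g q * (\1_D q.2)%:E)%E.
have mh : measurable_fun setT h.
  apply: emeasurable_funM => //; apply/measurable_EFinP.
  exact: (measurableT_comp (measurable_indic mD) measurable_snd).
have -> : (fun v => \int[nu]_(y in D) g (v, y))%E =
    (fun v => \int[nu]_y h^\+ (v, y) - \int[nu]_y h^\- (v, y))%E.
  apply/funext => v; rewrite integral_mkcond.
  have -> : ((fun y => g (v, y)) \_ D) = (fun y => h (v, y)).
    apply/funext => y; rewrite patchE /h/= indicE.
    by case: ifPn => yD; rewrite ?mule1 ?mule0.
  rewrite integralE; congr (_ - _)%E; apply: eq_integral => y _.
    by rewrite !funeposE.
  by rewrite !funenegE.
apply: emeasurable_funB.
  by apply: measurable_fun_fubini_tonelli_F => //; exact: measurable_funepos.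
by apply: measurable_fun_fubini_tonelli_F => //; exact: measurable_funeneg.
Qed.

Lemma sqr_sum4_le (R : realFieldType) (p q r s : R) :
  (p + q + r + s) ^+ 2 <= 4 * (p ^+ 2 + q ^+ 2 + r ^+ 2 + s ^+ 2).
Proof.
have := sqr_ge0 (p - q); have := sqr_ge0 (p - r); have := sqr_ge0 (p - s).
have := sqr_ge0 (q - r); have := sqr_ge0 (q - s); have := sqr_ge0 (r - s).
nra.
Qed.

(** For [state_norm_sq]: x and y are the squares of the initial condition and of the noise, n is the
    control term, controlled by k times the energy e, and l is the aggregate term. *)
Lemma weighted_sum_le (R : realFieldType) (k l x y n e : R) : 0 <= k -> 0 <= l ->
  n <= k * e -> 0 <= e -> 0 <= x -> 0 <= y ->
  x + y + n + l <= (1 + k + l) * (x + y + e + 1).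
Proof.
move=> k0 l0 nk e0 x0 y0.
have := mulr_ge0 k0 x0; have := mulr_ge0 k0 y0; have := mulr_ge0 l0 x0.
have := mulr_ge0 l0 y0; have := mulr_ge0 l0 e0.
nra.
Qed.

(** * The state as a measurable functional of index and noise *)

Section controlled_state.
Variables (R : realType) (T : R).
Hypothesis T_gt0 : 0 < T.
Context dI (I : measurableType dI).
Notation S := (cpath T * R)%type.
Notation mu := (@lebesgue_measure R).
Variables (a b c : I -> R) (C : R) (alpha : I -> R -> S -> R).
Hypotheses (ma : measurable_fun setT a) (mb : measurable_fun setT b)
  (mc : measurable_fun setT c).
Hypothesis abc : forall x, [/\ `|a x| <= C, `|b x| <= C & `|c x| <= C].
Hypothesis malpha : measurable_fun ([set: I] `*` `[0, T] `*` [set: S])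
  (fun q : I * R * S => alpha q.1.1 q.1.2 q.2).

Definition energy (q : I * S) : \bar R :=
  (\int[mu]_(r in `[0%R, T]) (`|alpha q.1 r q.2| ^+ 2)%:E)%E.

(* Set to 0 on profiles of infinite energy, so that the state is defined and measurable
   everywhere. *)
Definition control (q : I * S) (r : R) : R :=
  if (energy q < +oo)%E && (0 <= r <= T) then alpha q.1 r q.2 else 0.

Definition state (z : I -> cpath T) (q : I * S) : cpath T :=
  state_path (a q.1) (b q.1) (c q.1) (control q) (z q.1) q.2.

(** Measurability of [alpha] is known only over [0, T]; extension by 0 gives a function measurable
    on the whole product. *)
Let control0 (v : (I * S) * R) : R :=
  if 0 <= v.2 <= T then alpha v.1.1 v.2 v.1.2 else 0.

Let measurable_control0 : measurable_fun setT control0.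
Proof.
pose D := [set v : (I * S) * R | `[0, T]%classic v.2].
have mD : measurable D.
  by rewrite -[D]setTI; apply: measurable_snd => //; exact: measurable_itv.
have -> : control0 = (fun v : (I * S) * R => alpha v.1.1 v.2 v.1.2) \_ D.
  apply/funext => v; rewrite patchE /control0.
  case: ifPn => vT; first by rewrite mem_set//= /D/= in_itv.
  by rewrite memNset//= /D/= in_itv/=; exact/negP.
apply/(measurable_restrictT _ mD).
apply: (measurable_comp _ _ malpha (g := fun v : (I * S) * R => ((v.1.1, v.2), v.1.2))) => //.
- by apply: measurableX => //; apply: measurableX => //; exact: measurable_itv.
- by move=> _ [v Dv <-] /=.
apply: measurable_funTS; apply: measurable_fun_pair.
  apply: measurable_fun_pair => //.
  exact: (measurableT_comp measurable_fst measurable_fst).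
exact: (measurableT_comp measurable_snd measurable_fst).
Qed.

Lemma measurable_energy : measurable_fun setT energy.
Proof.
have -> : energy = (fun q => \int[mu]_(r in `[0%R, T]) (`|control0 (q, r)| ^+ 2)%:E)%E.
  apply/funext => q; apply: eq_integral => r; rewrite inE/= in_itv/= => rT.
  by rewrite /control0/= rT.
apply: (@measurable_integral_param _ _ _ _ _ mu (fun v => (`|control0 v| ^+ 2)%:E)) => //.
apply/measurable_EFinP; apply: (@measurable_funX _ _ _ _ (fun r => `|control0 r|)).
exact: measurableT_comp.
Qed.

Lemma measurable_control : measurable_fun setT (fun v : (I * S) * R => control v.1 v.2).
Proof.
pose D := [set q : I * S | (energy q < +oo)%E].
have mD : measurable D.
  rewrite -[D]setTI; apply: (emeasurable_fun_infty_o measurableT) => //.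
  exact: measurable_energy.
have -> : (fun v : (I * S) * R => control v.1 v.2) = (fun v => \1_D v.1 * control0 v).
  apply/funext => v; rewrite /control indicE /control0 /D/=.
  case: ifPn => [/andP[e rT]|]; first by rewrite mem_set// rT mul1r.
  rewrite negb_and => /orP[e|/negbTE ->]; last by rewrite mulr0.
  by rewrite memNset ?mul0r//=; exact/negP.
apply: measurable_funM => //.
exact: (measurableT_comp (measurable_indic mD) measurable_fst).
Qed.

Lemma control_square q :
  (\int[mu]_(r in `[0%R, T]) (`|control q r| ^+ 2)%:E < +oo)%E /\
  (\int[mu]_(r in `[0%R, T]) (`|control q r| ^+ 2)%:E <= energy q)%E.
Proof.
have [e|e] := boolP (energy q < +oo)%E.
  rewrite (_ : (\int[mu]_(r in `[0%R, T]) (`|control q r| ^+ 2)%:E)%E = energy q)//.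
  apply: eq_integral => r; rewrite inE/= in_itv/= => rT.
  by rewrite /control e rT.
under eq_integral do rewrite /control (negbTE e)/= normr0 expr0n/=.
by rewrite integral0 ltry; split => //; apply: integral_ge0 => r _; rewrite lee_fin.
Qed.

Lemma measurable_control_section q : measurable_fun `[0, T] (control q).
Proof.
apply: measurable_funTS.
exact: (measurableT_comp measurable_control (measurable_pair1 q)).
Qed.

Lemma integrable_control q : mu.-integrable `[0, T] (EFin \o control q).
Proof.
by have [] := square_integrable_itv T_gt0 (@measurable_control_section q) (control_square q).1.
Qed.

Lemma measurable_state z : measurable_fun setT z -> measurable_fun setT (state z).
Proof.
move=> mz.
have m1 (f : I -> R) : measurable_fun setT f -> measurable_fun setT (fun q : I * S => f q.1).
  by move=> mf; exact: (measurableT_comp mf measurable_fst).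
apply: measurable_resolvent => //; first exact: m1.
have ms2 : measurable_fun setT (fun q : I * S => q.2.2).
  exact: (measurableT_comp measurable_snd measurable_snd).
have ms1 : measurable_fun setT (fun q : I * S => q.2.1).
  exact: (measurableT_comp measurable_fst measurable_snd).
apply: measurable_cpathD => //; last first.
  apply: measurable_cpathZ => //; first exact: m1.
  apply: measurable_int_cpath => //.
  exact: (measurableT_comp mz measurable_fst).
apply: measurable_cpathD => //; last first.
  apply: measurable_cpathZ => //; first exact: m1.
  apply: measurable_fun_cpath => // p.
  under eq_fun do rewrite (int_pathE T_gt0 (integrable_control _) (gridT T_gt0 p)).
  have mint : measurable_fun setT
      (fun q => \int[mu]_(r in `[0%R, grid T p]) (control q r)%:E)%E.
    apply: (@measurable_integral_param _ _ _ _ _ mu (fun v => (control v.1 v.2)%:E)) => //.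
    by apply/measurable_EFinP; exact: measurable_control.
  exact: (measurableT_comp (fine_measurable measurableT) mint).
apply: measurable_cpathD => //.
apply: measurable_fun_cpath => // p.
by under eq_fun do rewrite (cst_pathE _ (gridT T_gt0 p)).
Qed.

Lemma state_solution z q : (energy q < +oo)%E ->
  state_equation (a q.1) (b q.1) (c q.1) (fun t => alpha q.1 t q.2) (z q.1) q.2 (state z q).
Proof.
move=> e t tT.
have cE r : r \in `[0, t]%classic ->
    a q.1 * state z q r + b q.1 * control q r + c q.1 * z q.1 r =
    a q.1 * state z q r + b q.1 * alpha q.1 r q.2 + c q.1 * z q.1 r.
  rewrite inE/= in_itv/= => /andP[r0 rt].
  have rT : r <= T by apply: (le_trans rt); case/andP: tT.
  by rewrite /control e r0 rT.
have [si sE] := state_pathP T_gt0 (a q.1) (b q.1) (c q.1) (z q.1) q.2 (integrable_control q) tT.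
split.
  by apply: eq_integrable si => // r rt; rewrite /= cE.
by rewrite -/(state z q) in sE; rewrite sE; apply: eq_Rintegral => r; exact: cE.
Qed.

(** Square of the resolvent bound times the input bound. The factor 4 in K comes from squaring a sum
    of four terms, [E] is the constant of the resolvent, and z enters only through M, so one K
    serves all aggregates bounded by M. *)
Lemma state_norm_sq M : exists2 K : R, 0 <= K & forall z q, `|z q.1| <= M ->
  ((`|state z q| ^+ 2)%:E <=
    K%:E * ((q.2.2 ^+ 2)%:E + (`|q.2.1| ^+ 2)%:E + energy q + 1))%E.
Proof.
have C0 : 0 <= C by have [+ _ _] := abc point; exact: le_trans.
pose E := 1 + C * (expR (C * T) * (T * expR (C * T))).
have E1 : 1 <= E by rewrite lerDl !mulr_ge0// ?expR_ge0// ltW.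
pose K := 4 * E ^+ 2 * (1 + C ^+ 2 * T + C ^+ 2 * T ^+ 2 * M ^+ 2).
have CT0 : 0 <= C ^+ 2 * T by rewrite mulr_ge0 ?sqr_ge0// ltW.
have CTM0 : 0 <= C ^+ 2 * T ^+ 2 * M ^+ 2 by rewrite -!exprMn sqr_ge0.
have E20 : 0 < 4 * E ^+ 2 by rewrite mulr_gt0// exprn_gt0// (lt_le_trans _ E1).
have K0 : 0 < K by rewrite /K mulr_gt0// -addrA ltr_wpDr// addr_ge0.
exists K; first exact: ltW.
move=> z q zM.
have e0 : (0 <= energy q)%E by apply: integral_ge0 => r _; rewrite lee_fin sqr_ge0.
(* For infinite energy the right-hand side is +oo, K being positive. *)
have [e|] := boolP (energy q < +oo)%E; last first.
  rewrite -leNgt leye_eq => /eqP ->.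
  rewrite [X in (_ <= _ * X)%E](_ : _ = +oo%E); last by rewrite -EFinD.
  by rewrite gt0_muley ?leey// lte_fin.
have ef : energy q \is a fin_num by rewrite ge0_fin_numE.
have [_ nT] := square_integrable_itv T_gt0 (@measurable_control_section q) (control_square q).1.
have {}nT : `|int_path T (control q)| ^+ 2 <= T * fine (energy q).
  apply: (le_trans nT); apply: ler_wpM2l; first exact: ltW.
  apply: fine_le => //; last exact: (control_square q).2.
  rewrite ge0_fin_numE; first exact: (control_square q).1.
  by apply: integral_ge0 => r _; rewrite lee_fin sqr_ge0.
pose e' := fine (energy q); have eE : energy q = e'%:E by rewrite fineK.
rewrite -/e' in nT.
have [ax bx cx] := abc q.1.
have := resolvent_norm T_gt0 (input_path (b q.1) (c q.1) (control q) (z q.1) q.2) ax.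
rewrite -/E -/(state_path _ _ _ _ _ _) -/(state z q) => sE.
have := input_path_norm T_gt0 (control q) (z q.1) q.2 bx cx.
move: sE nT zM; rewrite eE -!EFinD -EFinM lee_fin.
set X := `|state z q|; set V := `|input_path _ _ _ _ _|.
set x := q.2.2; set B := `|q.2.1|; set n := `|int_path _ _|; set m := `|z q.1|.
move=> XV nT mM VB.
have X0 : 0 <= X by exact: normr_ge0.
have n0 : 0 <= n by exact: normr_ge0.
have B0 : 0 <= B by exact: normr_ge0.
have m0 : 0 <= m by exact: normr_ge0.
have {}VB : V <= `|x| + B + C * n + C * T * M.
  apply: (le_trans VB); rewrite lerD2l; apply: ler_wpM2l => //.
  by apply: mulr_ge0 => //; exact: ltW.
have V0 : 0 <= V by exact: normr_ge0.
have e'0 : 0 <= e' by exact: fine_ge0.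
have : X ^+ 2 <= E ^+ 2 * V ^+ 2.
  by rewrite -exprMn lerXn2r ?nnegrE// mulr_ge0// (le_trans _ E1).
move/le_trans; apply.
have V2 : V ^+ 2 <= 4 * (x ^+ 2 + B ^+ 2 + C ^+ 2 * n ^+ 2 + C ^+ 2 * T ^+ 2 * M ^+ 2).
  have S0 : 0 <= `|x| + B + C * n + C * T * M by exact: le_trans VB.
  apply: (@le_trans _ _ ((`|x| + B + C * n + C * T * M) ^+ 2)).
    by rewrite lerXn2r ?nnegrE.
  rewrite -(real_normK (num_real x)) -!exprMn.
  exact: sqr_sum4_le.
rewrite (le_trans (ler_wpM2l (sqr_ge0 _) V2))//.
rewrite mulrA (mulrC (E ^+ 2)) /K -[leRHS]mulrA; apply: ler_wpM2l; first exact: ltW.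
have Cn : C ^+ 2 * n ^+ 2 <= C ^+ 2 * T * e' by rewrite -mulrA ler_wpM2l ?sqr_ge0.
apply: weighted_sum_le => //; exact: sqr_ge0.
Qed.

End controlled_state.

(** * Almost sure statements, laws and sections *)

Lemma ae_exists d (U : measurableType d) (R : realType) (mu : probability U R)
    (A : U -> Prop) : {ae mu, forall u, A u} -> exists u, A u.
Proof.
move=> [N [mN N0 AN]]; apply: contrapT => /forallNP nA.
have NT : N = setT by apply/seteqP; split => // u _; exact: AN (nA u).
by move: N0; rewrite NT probability_setT => /eqP; rewrite onee_eq0.
Qed.

Lemma ae_countable d (U : measurableType d) (R : realType) (mu : probability U R)
    (K : countType) (A : K -> U -> Prop) :
  (forall k, {ae mu, forall u, A k u}) -> {ae mu, forall u k, A k u}.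
Proof.
move=> aeA; pose B n u := if unpickle n is Some k then A k u else True.
have /ae_foralln : forall n, {ae mu, forall u, B n u}.
  by move=> n; rewrite /B; case: (unpickle n) => [k|]; [exact: aeA|exact: aeW].
by apply: filterS => u Bu k; have := Bu (pickle k); rewrite /B pickleK.
Qed.

Lemma has_law_integral d d' (Om : measurableType d) (S : measurableType d')
    (R : realType) (P : probability Om R) (X : Om -> S)
    (m : {measure set S -> \bar R}) (g : S -> \bar R) :
  has_law P X m -> measurable_fun setT g -> (forall s, 0 <= g s)%E ->
  (\int[P]_om g (X om) = \int[m]_s g s)%E.
Proof.
move=> [mX PX] mg g0.
pose Y : {mfun Om >-> S} := mfun_Sub (mem_set mX).
rewrite [RHS](eq_measure_integral (distribution P Y)); last first.
  by move=> A mA _; rewrite -PX.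
by rewrite (ge0_integral_distribution Y).
Qed.

Section square_integrable.
Variables (R : realType) (T : R).
Hypothesis T_gt0 : 0 < T.

Lemma square_integrable_path d (U : measurableType d) (mu : probability U R)
    (F : U -> cpath T) : square_integrable mu F -> integrable_path mu F.
Proof.
move=> [mF iF]; split => //.
apply: (@le_lt_trans _ _ (\int[mu]_u (1 + (`|F u| ^+ 2)%:E))%E).
  apply: ge0_le_integral => //.
  - exact: measurable_EFin_cpath_norm.
  - apply: emeasurable_funD => //; apply/measurable_EFinP.
    apply: (@measurable_funX _ _ _ _ (fun u => `|F u|)).
    exact: (measurableT_comp (@measurable_cpath_norm R T)).
  - move=> u _; rewrite -EFinD lee_fin; set n := `|F u|.
    have := sqr_ge0 (n - 1); have : 0 <= n by exact: normr_ge0.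
    by clearbody n; nra.
rewrite ge0_integralD//; last first.
  apply/measurable_EFinP; apply: (@measurable_funX _ _ _ _ (fun u => `|F u|)).
  exact: (measurableT_comp (@measurable_cpath_norm R T)).
by rewrite integral_cst//= probability_setT mule1 lte_add_pinfty// ltry.
Qed.

Lemma square_integrable_bounded d (U : measurableType d) (mu : probability U R)
    (F : U -> cpath T) M : measurable_fun setT F -> (forall u, `|F u| <= M) ->
  square_integrable mu F.
Proof.
move=> mF FM; split => //.
apply: (@le_lt_trans _ _ (\int[mu]_u (cst (M ^+ 2)%:E) u)%E).
  apply: ge0_le_integral => //.
  - apply/measurable_EFinP; apply: (@measurable_funX _ _ _ _ (fun u => `|F u|)).
    exact: (measurableT_comp (@measurable_cpath_norm R T)).
  - move=> u _; rewrite lee_fin lerXn2r ?nnegrE//.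
    by rewrite (le_trans _ (FM u)).
by rewrite integral_cst//= probability_setT mule1 ltry.
Qed.

Section boxtimes.
Context d dI (Om : measurableType d) (I : measurableType dI).
Context (P : probability Om R) (lam : probability I R).
Context (W : set (set (Om * I))) (Q : probability (g_sigma_algebraType W) R).
Hypothesis QF : fubini_extension P lam Q.

(** The Fubini property is applied to the norm and to the evaluations at grid times. These are
    countably many real functions, and off one null set they recover the measurability of the
    path-valued section. *)
Lemma integrable_path_section1 (F : Om * I -> cpath T) : integrable_path Q F ->
  {ae P, forall om, integrable_path lam (fun x => F (om, x))}.
Proof.
move=> iF.
have [_ _ /(_ _ (integrable_path_norm iF))[_ iN _ _]] := QF.
have : forall p, {ae P, forall om, measurable_fun setT (fun x => F (om, x) (grid T p))}.
  move=> p; have [_ _ /(_ _ (integrable_path_eval T_gt0 (grid T p) iF))[_ ip _ _]] := QF.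
  by apply: filterS ip => om /measurable_int/measurable_EFinP.
move=> /ae_countable; apply: filterS2 iN => om iN mF.
split; first exact: measurable_fun_cpath.
have /integrableP[_] := iN.
by under eq_integral do rewrite gee0_abs//.
Qed.

End boxtimes.
End square_integrable.

Section finite_integrals.
Context d (U : measurableType d) (R : realType) (mu : probability U R).
Local Open Scope ereal_scope.

Lemma integral_ltyD (f g : U -> \bar R) :
  measurable_fun setT f -> measurable_fun setT g ->
  (forall u, 0 <= f u) -> (forall u, 0 <= g u) ->
  \int[mu]_u f u < +oo -> \int[mu]_u g u < +oo -> \int[mu]_u (f u + g u) < +oo.
Proof. by move=> mf mg f0 g0 fi gi; rewrite ge0_integralD// lte_add_pinfty. Qed.

Lemma integral_lty_le (f g : U -> \bar R) (K : R) : (0 <= K)%R ->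
  measurable_fun setT f -> measurable_fun setT g ->
  (forall u, 0 <= f u) -> (forall u, 0 <= g u) ->
  {ae mu, forall u, f u <= K%:E * g u} -> \int[mu]_u g u < +oo ->
  \int[mu]_u f u < +oo.
Proof.
move=> K0 mf mg f0 g0 fg gi.
apply: (@le_lt_trans _ _ (\int[mu]_u (K%:E * g u))).
  apply: ae_ge0_le_integral => //.
  - by move=> u _; rewrite mule_ge0.
  - exact: measurable_funeM.
  - by apply: filterS fg.
rewrite ge0_integralZl//.
by rewrite lte_mul_pinfty// ge0_fin_numE ?integral_ge0.
Qed.

End finite_integrals.

(** * Second moments of the noise and of the state *)

Section state_moments.
Variables (R : realType) (T : R).
Hypothesis T_gt0 : 0 < T.
Context d dI (Om : measurableType d) (I : measurableType dI).
Context (P : probability Om R) (lam : probability I R).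
Context (W : set (set (Om * I))) (Q : probability (g_sigma_algebraType W) R).
Hypothesis QF : fubini_extension P lam Q.
Notation OmI := (g_sigma_algebraType W).
Notation S := (cpath T * R)%type.
Notation mu := (@lebesgue_measure R).
Variables (wiener : probability (cpath T) R) (nu : I -> probability R R).
Variables (BB : Om * I -> S) (C2 : R).
Hypothesis wiener0 : wiener [set f : cpath T | f 0 = 0] = 1%E.
Hypothesis nu2 : forall x, (\int[nu x]_y (y ^+ 2)%:E <= C2%:E)%E.
Hypothesis mBB : measurable_fun setT (BB : OmI -> S).
Hypothesis BBlaw : forall x, has_law P (fun om => BB (om, x)) (wiener \x nu x)%E.
Variables (a b c : I -> R) (C : R) (alpha : I -> R -> S -> R).
Hypotheses (ma : measurable_fun setT a) (mb : measurable_fun setT b)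
  (mc : measurable_fun setT c).
Hypothesis abc : forall x, [/\ `|a x| <= C, `|b x| <= C & `|c x| <= C].
Hypothesis alphaP : admissible P Q BB alpha.
Variables (XX ZZ : Om * I -> cpath T).
Hypotheses (XX2 : square_integrable Q XX) (ZZ2 : square_integrable Q ZZ).
Hypothesis XXE : {ae Q, forall p, state_equation (a p.2) (b p.2) (c p.2)
  (fun t => alpha p.2 t (BB p)) (ZZ p) (BB p) (XX p)}.

Let malpha : measurable_fun ([set: I] `*` `[0, T] `*` [set: S])
  (fun q : I * R * S => alpha q.1.1 q.1.2 q.2).
Proof. by case: alphaP. Qed.

Lemma measurable_cpath_norm2 d' (U : measurableType d') (F : U -> cpath T) :
  measurable_fun setT F -> measurable_fun setT (fun u => (`|F u| ^+ 2)%:E).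
Proof.
move=> mF; apply/measurable_EFinP; apply: (@measurable_funX _ _ _ _ (fun u => `|F u|)).
exact: (measurableT_comp (@measurable_cpath_norm R T)).
Qed.

Lemma measurable_input : measurable_fun setT (fun p : OmI => (p.2, BB p)).
Proof.
apply: measurable_fun_pair => //.
exact: (measurable_fun_boxtimes QF measurable_snd).
Qed.

Lemma measurable_noise_section x : measurable_fun setT (fun om => BB (om, x)).
Proof. by have [] := BBlaw x. Qed.

Lemma measurable_input_section x : measurable_fun setT (fun om => (x, BB (om, x))).
Proof. by apply: measurable_fun_pair => //; exact: measurable_noise_section. Qed.

Lemma ae_energy : {ae Q, forall p, (energy alpha (p.2, BB p) < +oo)%E}.
Proof.
have e0 q : (0 <= energy alpha q)%E.
  by apply: integral_ge0 => r _; rewrite lee_fin sqr_ge0.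
have me := measurable_energy malpha.
have : Q.-integrable setT (fun p => energy alpha (p.2, BB p)).
  apply/integrableP; split; first exact: (measurableT_comp me measurable_input).
  under eq_integral do rewrite gee0_abs//.
  by have [_ _ + _] := alphaP.
move=> /integrable_ae -/(_ measurableT).
by apply: filterS => p /(_ Logic.I); rewrite ge0_fin_numE.
Qed.

(** This rests on the moment condition of admissibility at the individual x; the averaged condition
    would reach almost every x only. *)
Lemma ae_energy_section x : {ae P, forall om, (energy alpha (x, BB (om, x)) < +oo)%E}.
Proof.
have e0 q : (0 <= energy alpha q)%E.
  by apply: integral_ge0 => r _; rewrite lee_fin sqr_ge0.
have me := measurable_energy malpha.
have : P.-integrable setT (fun om => energy alpha (x, BB (om, x))).
  apply/integrableP; split; first exact: (measurableT_comp me (measurable_input_section x)).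
  under eq_integral do rewrite gee0_abs//.
  by have [_ _ _ +] := alphaP; exact.
move=> /integrable_ae -/(_ measurableT).
by apply: filterS => p /(_ Logic.I); rewrite ge0_fin_numE.
Qed.

(** The event is measurable for W, so it can be checked section by section, where the law of the
    Brownian path is Wiener measure. *)
Lemma noise0 : {ae Q, forall p, (BB p).1 0 = 0}.
Proof.
have mB0 : measurable_fun setT (fun s : S => s.1 0).
  exact: (measurableT_comp (measurable_cpath_eval 0) measurable_fst).
apply: (boxtimes_ae2 QF (A := [set p | (BB p).1 0 = 0])).
  have := measurableT_comp mB0 mBB measurableT (measurable_set1 0).
  by rewrite setTI.
apply: aeW => x.
pose A := [set f : cpath T | f 0 = 0].
have mA : measurable A.
  by rewrite -[A]setTI; exact: (@measurable_cpath_eval R T 0 measurableT _ (measurable_set1 0)).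
have [mx lawx] := BBlaw x.
have mAT : measurable (A `*` [set: R]) by exact: measurableX.
have mAx : measurable ((fun om => BB (om, x)) @^-1` (A `*` [set: R])).
  by rewrite -[X in measurable X]setTI; exact: mx.
exists (~` ((fun om => BB (om, x)) @^-1` (A `*` [set: R]))); split.
- exact: measurableC.
- have PA : P ((fun om => BB (om, x)) @^-1` (A `*` [set: R])) = 1%E.
    rewrite lawx//; apply: (etrans (product_measure1E _ _ mA measurableT)).
    by rewrite [X in (X * _)%E](wiener0 : wiener A = 1%E) mul1e; exact: probability_setT.
  by rewrite [LHS]probability_setC// PA subee.
- by move=> om /= BBn [].
Qed.

Lemma square_ge0E (y : R) : (0 <= (y ^+ 2)%:E)%E.
Proof. by rewrite lee_fin sqr_ge0. Qed.

Lemma initial_moment x : (\int[P]_om ((BB (om, x)).2 ^+ 2)%:E <= C2%:E)%E.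
Proof.
have m2 : measurable_fun setT (fun y : R => (y ^+ 2)%:E).
  by apply/measurable_EFinP; exact: exprn_measurable.
have ms2 : measurable_fun setT (fun s : S => (s.2 ^+ 2)%:E).
  exact: (measurableT_comp m2 measurable_snd).
rewrite (has_law_integral (m := (wiener \x nu x)%E) (BBlaw x) ms2)//; last first.
  by move=> s; exact: square_ge0E.
rewrite fubini_tonelli1//; last by move=> s; exact: square_ge0E.
rewrite /fubini_F/= integral_cst//= probability_setT mule1.
exact: nu2.
Qed.

Lemma noise_moment x : (\int[P]_om (`|(BB (om, x)).1| ^+ 2)%:E =
  \int[wiener]_f (`|f| ^+ 2)%:E)%E.
Proof.
have ms2 : measurable_fun setT (fun s : S => (`|s.1| ^+ 2)%:E).
  exact: (measurable_cpath_norm2 measurable_fst).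
rewrite (has_law_integral (m := (wiener \x nu x)%E) (BBlaw x) ms2)//.
rewrite fubini_tonelli1//.
apply: eq_integral => f _.
by rewrite /fubini_F/= integral_cst//= probability_setT mule1.
Qed.

Lemma state_equation_control q (z X : cpath T) : (energy alpha q < +oo)%E ->
  state_equation (a q.1) (b q.1) (c q.1) (fun t => alpha q.1 t q.2) z q.2 X ->
  state_equation (a q.1) (b q.1) (c q.1) (control alpha q) z q.2 X.
Proof.
move=> e XE t tT; have [iX Xt] := XE t tT.
have cE r : r \in `[0, t]%classic ->
    a q.1 * X r + b q.1 * alpha q.1 r q.2 + c q.1 * z r =
    a q.1 * X r + b q.1 * control alpha q r + c q.1 * z r.
  rewrite inE/= in_itv/= => /andP[r0 rt].
  have rT : r <= T by apply: (le_trans rt); case/andP: tT.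
  by rewrite /control e r0 rT.
split; first by apply: eq_integrable iX => // r rt; rewrite /= cE.
by rewrite Xt; apply: eq_Rintegral => r; exact: cE.
Qed.

Lemma sqr_sum3_le (x y z : R) : (x + y + z) ^+ 2 <= 3 * (x ^+ 2 + y ^+ 2 + z ^+ 2).
Proof.
have := sqr_ge0 (x - y); have := sqr_ge0 (x - z); have := sqr_ge0 (y - z); nra.
Qed.

Lemma energy_ge0 q : (0 <= energy alpha q)%E.
Proof. by apply: integral_ge0 => r _; exact: square_ge0E. Qed.

Lemma int_control_sq q : ((`|int_path T (control alpha q)| ^+ 2)%:E <= T%:E * energy alpha q)%E.
Proof.
have [_] := square_integrable_itv T_gt0
  (@measurable_control_section _ _ _ _ _ malpha q) (control_square alpha q).1.
rewrite -lee_fin => /le_trans; apply.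
rewrite EFinM; apply: lee_wpmul2l; first by rewrite lee_fin ltW.
rewrite fineK; first exact: (control_square alpha q).2.
rewrite ge0_fin_numE; first exact: (control_square alpha q).1.
by apply: integral_ge0 => r _; exact: square_ge0E.
Qed.

(* No maximal inequality is needed: the given solution XX is square integrable, and the
   state equation expresses the noise through XX, ZZ and the control. *)
Lemma noise_square_integrable : (\int[Q]_p (`|(BB p).1| ^+ 2)%:E < +oo)%E.
Proof.
have me : measurable_fun setT (fun p : OmI => energy alpha (p.2, BB p)).
  exact: (measurableT_comp (measurable_energy malpha) measurable_input).
have [mX iX] := XX2; have [mZ iZ] := ZZ2.
have mB1 : measurable_fun setT (fun p : OmI => (BB p).1).
  exact: (measurableT_comp measurable_fst mBB).
(* The 3 comes from squaring a sum of three terms; the weights are the squared coefficients in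
   [noise_norm], with C^2 T for the control after passing to its energy. *)
pose K := 3 * ((2 + C * T) ^+ 2 + C ^+ 2 * T + (C * T) ^+ 2).
have C0 : 0 <= C by have [+ _ _] := abc point; exact: le_trans.
have CT0 : 0 <= C ^+ 2 * T by rewrite mulr_ge0 ?sqr_ge0// ltW.
have K0 : 0 <= K by rewrite mulr_ge0// !addr_ge0 ?sqr_ge0.
apply: (@integral_lty_le _ _ _ Q _
  (fun p => (`|XX p| ^+ 2)%:E + energy alpha (p.2, BB p) + (`|ZZ p| ^+ 2)%:E)%E K) => //.
- exact: measurable_cpath_norm2.
- apply: emeasurable_funD; last exact: measurable_cpath_norm2.
  by apply: emeasurable_funD => //; exact: measurable_cpath_norm2.
- move=> p; apply: adde_ge0; last exact: square_ge0E.
  by apply: adde_ge0; [exact: square_ge0E|exact: energy_ge0].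
- apply: (@filterS3 _ _ (ae_filter_ringOfSetsType Q) _ _ _ _ _ XXE noise0 ae_energy) => p Xp B0 ep.
  have [ax bx cx] := abc p.2.
  have iu := integrable_control T_gt0 malpha (p.2, BB p).
  have := noise_norm T_gt0 ax bx cx iu B0 (state_equation_control ep Xp).
  have := int_control_sq (p.2, BB p).
  have ef : energy alpha (p.2, BB p) \is a fin_num by rewrite ge0_fin_numE ?energy_ge0.
  pose e := fine (energy alpha (p.2, BB p)).
  have eE : energy alpha (p.2, BB p) = e%:E by rewrite /e fineK.
  have e0 : 0 <= e by rewrite fine_ge0 ?energy_ge0.
  rewrite eE -!EFinD -!EFinM !lee_fin.
  have := normr_ge0 (BB p).1.
  set n := `|int_path _ _|; set x := `|XX p|; set z := `|ZZ p|; set B := `|(BB p).1|.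
  move=> Bge ne Bx.
  apply: (@le_trans _ _ (((2 + C * T) * x + C * n + C * T * z) ^+ 2)).
    by rewrite lerXn2r ?nnegrE// (le_trans Bge).
  apply: (le_trans (sqr_sum3_le _ _ _)); rewrite /K -[leRHS]mulrA ler_wpM2l//.
  rewrite !exprMn.
  have : C ^+ 2 * n ^+ 2 <= C ^+ 2 * T * e by rewrite -mulrA ler_wpM2l ?sqr_ge0.
  have x2 := sqr_ge0 x; have z2 := sqr_ge0 z.
  have := sqr_ge0 (2 + C * T); have := sqr_ge0 (C * T); rewrite exprMn.
  move: CT0 x2 z2 e0; set k := C ^+ 2 * T; set l := C ^+ 2 * T ^+ 2.
  set m := (2 + C * T) ^+ 2; set X := x ^+ 2; set Z := z ^+ 2; set N := C ^+ 2 * n ^+ 2.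
  move=> k0 X0 Z0 e0 l0 m0 Ne.
  have := mulr_ge0 m0 e0; have := mulr_ge0 m0 Z0; have := mulr_ge0 k0 X0.
  have := mulr_ge0 k0 Z0; have := mulr_ge0 l0 X0; have := mulr_ge0 l0 e0.
  clearbody k l m X Z N; lra.
- apply: integral_ltyD => //.
  + by apply: emeasurable_funD => //; exact: measurable_cpath_norm2.
  + exact: measurable_cpath_norm2.
  + by move=> p; apply: adde_ge0; [exact: square_ge0E|exact: energy_ge0].
  apply: integral_ltyD => //.
  + exact: measurable_cpath_norm2.
  + by move=> p; exact: energy_ge0.
  + by have [_ _ + _] := alphaP.
Qed.

(** The second moment of the Brownian path is the same at all indices. The Fubini property makes it
    finite at some index y, hence at x. *)
Lemma noise_square_integrable_section x :
  (\int[P]_om (`|(BB (om, x)).1| ^+ 2)%:E < +oo)%E.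
Proof.
have iB : Q.-integrable setT (EFin \o (fun p => `|(BB p).1| ^+ 2)).
  apply/integrableP; split.
    apply: measurable_cpath_norm2.
    exact: (measurableT_comp measurable_fst mBB).
  apply: le_lt_trans noise_square_integrable.
  rewrite le_eqVlt; apply/orP; left; apply/eqP; apply: eq_integral => p _.
  by rewrite gee0_abs// lee_fin sqr_ge0.
have [_ _ /(_ _ iB)[/ae_exists[y /integrableP[_ iy]] _ _ _]] := QF.
rewrite noise_moment -(noise_moment y); apply: le_lt_trans iy.
apply: ge0_le_integral => //.
- apply: measurable_cpath_norm2.
  exact: (measurableT_comp measurable_fst (measurable_noise_section y)).
- apply: measurableT_comp => //; apply: measurable_cpath_norm2.
  exact: (measurableT_comp measurable_fst (measurable_noise_section y)).
- by move=> om _; exact: lee_abs.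
Qed.

(** The initial condition is the value of [XX] at time 0, so its square is dominated by that of the
    norm of [XX]. *)
Lemma initial_square_integrable : (\int[Q]_p ((BB p).2 ^+ 2)%:E < +oo)%E.
Proof.
have [mX iX] := XX2.
apply: (@integral_lty_le _ _ _ Q _ (fun p => (`|XX p| ^+ 2)%:E) 1) => //.
- apply/measurable_EFinP; apply: (@measurable_funX _ _ _ _ (fun p : OmI => (BB p).2)).
  exact: (measurableT_comp measurable_snd mBB).
- exact: measurable_cpath_norm2.
- by move=> p; exact: square_ge0E.
- apply: (@filterS2 _ _ (ae_filter_ringOfSetsType Q) _ _ _ _ XXE noise0) => p Xp B0.
  have := state_path0 T_gt0 Xp; rewrite B0 addr0 mul1e lee_fin => <-.
  rewrite -(real_normK (num_real _)) lerXn2r ?nnegrE//.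
  exact: cpath_norm_ub.
Qed.

(** G is either the input map under Q or its section at a fixed x under P; one estimate serves
    both. *)
Lemma state_square_integrable d' (V : measurableType d') (m : probability V R)
    (G : V -> I * S) (z : I -> cpath T) M :
  measurable_fun setT G -> measurable_fun setT z -> (forall x, `|z x| <= M) ->
  (\int[m]_v ((G v).2.2 ^+ 2)%:E < +oo)%E ->
  (\int[m]_v (`|(G v).2.1| ^+ 2)%:E < +oo)%E ->
  (\int[m]_v energy alpha (G v) < +oo)%E ->
  square_integrable m (fun v => state a b c alpha z (G v)).
Proof.
move=> mG mz zM i2 i1 ie.
have [K K0 stK] := state_norm_sq T_gt0 abc malpha M.
have mst : measurable_fun setT (fun v => state a b c alpha z (G v)).
  exact: (measurableT_comp (measurable_state T_gt0 ma mb mc malpha mz) mG).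
split => //.
have mG2 : measurable_fun setT (fun v => (G v).2).
  exact: (measurableT_comp measurable_snd mG).
have m1 : measurable_fun setT (fun v => (`|(G v).2.1| ^+ 2)%:E).
  exact: (measurable_cpath_norm2 (measurableT_comp measurable_fst mG2)).
have m2 : measurable_fun setT (fun v => ((G v).2.2 ^+ 2)%:E).
  apply/measurable_EFinP; apply: (@measurable_funX _ _ _ _ (fun v => (G v).2.2)).
  exact: (measurableT_comp measurable_snd mG2).
have me : measurable_fun setT (fun v => energy alpha (G v)).
  exact: (measurableT_comp (measurable_energy malpha) mG).
have m21 := emeasurable_funD m2 m1; have m21e := emeasurable_funD m21 me.
have p21 v : (0 <= ((G v).2.2 ^+ 2)%:E + (`|(G v).2.1| ^+ 2)%:E)%E.
  by rewrite adde_ge0 ?square_ge0E.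
have p21e v : (0 <= ((G v).2.2 ^+ 2)%:E + (`|(G v).2.1| ^+ 2)%:E + energy alpha (G v))%E.
  by rewrite adde_ge0 ?energy_ge0.
apply: (@integral_lty_le _ _ _ m _ (fun v => ((G v).2.2 ^+ 2)%:E +
  (`|(G v).2.1| ^+ 2)%:E + energy alpha (G v) + 1)%E K) => //.
- exact: measurable_cpath_norm2.
- exact: emeasurable_funD.
- by move=> v; rewrite adde_ge0.
- by apply: aeW => v; apply: stK.
- apply: integral_ltyD => //.
    apply: integral_ltyD => //; first by move=> v; exact: energy_ge0.
    by apply: integral_ltyD => // v; exact: square_ge0E.
  by rewrite integral_cst//= probability_setT mule1 ltry.
Qed.

Lemma state_square_integrable_boxtimes (z : I -> cpath T) M :
  measurable_fun setT z -> (forall x, `|z x| <= M) ->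
  square_integrable Q (fun p => state a b c alpha z (p.2, BB p)).
Proof.
move=> mz zM.
apply: (@state_square_integrable _ _ Q (fun p => (p.2, BB p)) z M) => //.
- exact: measurable_input.
- exact: initial_square_integrable.
- exact: noise_square_integrable.
- by have [_ _ + _] := alphaP.
Qed.

Lemma state_square_integrable_section (z : I -> cpath T) M x :
  measurable_fun setT z -> (forall x, `|z x| <= M) ->
  square_integrable P (fun om => state a b c alpha z (x, BB (om, x))).
Proof.
move=> mz zM.
apply: (@state_square_integrable _ _ P (fun om => (x, BB (om, x))) z M) => //.
- exact: measurable_input_section.
- by rewrite (le_lt_trans (initial_moment x))// ltry.
- exact: noise_square_integrable_section.
- by have [_ _ _ +] := alphaP; exact.
Qed.

End state_moments.

(** * Aggregates of integrable families *)

Section aggregate_theory.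
Variables (R : realType) (T : R).
Hypothesis T_gt0 : 0 < T.
Context d (U : measurableType d) (mu : probability U R).
Implicit Types F G : U -> cpath T.

Lemma aggB F G : integrable_path mu F -> integrable_path mu G ->
  agg mu (fun u => F u - G u) = agg mu F - agg mu G.
Proof.
move=> iF iG; apply: cpath_eq => // t tT; rewrite cpathB !aggE//; last first.
  exact: integrable_pathB.
rewrite -RintegralB//; first exact: integrable_path_eval.
exact: integrable_path_eval.
Qed.

Lemma ae_eq_agg F G : integrable_path mu F -> integrable_path mu G ->
  {ae mu, forall u, F u = G u} -> agg mu F = agg mu G.
Proof.
move=> iF iG FG; apply: cpath_eq => // t tT; rewrite !aggE//.
congr fine; apply: ae_eq_integral => //.
- exact: measurable_int (integrable_path_eval T_gt0 t iF).
- exact: measurable_int (integrable_path_eval T_gt0 t iG).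
- by apply: filterS FG => u ->.
Qed.

Lemma agg_eval_le F t : integrable_path mu F -> 0 <= t <= T ->
  ((`|agg mu F t|)%:E <= \int[mu]_u (`|F u t|)%:E)%E.
Proof.
move=> iF tT; rewrite aggE// EFin_normr_Rintegral//; last exact: integrable_path_eval.
apply: le_abse_integral => //.
exact: measurable_int (integrable_path_eval T_gt0 t iF).
Qed.

Lemma agg_norm_le F : integrable_path mu F ->
  `|agg mu F| <= fine (\int[mu]_u (`|F u|)%:E).
Proof.
move=> iF; apply: cpath_norm_le_itv => // t tT; rewrite -lee_fin fineK; last first.
  by apply: integrable_fin_num => //; exact: integrable_path_norm.
apply: (le_trans (agg_eval_le iF tT)); apply: ge0_le_integral => //.
- exact: (measurable_EFin_cpath_eval T_gt0 t iF.1).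
- exact: measurable_EFin_cpath_norm iF.1.
- by move=> u _; rewrite lee_fin cpath_norm_ub.
Qed.

Lemma integral_norm_le F G : integrable_path mu F -> integrable_path mu G ->
  (forall u, `|F u| <= `|G u|) ->
  fine (\int[mu]_u (`|F u|)%:E) <= fine (\int[mu]_u (`|G u|)%:E).
Proof.
move=> iF iG FG; apply: fine_le.
- by apply: integrable_fin_num => //; exact: integrable_path_norm.
- by apply: integrable_fin_num => //; exact: integrable_path_norm.
apply: ge0_le_integral => //.
- exact: measurable_EFin_cpath_norm iF.1.
- exact: measurable_EFin_cpath_norm iG.1.
- by move=> u _; rewrite lee_fin.
Qed.

Lemma measurable_agg d' (V : measurableType d') (w : V -> U -> R) F :
  measurable_fun setT (fun p : V * U => w p.1 p.2) ->
  (forall v u, `|w v u| <= 1) -> integrable_path mu F ->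
  measurable_fun setT (fun v => agg mu (fun u => w v u *: F u)).
Proof.
move=> mw w1 iF; apply: measurable_fun_cpath => // p.
have iwF v : integrable_path mu (fun u => w v u *: F u).
  apply: integrable_pathZ => //.
  exact: (measurableT_comp mw (measurable_pair1 v)).
under eq_fun do rewrite (aggE T_gt0 (iwF _) (gridT T_gt0 p)).
have mint : measurable_fun setT
    (fun v => \int[mu]_u (w v u * F u (grid T p))%:E)%E.
  apply: (@measurable_integral_param _ _ _ _ _ mu
    (fun q => (w q.1 q.2 * F q.2 (grid T p))%:E)) => //.
  apply/measurable_EFinP; apply: measurable_funM => //.
  have mF := (measurable_cpathP T_gt0 _).1 iF.1 (grid T p).
  exact: (measurableT_comp mF measurable_snd).
exact: (measurableT_comp (fine_measurable measurableT) mint).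
Qed.

End aggregate_theory.

(** * Test functions and the state without aggregate *)

Section rays.
Context dI (I : measurableType dI) (R : realType) (pos : I -> R).
Hypothesis mpos : measurable_fun setT pos.

(** [None] encodes the constant 1; it supplies the total integral, which the Dynkin argument uses
    for complements. *)
Definition ray (k : option rat) (y : I) : R :=
  if k is Some r then \1_(pos @^-1` `]-oo, ratr r[) y else 1.

Lemma measurable_ray k : measurable_fun setT (ray k).
Proof.
case: k => [r|]; last exact: measurable_cst.
have mr : measurable (pos @^-1` `]-oo, ratr r[).
  by rewrite -[X in measurable X]setTI; exact: mpos.
exact: (measurable_indic mr).
Qed.

Lemma ray_le1 k y : `|ray k y| <= 1.
Proof.
by case: k => [r|] /=; rewrite ?normr1// indicE; case: (_ \in _); rewrite ?normr1 ?normr0.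
Qed.

End rays.

Section uncontrolled_state.
Variables (R : realType) (T : R).
Hypothesis T_gt0 : 0 < T.
Context d dI (Om : measurableType d) (I : measurableType dI).
Context (P : probability Om R) (lam : probability I R).
Context (W : set (set (Om * I))) (Q : probability (g_sigma_algebraType W) R).
Hypothesis QF : fubini_extension P lam Q.
Notation OmI := (g_sigma_algebraType W).
Notation S := (cpath T * R)%type.
Notation mu := (@lebesgue_measure R).
Variables (wiener : probability (cpath T) R) (nu : I -> probability R R).
Variables (BB : Om * I -> S) (C2 : R).
Hypothesis wiener0 : wiener [set f : cpath T | f 0 = 0] = 1%E.
Hypothesis nu2 : forall x, (\int[nu x]_y (y ^+ 2)%:E <= C2%:E)%E.
Hypothesis mBB : measurable_fun setT (BB : OmI -> S).
Hypothesis BBepi : epi P lam BB.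
Hypothesis BBlaw : forall x, has_law P (fun om => BB (om, x)) (wiener \x nu x)%E.
Variables (a b c : I -> R) (C : R) (alpha : I -> R -> S -> R).
Hypotheses (ma : measurable_fun setT a) (mb : measurable_fun setT b)
  (mc : measurable_fun setT c).
Hypothesis abc : forall x, [/\ `|a x| <= C, `|b x| <= C & `|c x| <= C].
Hypothesis alphaP : admissible P Q BB alpha.
Variable pos : I -> R.
Hypothesis mpos : measurable_fun setT pos.
Variables (XX ZZ : Om * I -> cpath T).
Hypotheses (XX2 : square_integrable Q XX) (ZZ2 : square_integrable Q ZZ).
Hypothesis XXE : {ae Q, forall p, state_equation (a p.2) (b p.2) (c p.2)
  (fun t => alpha p.2 t (BB p)) (ZZ p) (BB p) (XX p)}.
Let malpha : measurable_fun ([set: I] `*` `[0, T] `*` [set: S])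
  (fun q : I * R * S => alpha q.1.1 q.1.2 q.2).
Proof. by case: alphaP. Qed.

Let state2Q (z : I -> cpath T) M : measurable_fun setT z -> (forall x, `|z x| <= M) ->
  square_integrable Q (fun p => state a b c alpha z (p.2, BB p)).
Proof.
move=> mz zM; exact: (state_square_integrable_boxtimes T_gt0 QF wiener0 mBB BBlaw
  ma mb mc abc alphaP XX2 ZZ2 XXE mz zM).
Qed.

Let F0 p := state a b c alpha (fun=> 0) (p.2, BB p).

Let F02 : square_integrable Q F0.
Proof. by apply: (@state2Q _ 0) => // x; rewrite normr0. Qed.

(** With the aggregate set to 0, the tested state is a measurable function of (y, B^y), to which
    [epi_lln] applies. The index k ranges over a countable type. *)
Lemma state_lln (k : option rat * (nat * nat)) : exists m : R, {ae P, forall om,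
  (\int[lam]_y (ray pos k.1 y * F0 (om, y) (grid T k.2))%:E = m%:E)%E}.
Proof.
apply: (epi_lln QF mBB _ BBepi
  (phi := fun q => ray pos k.1 q.1 * state a b c alpha (fun=> 0) q (grid T k.2))).
- by move=> x; have [] := BBlaw x.
- apply: measurable_funM; first exact: (measurableT_comp (measurable_ray mpos k.1) measurable_fst).
  have mst := measurable_state T_gt0 ma mb mc malpha (@measurable_cst _ _ I (cpath T) setT 0).
  exact: ((measurable_cpathP T_gt0 _).1 mst).
have iF := square_integrable_path F02.
have mr : measurable_fun setT (fun p : OmI => ray pos k.1 p.2).
  apply: (measurable_fun_boxtimes QF (f := fun p => ray pos k.1 p.2)).
  exact: (measurableT_comp (measurable_ray mpos k.1) measurable_snd).
have iZ : integrable_path Q (fun p => ray pos k.1 p.2 *: F0 p).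
  by apply: integrable_pathZ => // p; exact: ray_le1.
exact: (integrable_path_eval T_gt0 (grid T k.2) iZ).
Qed.

End uncontrolled_state.

(** * The graphon system *)

Section graphon_system.
Variables (R : realType) (T : R).
Hypothesis T_gt0 : 0 < T.
Context d dI (Om : measurableType d) (I : measurableType dI).
Context (P : probability Om R) (lam : probability I R).
Context (W : set (set (Om * I))) (Q : probability (g_sigma_algebraType W) R).
Hypothesis QF : fubini_extension P lam Q.
Notation OmI := (g_sigma_algebraType W).
Notation S := (cpath T * R)%type.
Notation mu := (@lebesgue_measure R).
Variables (BB : Om * I -> S) (a b c : I -> R) (C : R) (alpha : I -> R -> S -> R).
Hypothesis abc : forall x, [/\ `|a x| <= C, `|b x| <= C & `|c x| <= C].
Variables (pos : I -> R) (w : I -> I -> R).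
Hypothesis mpos : measurable_fun setT pos.
Hypothesis w01 : forall x y, 0 <= w x y <= 1.
Hypothesis mw : measurable_fun setT (fun p : I * I => w p.1 p.2).
Hypothesis wborel : forall x s, exists2 B : set R, measurable B &
  [set y | s <= w x y] = pos @^-1` B.
Variables (XX ZZ : Om * I -> cpath T).
Hypotheses (XX2 : square_integrable Q XX) (ZZ2 : square_integrable Q ZZ).
Hypothesis XXE : {ae Q, forall p, state_equation (a p.2) (b p.2) (c p.2)
  (fun t => alpha p.2 t (BB p)) (ZZ p) (BB p) (XX p)}.
Hypothesis ZZE : {ae Q, forall p, bochner_integral_is lam
  (fun y => w p.2 y *: XX (p.1, y)) (ZZ p)}.
Hypothesis energyQ : {ae Q, forall p, (energy alpha (p.2, BB p) < +oo)%E}.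
Variable F0 : Om * I -> cpath T.
Hypothesis F02 : square_integrable Q F0.
Hypothesis F0E : forall p, (energy alpha (p.2, BB p) < +oo)%E ->
  state_equation (a p.2) (b p.2) (c p.2) (fun t => alpha p.2 t (BB p)) 0 (BB p) (F0 p).
Hypothesis F0_lln : forall k : option rat * (nat * nat), exists m : R, {ae P, forall om,
  (\int[lam]_y (ray pos k.1 y * F0 (om, y) (grid T k.2))%:E = m%:E)%E}.

(** Collects all almost sure statements about one sample point, for a fixed choice [m] of the
    limiting constants. It does not mention any particular x, so the exceptional set is fixed before
    x is chosen. *)
Definition generic (m : option rat * (nat * nat) -> R) om := [/\
  forall k, (\int[lam]_y (ray pos k.1 y * F0 (om, y) (grid T k.2))%:E = (m k)%:E)%E,
  integrable_path lam (fun y => XX (om, y)),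
  integrable_path lam (fun y => F0 (om, y)) &
  {ae lam, forall y, [/\ state_equation (a y) (b y) (c y)
    (fun t => alpha y t (BB (om, y))) (ZZ (om, y)) (BB (om, y)) (XX (om, y)),
    (energy alpha (y, BB (om, y)) < +oo)%E &
    bochner_integral_is lam (fun z => w y z *: XX (om, z)) (ZZ (om, y))]}].

Lemma ae_generic : exists m, {ae P, forall om, generic m om}.
Proof.
have [m mE] := choice F0_lln; exists m.
have ae1 := ae_countable mE.
have ae2 := integrable_path_section1 T_gt0 QF (square_integrable_path XX2).
have ae3 := integrable_path_section1 T_gt0 QF (square_integrable_path F02).
have : {ae Q, forall p, [/\ state_equation (a p.2) (b p.2) (c p.2)
    (fun t => alpha p.2 t (BB p)) (ZZ p) (BB p) (XX p),
    (energy alpha (p.2, BB p) < +oo)%E &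
    bochner_integral_is lam (fun y => w p.2 y *: XX (p.1, y)) (ZZ p)]}.
  exact: (@filterS3 _ _ (ae_filter_ringOfSetsType Q) _ _ _ _
    (fun p h1 h2 h3 => And3 h1 h2 h3) XXE energyQ ZZE).
move=> /(ae_boxtimes1 QF) ae4.
by apply: filterS2 (filterI ae1 ae2) (filterI ae3 ae4) => om [h1 h2] [h3 h4].
Qed.

Let w_le1 x y : `|w x y| <= 1.
Proof. by have /andP[w0 w1] := w01 x y; rewrite ger0_norm. Qed.

Let mwx x : measurable_fun setT (w x).
Proof. exact: (measurableT_comp mw (measurable_pair1 x)). Qed.

Let integrable_weighted x (F : I -> cpath T) : integrable_path lam F ->
  integrable_path lam (fun y => w x y *: F y).
Proof. by move=> iF; apply: integrable_pathZ => //; exact: w_le1. Qed.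

Let agg_weightedB x (F G : I -> cpath T) : integrable_path lam F -> integrable_path lam G ->
  agg lam (fun y => w x y *: (F y - G y)) =
  agg lam (fun y => w x y *: F y) - agg lam (fun y => w x y *: G y).
Proof.
move=> iF iG.
rewrite -(aggB T_gt0 (integrable_weighted x iF) (integrable_weighted x iG)).
by congr (agg lam); apply/funext => y; rewrite scalerBr.
Qed.

(** Two generic points share the constants [m], so at each grid time the difference of their
    sections integrates to 0 against every ray, and then against w(x, .) whatever x is. *)
Lemma generic_state_agg m om om0 x : generic m om -> generic m om0 ->
  agg lam (fun y => w x y *: F0 (om, y)) = agg lam (fun y => w x y *: F0 (om0, y)).
Proof.
move=> [mE _ iF _] [m0E _ iF' _].
apply/eqP; rewrite -subr_eq0 -(agg_weightedB x iF iF'); apply/eqP.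
have iD := integrable_pathB T_gt0 iF iF'.
apply: (cpath_eq_grid T_gt0) => p.
rewrite (aggE T_gt0 (integrable_weighted x iD) (gridT T_gt0 p)).
pose k y := (F0 (om, y) - F0 (om0, y)) (grid T p).
have ik : lam.-integrable setT (EFin \o k) by exact: (integrable_path_eval T_gt0 (grid T p) iD).
have kray r : (\int[lam]_y (ray pos r y * k y)%:E = 0)%E.
  have ir (F : I -> cpath T) : integrable_path lam F ->
      lam.-integrable setT (fun y => (ray pos r y * F y (grid T p))%:E).
    move=> iF1; have iZ : integrable_path lam (fun y => ray pos r y *: F y).
      by apply: integrable_pathZ => //; [exact: measurable_ray|move=> y; exact: ray_le1].
    exact: (integrable_path_eval T_gt0 (grid T p) iZ).
  transitivity (\int[lam]_y ((ray pos r y * F0 (om, y) (grid T p))%:E -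
      (ray pos r y * F0 (om0, y) (grid T p))%:E))%E.
    by apply: eq_integral => y _; rewrite -EFinB -mulrBr.
  rewrite integralB//; last 2 first.
  - exact: (ir _ iF).
  - exact: (ir _ iF').
  by rewrite (mE (r, p)) (m0E (r, p)) subee.
have := @integral_borel_test _ _ _ lam _ mpos k (w x) ik _ _ (w01 x) (wborel x).
rewrite /Rintegral => -> //.
- by have := kray None; under eq_integral do rewrite mul1r.
- move=> q; rewrite -[RHS](kray (Some q)) integral_mkcond.
  apply: eq_integral => y _; rewrite patchE /ray indicE.
  by case: ifPn => yq; rewrite ?yq ?(negbTE yq) ?mul1r ?mul0r.
Qed.

Let ZZagg om y : integrable_path lam (fun z => XX (om, z)) ->
  bochner_integral_is lam (fun z => w y z *: XX (om, z)) (ZZ (om, y)) ->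
  ZZ (om, y) = agg lam (fun z => w y z *: XX (om, z)).
Proof.
move=> iX bX; apply: (cpath_eq T_gt0) => t tT.
have iwX := integrable_weighted y iX.
by rewrite (aggE T_gt0 iwX tT); exact: (bochner_eval T_gt0 bX iwX tT).
Qed.

(* By [generic_state_agg] the deviation XX - F0 solves the same linear system for om and om0,
   and that system has at most one solution. *)
Lemma generic_deviation m om om0 : generic m om -> generic m om0 ->
  {ae lam, forall y, XX (om, y) - F0 (om, y) = XX (om0, y) - F0 (om0, y)}.
Proof.
move=> gom gom0; have := (gom, gom0).
move=> [[_ iX iF E] [_ iX0 iF00 E0]].
have iD := integrable_pathB T_gt0 iX iF; have iD0 := integrable_pathB T_gt0 iX0 iF00.
have [mDD iDD] := integrable_pathB T_gt0 iD iD0.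
have aC x : `|a x| <= C by have [] := abc x.
have cC x : `|c x| <= C by have [] := abc x.
have dev om' y : state_equation (a y) (b y) (c y)
      (fun t => alpha y t (BB (om', y))) (ZZ (om', y)) (BB (om', y)) (XX (om', y)) ->
    (energy alpha (y, BB (om', y)) < +oo)%E ->
    XX (om', y) - F0 (om', y) =
      int_path T (a y *: (XX (om', y) - F0 (om', y)) + c y *: ZZ (om', y)).
  move=> XE e.
  by have := state_diff T_gt0 XE (@F0E (om', y) e); rewrite [ZZ _ - 0]subr0.
have := @collective_unique _ _ T_gt0 _ _ lam
  (fun y => (XX (om, y) - F0 (om, y)) - (XX (om0, y) - F0 (om0, y)))
  (fun y => ZZ (om, y) - ZZ (om0, y)) a c C aC cC mDD iDD.
move=> /(_ _ _)/filterS; apply.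
- by move=> y /eqP; rewrite subr_eq0 => /eqP.
- apply: filterS2 E E0 => y [XE e _] [XE0 e0 _].
  rewrite {1}(dev _ _ XE e) {1}(dev _ _ XE0 e0) -(int_cpathB T_gt0); congr (int_path T _).
  by rewrite opprD addrACA -!scalerBr.
- apply: filterS2 E E0 => y [_ _ bX] [_ _ bX0] t tT.
  (* The aggregates of F0 agree at the two points and drop out, so the difference of the aggregates
     involves the deviations alone and the system closes. *)
  have -> : ZZ (om, y) - ZZ (om0, y) = agg lam (fun z => w y z *:
      ((XX (om, z) - F0 (om, z)) - (XX (om0, z) - F0 (om0, z)))).
    rewrite (ZZagg iX bX) (ZZagg iX0 bX0).
    rewrite (agg_weightedB y iD iD0) (agg_weightedB y iX iF) (agg_weightedB y iX0 iF00).
    by rewrite (generic_state_agg y gom gom0) opprB addrA subrK.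
  have iDDp : integrable_path lam (fun z =>
      (XX (om, z) - F0 (om, z)) - (XX (om0, z) - F0 (om0, z))) by split.
  apply: (le_trans (agg_eval_le T_gt0 (integrable_weighted y iDDp) tT)).
  apply: ge0_le_integral => //.
  + exact: (measurable_EFin_cpath_eval T_gt0 t (integrable_weighted y iDDp).1).
  + exact: (measurable_EFin_cpath_eval T_gt0 t mDD).
  + by move=> z _; rewrite lee_fin cpathZ normrM ler_piMl.
Qed.

(** The aggregate of [XX] splits into those of the deviation and of [F0], each the same at both
    points. *)
Lemma generic_agg m om om0 x : generic m om -> generic m om0 ->
  agg lam (fun y => w x y *: XX (om, y)) = agg lam (fun y => w x y *: XX (om0, y)).
Proof.
move=> gom gom0; have := (gom, gom0).
move=> [[_ iX iF _] [_ iX0 iF00 _]].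
have iD := integrable_pathB T_gt0 iX iF; have iD0 := integrable_pathB T_gt0 iX0 iF00.
have : agg lam (fun y => w x y *: (XX (om, y) - F0 (om, y))) =
    agg lam (fun y => w x y *: (XX (om0, y) - F0 (om0, y))).
  apply: (ae_eq_agg T_gt0 (integrable_weighted x iD) (integrable_weighted x iD0)).
  by apply: filterS (generic_deviation gom gom0) => y ->.
rewrite (agg_weightedB x iX iF) (agg_weightedB x iX0 iF00) (generic_state_agg x gom gom0).
by move=> /addIr.
Qed.

(** * The deterministic aggregate and the versions defined at every index *)

Section deterministic_aggregate.
Variables (m : option rat * (nat * nat) -> R) (om0 : Om).
Hypotheses (aeG : {ae P, forall om, generic m om}) (gom0 : generic m om0).

Definition mean_aggregate x := agg lam (fun y => w x y *: XX (om0, y)).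

Let iX0 : integrable_path lam (fun y => XX (om0, y)).
Proof. by case: gom0. Qed.

Lemma measurable_mean_aggregate : measurable_fun setT mean_aggregate.
Proof. exact: (measurable_agg T_gt0 mw w_le1 iX0). Qed.

Lemma mean_aggregate_norm x :
  `|mean_aggregate x| <= fine (\int[lam]_y (`|XX (om0, y)|)%:E)%E.
Proof.
have iwX := integrable_weighted x iX0.
apply: (le_trans (agg_norm_le T_gt0 iwX)).
apply: (integral_norm_le iwX iX0) => y.
by rewrite normrZ ler_piMl.
Qed.

Lemma generic_aggregate om : generic m om ->
  {ae lam, forall x, ZZ (om, x) = mean_aggregate x}.
Proof.
move=> gom; have [_ iX _ E] := gom.
by apply: filterS E => x [_ _ bX]; rewrite (ZZagg iX bX) (generic_agg x gom gom0).
Qed.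

(** Supplies the measurability that [boxtimes_ae1] asks for; the equality is phrased through the
    norm, a measurable real function. *)
Lemma measurable_aggregate_eq :
  measurable ([set p | `|ZZ p - mean_aggregate p.2| = 0] : set OmI).
Proof.
have mz : measurable_fun setT (fun p : OmI => mean_aggregate p.2).
  apply: (measurable_fun_boxtimes QF (f := fun p => mean_aggregate p.2)).
  exact: (measurableT_comp measurable_mean_aggregate measurable_snd).
have mD : measurable_fun setT (fun p : OmI => ZZ p - mean_aggregate p.2).
  under eq_fun do rewrite -scaleN1r.
  apply: (measurable_cpathD T_gt0); first by case: ZZ2.
  exact: (measurable_cpathZ T_gt0 (@measurable_cst _ _ OmI R setT (-1)) mz).
have mN : measurable_fun setT (fun p : OmI => `|ZZ p - mean_aggregate p.2|).
  exact: (measurableT_comp (@measurable_cpath_norm R T) mD).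
have := mN measurableT _ (measurable_set1 0).
by rewrite setTI.
Qed.

Lemma aggregate_eq : {ae Q, forall p, ZZ p = mean_aggregate p.2}.
Proof.
have := boxtimes_ae1 QF measurable_aggregate_eq.
have H : {ae P, forall om, {ae lam, forall x,
    [set p | `|ZZ p - mean_aggregate p.2| = 0] (om, x)}}.
  apply: filterS (aeG) => om /generic_aggregate; apply: filterS => x /= ->.
  by rewrite subrr normr0.
move=> /(_ H); apply: (@filterS _ _ (ae_filter_ringOfSetsType Q)) => p /= /eqP.
by rewrite normr_eq0 subr_eq0 => /eqP.
Qed.

Lemma probability_aggregate_eq :
  Q [set p | `|ZZ p - mean_aggregate p.2| = 0] = 1%E.
Proof.
have mE := measurable_aggregate_eq.
have : Q (~` [set p | `|ZZ p - mean_aggregate p.2| = 0]) = 0%E.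
  apply: (measure_negligible (measurableC mE)).
  apply: negligibleS (aggregate_eq) => p /= np zp; apply: np.
  by rewrite /= zp subrr normr0.
rewrite probability_setC// => /eqP; rewrite sube_eq ?fin_num_measure// add0e.
  by move=> /eqP <-.
Qed.

Hypothesis energyP : forall x, {ae P, forall om, (energy alpha (x, BB (om, x)) < +oo)%E}.
Variable X : Om * I -> cpath T.
Hypotheses (XQ : square_integrable Q X)
  (XP : forall x, square_integrable P (fun om => X (om, x))).
Hypothesis XE : forall p, (energy alpha (p.2, BB p) < +oo)%E ->
  state_equation (a p.2) (b p.2) (c p.2) (fun t => alpha p.2 t (BB p))
    (mean_aggregate p.2) (BB p) (X p).

Lemma state_version : {ae Q, forall p, X p = XX p}.
Proof.
apply: (@filterS3 _ _ (ae_filter_ringOfSetsType Q) _ _ _ _ _ XXE energyQ aggregate_eq).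
move=> p XXp ep Zp; rewrite Zp in XXp.
exact: (state_unique T_gt0 (XE ep) XXp).
Qed.

(** For almost every omega, two versions differ only on a lam-null set of y, which the weighted
    integral at x does not see. This is how the aggregation equation passes from almost every x to
    every x. *)
Lemma version_aggregate x (Y : Om * I -> cpath T) : square_integrable Q Y ->
  {ae Q, forall p, Y p = XX p} ->
  {ae P, forall om, [/\ integrable_path lam (fun y => Y (om, y)) &
    agg lam (fun y => w x y *: Y (om, y)) = mean_aggregate x]}.
Proof.
move=> Y2 YX.
have iY := integrable_path_section1 T_gt0 QF (square_integrable_path Y2).
apply: filterS3 (aeG) iY (ae_boxtimes1 QF YX) => om gom iYom YXom; split => //.
have [_ iXom _ _] := gom; rewrite /mean_aggregate -(generic_agg x gom gom0).
apply: (ae_eq_agg T_gt0 (integrable_weighted x iYom) (integrable_weighted x iXom)).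
by apply: filterS YXom => y ->.
Qed.

Lemma deterministic_version_solution :
  version_solution P lam Q BB w a b c alpha XX ZZ X (fun p => mean_aggregate p.2).
Proof.
have mz : measurable_fun setT (fun p : OmI => mean_aggregate p.2).
  apply: (measurable_fun_boxtimes QF (f := fun p => mean_aggregate p.2)).
  exact: (measurableT_comp measurable_mean_aggregate measurable_snd).
split.
- split => //; exact: state_version.
- split; first exact: (square_integrable_bounded Q mz (fun p => mean_aggregate_norm p.2)).
  by apply: (@filterS _ _ (ae_filter_ringOfSetsType Q) _ _ _ aggregate_eq) => p ->.
move=> x; split => //.
- have mzx : measurable_fun setT (fun _ : Om => mean_aggregate x).
    exact: measurable_cst.
  by apply: (@square_integrable_bounded _ _ _ _ P _ `|mean_aggregate x| mzx) => om.
- by apply: filterS (energyP x) => om e; exact: (@XE (om, x) e).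
apply: filterS (version_aggregate x XQ state_version) => om [iX Xom] t tT.
have iwX := integrable_weighted x iX.
split; first exact: (integrable_path_eval T_gt0 t iwX).
by rewrite /= -Xom (aggE T_gt0 iwX tT).
Qed.

(** The aggregation equation expresses Z' at x through the class of X', which is that of [XX]; this
    forces Z' at every x, and uniqueness for the state equation then forces X'. *)
Lemma version_solution_unique (X' Z' : Om * I -> cpath T) :
  version_solution P lam Q BB w a b c alpha XX ZZ X' Z' ->
  forall x, {ae P, forall om, X' (om, x) = X (om, x)} /\
            {ae P, forall om, Z' (om, x) = mean_aggregate x}.
Proof.
move=> [[X'2 X'X] [Z'2 Z'Z] sol] x.
have [_ _ X'E Z'E] := sol x.
have Z'x : {ae P, forall om, Z' (om, x) = mean_aggregate x}.
  apply: filterS2 (Z'E) (version_aggregate x X'2 X'X) => om Z'om [iX' <-].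
  apply: (cpath_eq T_gt0) => t tT; have [_ ->] := Z'om t tT.
  by rewrite (aggE T_gt0 (integrable_weighted x iX') tT).
split=> //; apply: filterS3 (X'E) Z'x (energyP x) => om X'om Z'om e.
rewrite Z'om in X'om.
exact: (state_unique T_gt0 X'om (@XE (om, x) e)).
Qed.

End deterministic_aggregate.

End graphon_system.

(** * The index interval and its Borel structure *)

Section index_space.
Variables (R : realType) (J : segment_of R) (calI : set (set (points J))).
Hypothesis calI_borel : forall B : set R, measurable B -> calI (\val @^-1` B).
Notation I := (g_sigma_algebraType calI).

Lemma measurable_position : measurable_fun setT (\val : I -> R).
Proof. by move=> _ B mB; rewrite setTI; apply: sub_sigma_algebra; exact: calI_borel. Qed.

Lemma measurable_borel_points (A : set (borel_points J)) : measurable A ->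
  exists2 B : set R, measurable B & A = \val @^-1` B.
Proof. by move=> [B mB <-]; exists B => //; rewrite setTI. Qed.

Lemma measurable_to_borel_points : measurable_fun setT (id : I -> borel_points J).
Proof.
move=> _ A /measurable_borel_points[B mB ->].
exact: (measurable_position measurableT).
Qed.

Variable w : points J -> points J -> R.
Hypothesis w_meas : measurable_fun setT
  (fun p : borel_points J * borel_points J => w p.1 p.2).

Lemma measurable_graphon : measurable_fun setT (fun p : I * I => w p.1 p.2).
Proof.
have mid : measurable_fun setT
    (fun p : I * I => (p.1 : borel_points J, p.2 : borel_points J)).
  apply: measurable_fun_pair.
    exact: (measurableT_comp measurable_to_borel_points measurable_fst).
  exact: (measurableT_comp measurable_to_borel_points measurable_snd).
exact: (measurableT_comp w_meas mid).
Qed.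

(** Borel measurability of the graphon enters here: its upper level sets in y come from the line and
    not merely from [calI]. *)
Lemma graphon_level_set x s : exists2 B : set R, measurable B &
  [set y | s <= w x y] = \val @^-1` B.
Proof.
apply: measurable_borel_points.
have mwx : measurable_fun setT (fun y : borel_points J => w x y).
  exact: (measurableT_comp w_meas (measurable_pair1 (x : borel_points J))).
have := mwx measurableT _ (measurable_itv `[s, +oo[).
rewrite setTI; congr (measurable _).
by apply/seteqP; split => y /=; rewrite in_itv/= andbT.
Qed.

End index_space.

Theorem theorem2
  (R : realType) (T : R) (T_gt0 : 0 < T)
  (J : segment_of R)
  (calI : set (set (points J))) (calI_sigma : sigma_algebra setT calI)
  (lam : probability (g_sigma_algebraType calI) R)
  (lam_ext : extends_lebesgue lam)
  (d : measure_display) (Om : measurableType d) (P : probability Om R)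
  (W : set (set (Om * g_sigma_algebraType calI)))
  (Q : probability (g_sigma_algebraType W) R)
  (Q_fubini : fubini_extension P lam Q) (Q_rich : rich P lam W)
  (wiener : probability (cpath T) R) (wienerP : wiener_measure wiener)
  (nu : g_sigma_algebraType calI -> probability R R)
  (nu_meas : measurable_fun setT
     (nu : g_sigma_algebraType calI -> pprobability R R))
  (nu_moment : exists C : R, forall x,
     (\int[nu x]_y (y ^+ 2)%:E <= C%:E)%E)
  (BB : Om * g_sigma_algebraType calI -> cpath T * R)
  (BB_noise : noise P lam W wiener nu BB)
  (w : points J -> points J -> R)
  (w_range : forall x y, 0 <= w x y <= 1)
  (w_sym : forall x y, w x y = w y x)
  (w_meas : measurable_fun setT
     (fun p : borel_points J * borel_points J => w p.1 p.2))
  (a b c : g_sigma_algebraType calI -> R)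
  (a_meas : measurable_fun setT a) (b_meas : measurable_fun setT b)
  (c_meas : measurable_fun setT c)
  (abc_bounded : exists C : R, forall x,
     [/\ `|a x| <= C, `|b x| <= C & `|c x| <= C])
  (alpha : g_sigma_algebraType calI -> R -> cpath T * R -> R)
  (alpha_adm : admissible P Q BB alpha)
  (XX ZZ : Om * g_sigma_algebraType calI -> cpath T)
  (XX_sol : solution_L2box lam Q BB w a b c alpha XX ZZ) :
  (exists f : g_sigma_algebraType calI -> cpath T,
     square_integrable lam f /\ Q [set p | `|ZZ p - f p.2| = 0] = 1%E) /\
  (exists X Z : Om * g_sigma_algebraType calI -> cpath T,
     [/\ version_solution P lam Q BB w a b c alpha XX ZZ X Z,
         forall X' Z' : Om * g_sigma_algebraType calI -> cpath T,
           version_solution P lam Q BB w a b c alpha XX ZZ X' Z' ->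
           forall x, {ae P, forall om, X' (om, x) = X (om, x)} /\
                     {ae P, forall om, Z' (om, x) = Z (om, x)} &
         exists g : g_sigma_algebraType calI -> cpath T,
           square_integrable lam g /\ forall om x, Z (om, x) = g x]).
Proof.
have [C abc] := abc_bounded; have [C2 nu2] := nu_moment.
have [mBB BBepi BBlaw] := BB_noise; have [wiener0 _] := wienerP.
have calI_borel (B : set R) : measurable B -> calI (\val @^-1` B).
  by move=> mB; have [] := lam_ext B mB.
have mpos := measurable_position calI_borel.
have mw := measurable_graphon calI_borel w_meas.
have wborel := graphon_level_set w_meas.
have w01 (x y : g_sigma_algebraType calI) : 0 <= w x y <= 1 by exact: w_range.
have [XX2 ZZ2 XXE ZZE] := XX_sol.
have malpha : measurable_fun ([set: g_sigma_algebraType calI] `*` `[0, T] `*` [set: cpath T * R])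
  (fun q : g_sigma_algebraType calI * R * (cpath T * R) => alpha q.1.1 q.1.2 q.2).
  by case: alpha_adm.
have energyQ := ae_energy Q_fubini mBB alpha_adm.
have energyP := ae_energy_section BBlaw alpha_adm.
have stateQ := state_square_integrable_boxtimes T_gt0 Q_fubini wiener0 mBB BBlaw
  a_meas b_meas c_meas abc alpha_adm XX2 ZZ2 XXE.
have stateP := state_square_integrable_section T_gt0 Q_fubini wiener0 nu2 mBB BBlaw
  a_meas b_meas c_meas abc alpha_adm XX2 ZZ2 XXE.
have stateE (z : g_sigma_algebraType calI -> cpath T) (p : Om * g_sigma_algebraType calI)
    (e : (energy alpha (p.2, BB p) < +oo)%E) :=
  state_solution T_gt0 a b c malpha z e.
have lln := state_lln T_gt0 Q_fubini wiener0 mBB BBepi BBlaw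
  a_meas b_meas c_meas abc alpha_adm mpos XX2 ZZ2 XXE.
pose F0 (p : Om * g_sigma_algebraType calI) := state a b c alpha (fun=> 0) (p.2, BB p).
have F02 : square_integrable Q F0.
  apply: (stateQ (fun=> 0) 0) => [|y]; first exact: measurable_cst.
  by rewrite normr0.
have F0E (p : Om * g_sigma_algebraType calI) (e : (energy alpha (p.2, BB p) < +oo)%E) :
  state_equation (a p.2) (b p.2) (c p.2) (fun t => alpha p.2 t (BB p)) 0 (BB p) (F0 p).
  exact: stateE (fun=> 0) p e.
have [m aeG] := ae_generic T_gt0 Q_fubini XX2 XXE ZZE energyQ F02 lln.
(* A set of full measure is nonempty, and any generic point serves: by [generic_agg] they all give
   the same aggregate. *)
have [om0 gom0] := ae_exists aeG.
pose g := mean_aggregate lam w XX om0.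
have mg := measurable_mean_aggregate T_gt0 w01 mw gom0.
have gB := mean_aggregate_norm T_gt0 w01 mw gom0.
have g2 := square_integrable_bounded lam mg gB.
have XQ := stateQ _ _ mg gB.
have XP x := stateP _ _ x mg gB.
(* The state is driven by [g] instead of [ZZ]; as [g] is bounded, its second moments are finite
   under Q and under P at every x. *)
pose X (p : Om * g_sigma_algebraType calI) := state a b c alpha g (p.2, BB p).
have XE (p : Om * g_sigma_algebraType calI) (e : (energy alpha (p.2, BB p) < +oo)%E) :
  state_equation (a p.2) (b p.2) (c p.2) (fun t => alpha p.2 t (BB p)) (g p.2) (BB p) (X p).
  exact: stateE g p e.
split.
  exists g; split; first exact: g2.
  exact: (probability_aggregate_eq T_gt0 Q_fubini abc mpos w01 mw wborel ZZ2 F0E aeG gom0).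
exists X, (fun p => g p.2); split.
- exact: (deterministic_version_solution T_gt0 Q_fubini abc mpos w01 mw wborel ZZ2 XXE
    energyQ F0E aeG gom0 energyP XQ XP XE).
- move=> X' Z' sol x.
  exact: (version_solution_unique T_gt0 Q_fubini abc mpos w01 mw wborel F0E aeG gom0
    energyP XE sol x).
- by exists g; split; first exact: g2.
Qed.
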